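(* Assume that for every $x\in\mathcal X$, $$\eta^2\,\mathrm{Var}[\imath_{P^*,W_1}(x;Y_1)]+(1-\eta)^2\,\mathrm{Var}[\imath_{P^*,W_2}(x;Y_2)]=V,$$ where $Y_k\sim W_k(\cdot|x)$. Then for every $\epsilon\in(0,1/2)$, $$\log M^*_{\mathrm f}(n,\epsilon)=nC-\sqrt{nV}\,Q^{-1}(2\epsilon)+\mathcal O(n^{1/3}\log n)\quad (n\to\infty),$$ i.e., there exist constants $K,n_0$ such that $\big|\log M^*_{\mathrm f}(n,\epsilon)-nC+\sqrt{nV}Q^{-1}(2\epsilon)\big|\le Kn^{1/3}\log n$ for all $n\ge n_0$.
   Context: Setting (CM-DMBC): finite alphabets $\mathcal X=\{1,\dots,N\}$, $\mathcal Y$; transition matrices $W_1,W_2$; given input $x$ the outputs are $(y_1,y_2)$ with probability $W_1(y_1|x)W_2(y_2|x)$, memoryless. For a distribution $P$ on $\mathcal X$: $PW_k(y)=\sum_xP(x)W_k(y|x)$, $\imath_{P,W_k}(x;y)=\log\frac{W_k(y|x)}{PW_k(y)}$ (natural log), $I_k(P)=\sum_xP(x)D(W_k(\cdot|x)\|PW_k)$, $V_k(P)=\sum_xP(x)\mathrm{Var}[\imath_{P,W_k}(x;Y_k)]$ with $Y_k\sim W_k(\cdot|x)$. $C=\max_P\min_kI_k(P)$, $C_k=\max_PI_k(P)$. Standing assumptions: the maximizer $P^*$ of $\min_kI_k$ is unique, $P^*(x)>0$ for all $x$, $V_k:=V_k(P^* )>0$ and $C_k>C$ for $k=1,2$. $P^*_{Y_k}=P^*W_k$;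 for $\mathbf v\in\mathbb R^N$ with entries summing to zero, $\mathrm dI_k(\mathbf v)=\sum_xv_xD(W_k(\cdot|x)\|P^*_{Y_k})$; $\eta\in(0,1)$ is the unique constant with $\eta\,\mathrm dI_1(\mathbf v)+(1-\eta)\mathrm dI_2(\mathbf v)=0$ for all such $\mathbf v$. $V=\eta^2V_1+(1-\eta)^2V_2$. $Q$ is the Gaussian tail function $Q(t)=\int_t^\infty\frac1{\sqrt{2\pi}}e^{-u^2/2}du$. An $(n,M,\epsilon)$-FLF code: encoders $f_i:\{1,\dots,M\}\times\mathcal Y^{i-1}\times\mathcal Y^{i-1}\to\mathcal X$ (possibly randomized), $X_i=f_i(J,Y_1^{i-1},Y_2^{i-1})$ with $J$ uniform on $\{1,\dots,M\}$; decoders $g_k:\mathcal Y^n\to\{1,\dots,M\}$ with $\mathbb P[g_k(Y_k^n)\ne J]\le\epsilon$, $k=1,2$. $M^*_{\mathrm f}(n,\epsilon)$ is the largest $M$ for which an $(n,M,\epsilon)$-FLF code exists. *)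

(* Defs.v *)
From Stdlib Require Import Reals List Arith.
Open Scope R_scope.

(* Alphabets are {0,...,L-1} as natural numbers. *)

Fixpoint sumR (n : nat) (f : nat -> R) : R :=
  match n with O => 0 | S m => sumR m f + f m end.

Fixpoint prodR (n : nat) (f : nat -> R) : R :=
  match n with O => 1 | S m => prodR m f * f m end.

Fixpoint sum_seq (L n : nat) (F : list nat -> R) : R :=
  match n with
  | O => F nil
  | S m => sumR L (fun y => sum_seq L m (fun s => F (y :: s)))
  end.

Definition is_channel (NX NY : nat) (W : nat -> nat -> R) : Prop :=
  forall x, (x < NX)%nat ->
    (forall y, (y < NY)%nat -> 0 <= W x y) /\ sumR NY (fun y => W x y) = 1.

Definition is_dist (NX : nat) (P : nat -> R) : Prop :=
  (forall x, (x < NX)%nat -> 0 <= P x) /\ sumR NX P = 1.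

Definition PW (NX : nat) (P : nat -> R) (W : nat -> nat -> R) (y : nat) : R :=
  sumR NX (fun x => P x * W x y).

Definition info_dens (NX : nat) (P : nat -> R) (W : nat -> nat -> R) (x y : nat) : R :=
  ln (W x y / PW NX P W y).

(* D(W(.|x) || Q), with the convention 0 log 0 = 0 *)
Definition KL (NY : nat) (W : nat -> nat -> R) (x : nat) (Q : nat -> R) : R :=
  sumR NY (fun y => if Rlt_dec 0 (W x y) then W x y * ln (W x y / Q y) else 0).

Definition MI (NX NY : nat) (P : nat -> R) (W : nat -> nat -> R) : R :=
  sumR NX (fun x => P x * KL NY W x (PW NX P W)).

(* Var[ i_{P,W}(x;Y) ], Y ~ W(.|x); the mean of i_{P,W}(x;Y) is D(W(.|x)||PW) *)
Definition var_dens (NX NY : nat) (P : nat -> R) (W : nat -> nat -> R) (x : nat) : R :=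
  sumR NY (fun y => if Rlt_dec 0 (W x y)
                    then W x y * (info_dens NX P W x y - KL NY W x (PW NX P W)) ^ 2
                    else 0).

Definition disp (NX NY : nat) (P : nat -> R) (W : nat -> nat -> R) : R :=
  sumR NX (fun x => P x * var_dens NX NY P W x).

Definition dI (NX NY : nat) (Pstar : nat -> R) (W : nat -> nat -> R) (v : nat -> R) : R :=
  sumR NX (fun x => v x * KL NY W x (PW NX Pstar W)).

(* A deterministic encoder: enc i j y1 y2 is the channel input at time i+1
   (i = 0..n-1) for message j (j = 0..M-1, i.e. message j+1 of the paper),
   given past outputs y1 = Y_1^{i}, y2 = Y_2^{i} (lists of length i). *)
Definition encoder := nat -> nat -> list nat -> list nat -> nat.

Definition joint_prob (n : nat) (W1 W2 : nat -> nat -> R) (f : encoder)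
  (j : nat) (y1 y2 : list nat) : R :=
  prodR n (fun i =>
    let x := f i j (firstn i y1) (firstn i y2) in
    W1 x (nth i y1 O) * W2 x (nth i y2 O)).

Definition err_det (NY n M : nat) (W1 W2 : nat -> nat -> R) (f : encoder)
  (k1 : bool) (g : list nat -> nat) : R :=
  sumR M (fun j => / INR M *
    sum_seq NY n (fun y1 => sum_seq NY n (fun y2 =>
      joint_prob n W1 W2 f j y1 y2 *
      (if Nat.eqb (g (if k1 then y1 else y2)) j then 0 else 1)))).

(* An (n,M,eps)-FLF code exists.  A randomized encoder is a probability
   distribution (pu) over finitely many deterministic encoders (fs u), u < Nu;
   since for fixed n, M there are finitely many deterministic encoders, this
   covers all randomized encoders. *)
Definition FLF_code_exists (NX NY : nat) (W1 W2 : nat -> nat -> R)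
  (n M : nat) (eps : R) : Prop :=
  (1 <= M)%nat /\
  exists (Nu : nat) (pu : nat -> R) (fs : nat -> encoder)
         (g1 g2 : list nat -> nat),
    is_dist Nu pu /\
    (forall u i j y1 y2, (u < Nu)%nat -> (fs u i j y1 y2 < NX)%nat) /\
    sumR Nu (fun u => pu u * err_det NY n M W1 W2 (fs u) true g1) <= eps /\
    sumR Nu (fun u => pu u * err_det NY n M W1 W2 (fs u) false g2) <= eps.

Definition is_Mstar (NX NY : nat) (W1 W2 : nat -> nat -> R)
  (n : nat) (eps : R) (M : nat) : Prop :=
  FLF_code_exists NX NY W1 W2 n M eps /\
  forall M', FLF_code_exists NX NY W1 W2 n M' eps -> (M' <= M)%nat.

Definition gauss_pdf (u : R) : R := / sqrt (2 * PI) * exp (- (u ^ 2) / 2).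

(* gauss_tail t q  :<->  Q(t) = int_t^oo gauss_pdf = q (improper Riemann integral) *)
Definition gauss_tail (t q : R) : Prop :=
  forall e, e > 0 -> exists B, forall b (pr : Riemann_integrable gauss_pdf t b),
    b >= B -> Rabs (RiemannInt pr - q) < e.

(* Main.v *)
(** Write [S_k] for the information density accumulated by user [k] with respect to the output law
    of [Pstar], and [S = eta S_1 + (1 - eta) S_2]. Stationarity and the hypothesis on the
    conditional variances make the increments of [S] have conditional mean [C] and conditional
    variance [V] whatever the encoder does, so [S] is asymptotically Gaussian, uniformly over
    feedback strategies: [Phi ((t - x) / sqrt s)] solves the heat equation, and a Lindeberg
    telescoping along it gives the rate.

    Converse: [S <= log M] forces [S_1 <= log M] or [S_2 <= log M], and a change of measure bounds
    the probability of each of these events by the corresponding error probability, so the two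
    error probabilities add up to at least [P (S <= log M)]; hence the [2 * eps].

    Achievability: send [Pstar]-random codewords for [n - m] uses, with [m ~ n^(2/3)]. Then feedback
    tells the encoder [S_1] and [S_2], and it spends the last [m] uses on input laws at distance
    [n^(-1/6) sqrt (log n)] from [Pstar], which trade information between the users at the rate of the first
    order term [dI] and lose only [O (n^(1/3) log n)] through the second order term. If [S] is large
    enough this brings both users above [log M]; otherwise a fair coin decides which user is
    sacrificed, so that each of them fails with half of the outage probability of [S]. *)
Require Import Defs.
From Coquelicot Require Import Coquelicot.
From Stdlib Require Import Reals List Arith Lra Lia Psatz Classical.
Import ListNotations.
Open Scope R_scope.

(** The length [m] of the last phase balances two costs. Its tilt [tau] must let [m * tau] cover the
    fluctuations of the two sums, of order [sqrt (n log n)], so the curvature loss [m * tau ^ 2] is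
    of order [n log n / m], while the noise of the last phase costs [sqrt (m log n)]; with [m] of
    order [n^(2/3)] both are [O (n^(1/3) log n)]. The Gaussian approximation may then be as poor as
    [n^(-1/6)], since such an error in the probability moves [log M] by only [n^(1/3)].

    The obstacle to random coding is that the decoders do not know which input laws the encoder
    chose in the last phase. Each position of that phase therefore carries two letters, one for each
    of two opposite tilts, and a mode only says when to switch from the first to the second. There
    are [m + 1] modes, so a decoder can add up the likelihood ratios of all of them at a price of
    [O (log n)]. The outage probability is bounded for every codeword, so only atypical behaviour
    and confusion of codewords are averaged when a code is selected. *)

(** * Finite sums over lists and over output sequences *)

Fixpoint lsum {T : Type} (A : list T) (f : T -> R) : R :=
  match A with nil => 0 | t :: A' => f t + lsum A' f end.

Section ListSums.
Context {T : Type}.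
Implicit Types (A : list T) (f g : T -> R).

Lemma lsum_ext A f g : (forall t, In t A -> f t = g t) -> lsum A f = lsum A g.
Proof.
  induction A as [|t A IH]; simpl; intros H; [reflexivity|].
  rewrite H by auto; rewrite IH; auto.
Qed.

Lemma lsum_le A f g : (forall t, In t A -> f t <= g t) -> lsum A f <= lsum A g.
Proof.
  induction A as [|t A IH]; simpl; intros H; [lra|].
  apply Rplus_le_compat; auto.
Qed.

Lemma lsum_plus A f g : lsum A (fun t => f t + g t) = lsum A f + lsum A g.
Proof. induction A as [|t A IH]; simpl; [lra|]; rewrite IH; lra. Qed.

Lemma lsum_scal A k f : lsum A (fun t => k * f t) = k * lsum A f.
Proof. induction A as [|t A IH]; simpl; [lra|]; rewrite IH; lra. Qed.

Lemma lsum_zero A : lsum A (fun _ => 0) = 0.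
Proof. induction A as [|t A IH]; simpl; lra. Qed.

Lemma lsum_nonneg A f : (forall t, In t A -> 0 <= f t) -> 0 <= lsum A f.
Proof. intros H; rewrite <- (lsum_zero A); apply lsum_le; exact H. Qed.

Lemma lsum_ge_term A f t :
  (forall u, In u A -> 0 <= f u) -> In t A -> f t <= lsum A f.
Proof.
  induction A as [|u A IH]; simpl; intros H []; subst.
  - assert (0 <= lsum A f) by (apply lsum_nonneg; auto). lra.
  - assert (f t <= lsum A f) by (apply IH; auto). specialize (H u). intuition lra.
Qed.

Lemma lsum_eq0_term A f t :
  (forall u, In u A -> 0 <= f u) -> In t A -> lsum A f = 0 -> f t = 0.
Proof.
  intros H Ht H0; pose proof (lsum_ge_term A f t H Ht); specialize (H t Ht); lra.
Qed.

Lemma lsum_const_le A f c :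
  (forall t, In t A -> f t <= c) -> lsum A f <= INR (length A) * c.
Proof.
  induction A as [|u A IH]; intros H; [simpl; lra|].
  change (length (u :: A)) with (S (length A)); rewrite S_INR.
  simpl lsum. specialize (IH (fun t Ht => H t (or_intror Ht))).
  specialize (H u (or_introl eq_refl)). lra.
Qed.

Lemma lsum_app A A' f : lsum (A ++ A') f = lsum A f + lsum A' f.
Proof. induction A as [|t A IH]; simpl; [lra|]; rewrite IH; lra. Qed.

(** The source of every random-coding choice below. If all values exceeded [k], the nonnegative
    terms [w t * (f t - k)] would have a nonpositive sum, so all weights would vanish, against total
    mass one. *)
Lemma lsum_average_exists A (w : T -> R) f k :
  (forall t, In t A -> 0 <= w t) -> lsum A w = 1 ->
  lsum A (fun t => w t * f t) <= k -> exists t, In t A /\ f t <= k.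
Proof.
  intros Hw H1 Hk.
  destruct (List.Exists_dec (fun t => f t <= k) A (fun t => Rle_dec (f t) k)) as [HE|HE].
  - apply Exists_exists in HE; exact HE.
  - exfalso. rewrite <- Forall_Exists_neg in HE. rewrite Forall_forall in HE.
    assert (Hpos : lsum A (fun t => w t * (f t - k)) <= 0).
    { rewrite (lsum_ext _ _ (fun t => w t * f t + (- k) * w t)) by (intros; ring).
      rewrite lsum_plus, lsum_scal, H1; lra. }
    assert (Hall : forall t, In t A -> w t = 0).
    { intros t Ht.
      assert (Hge : forall u, In u A -> 0 <= w u * (f u - k)).
      { intros u Hu; specialize (HE u Hu); specialize (Hw u Hu); nra. }
      pose proof (lsum_ge_term A _ t Hge Ht) as H2; cbv beta in H2.
      specialize (HE t Ht); specialize (Hw t Ht).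
      apply Rnot_le_lt in HE. nra. }
    rewrite (lsum_ext A w (fun _ => 0)) in H1 by auto.
    rewrite lsum_zero in H1; lra.
Qed.

End ListSums.

Lemma lsum_swap {T U : Type} (A : list T) (B : list U) (f : T -> U -> R) :
  lsum A (fun t => lsum B (fun u => f t u)) = lsum B (fun u => lsum A (fun t => f t u)).
Proof.
  induction A as [|t A IH]; simpl.
  - symmetry; apply lsum_zero.
  - rewrite IH, <- lsum_plus; reflexivity.
Qed.

Lemma lsum_list_prod {T U : Type} (A : list T) (B : list U) (f : T * U -> R) :
  lsum (list_prod A B) f = lsum A (fun t => lsum B (fun u => f (t, u))).
Proof.
  induction A as [|t A IH]; simpl; [reflexivity|].
  rewrite lsum_app, IH; f_equal; clear IH.
  induction B as [|u B IHB]; simpl; [reflexivity|]; rewrite IHB; reflexivity.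
Qed.

Lemma sumR_lsum n f : sumR n f = lsum (seq 0 n) f.
Proof.
  induction n as [|n IH]; [reflexivity|].
  rewrite seq_S, lsum_app; simpl; rewrite IH; lra.
Qed.

Lemma sumR_ext n f g : (forall i, (i < n)%nat -> f i = g i) -> sumR n f = sumR n g.
Proof.
  intros H; rewrite !sumR_lsum; apply lsum_ext; intros i Hi; apply in_seq in Hi; apply H; lia.
Qed.

Lemma prodR_succ_front n f : prodR (S n) f = f 0%nat * prodR n (fun i => f (S i)).
Proof.
  induction n as [|n IH]; [simpl; ring|].
  change (prodR (S (S n)) f) with (prodR (S n) f * f (S n)).
  rewrite IH; simpl; ring.
Qed.

Lemma sum_seq_ext L n F G :
  (forall s, length s = n -> F s = G s) -> sum_seq L n F = sum_seq L n G.
Proof.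
  revert F G; induction n as [|n IH]; simpl; intros F G H; [apply H; reflexivity|].
  apply sumR_ext; intros y _; apply IH; intros s Hs; apply H; simpl; congruence.
Qed.

Lemma sum_seq_scal L n k F : sum_seq L n (fun s => k * F s) = k * sum_seq L n F.
Proof.
  revert F; induction n as [|n IH]; simpl; intros F; [reflexivity|].
  rewrite !sumR_lsum, <- lsum_scal; apply lsum_ext; intros y _; apply IH.
Qed.

Lemma sum_seq_lsum {T} L n (A : list T) F :
  sum_seq L n (fun s => lsum A (fun t => F s t)) = lsum A (fun t => sum_seq L n (fun s => F s t)).
Proof.
  revert F; induction n as [|n IH]; simpl; intros F; [reflexivity|].
  rewrite sumR_lsum.
  rewrite (lsum_ext _ _ (fun y => lsum A (fun t => sum_seq L n (fun s => F (y :: s) t))))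
    by (intros; apply IH).
  rewrite lsum_swap; apply lsum_ext; intros t _; rewrite sumR_lsum; reflexivity.
Qed.

(** * Expectations under a feedback strategy *)

(** Time is implicit in the length of the past outputs; this makes the remainder of a run, after one
    step, a strategy again. *)
Definition strategy := list nat -> list nat -> nat.

Definition next_strategy (phi : strategy) (a b : nat) : strategy :=
  fun l1 l2 => phi (a :: l1) (b :: l2).

Fixpoint Ex (NY : nat) (W1 W2 : nat -> nat -> R) (n : nat) (phi : strategy)
  (F : list nat -> list nat -> R) : R :=
  match n with
  | O => F nil nil
  | S m => lsum (seq 0 NY) (fun a => lsum (seq 0 NY) (fun b =>
      W1 (phi nil nil) a * W2 (phi nil nil) b *
      Ex NY W1 W2 m (next_strategy phi a b) (fun l1 l2 => F (a :: l1) (b :: l2))))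
  end.

(** Off these paths a transition probability may vanish, and the exponential of a sum of
    log-likelihoods is then no longer the likelihood ratio. *)
Fixpoint path_pos (NY : nat) (W1 W2 : nat -> nat -> R) (phi : strategy) (y1 y2 : list nat) : Prop :=
  match y1, y2 with
  | a :: l1, b :: l2 =>
      (In a (seq 0 NY) /\ 0 < W1 (phi nil nil) a) /\ (In b (seq 0 NY) /\ 0 < W2 (phi nil nil) b) /\
      path_pos NY W1 W2 (next_strategy phi a b) l1 l2
  | _, _ => True
  end.

Fixpoint path_sum (z : nat -> nat -> nat -> R) (phi : strategy) (y1 y2 : list nat) : R :=
  match y1, y2 with
  | a :: l1, b :: l2 => z (phi nil nil) a b + path_sum z (next_strategy phi a b) l1 l2
  | _, _ => 0
  end.

(** Passage from the product formula in the definition of a code to the one-step recursion on which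
    all later inductions run. The message is frozen, and the length of the past supplies the time
    index. *)
Lemma sum_joint_prob NY W1 W2 n (f : encoder) j F :
  sum_seq NY n (fun y1 => sum_seq NY n (fun y2 => joint_prob n W1 W2 f j y1 y2 * F y1 y2)) =
  Ex NY W1 W2 n (fun l1 l2 => f (length l1) j l1 l2) F.
Proof.
  revert f F; induction n as [|n IH]; intros f F.
  - unfold joint_prob; simpl; lra.
  - simpl sum_seq. simpl Ex. rewrite sumR_lsum. apply lsum_ext; intros a _.
    rewrite (sum_seq_ext _ _ _ (fun y1 => lsum (seq 0 NY) (fun b => sum_seq NY n (fun y2 =>
      joint_prob (S n) W1 W2 f j (a :: y1) (b :: y2) * F (a :: y1) (b :: y2)))))
      by (intros; apply sumR_lsum).
    rewrite sum_seq_lsum. apply lsum_ext; intros b _.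
    unfold next_strategy.
    rewrite <- (IH (fun i j l1 l2 => f (S i) j (a :: l1) (b :: l2))).
    rewrite <- sum_seq_scal. apply sum_seq_ext; intros y1 _.
    rewrite <- sum_seq_scal. apply sum_seq_ext; intros y2 _.
    unfold joint_prob at 1. rewrite prodR_succ_front. simpl. unfold joint_prob. ring.
Qed.

Section Expectation.
Context (NX NY : nat) (W1 W2 : nat -> nat -> R).
Local Notation YY := (seq 0 NY).
Implicit Types (phi : strategy) (F G : list nat -> list nat -> R).

Local Notation EX := (Ex NY W1 W2).

Definition valid_strategy phi := forall l1 l2, (phi l1 l2 < NX)%nat.

Lemma valid_next phi a b : valid_strategy phi -> valid_strategy (next_strategy phi a b).
Proof. intros H l1 l2; apply H. Qed.

Lemma Ex_plus n phi F G :
  EX n phi (fun y1 y2 => F y1 y2 + G y1 y2) = EX n phi F + EX n phi G.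
Proof.
  revert phi F G; induction n as [|n IH]; simpl; intros phi F G; [reflexivity|].
  rewrite <- lsum_plus; apply lsum_ext; intros a _.
  rewrite <- lsum_plus; apply lsum_ext; intros b _.
  rewrite (IH _ (fun l1 l2 => F (a :: l1) (b :: l2))); ring.
Qed.

Lemma Ex_scal n phi k F : EX n phi (fun y1 y2 => k * F y1 y2) = k * EX n phi F.
Proof.
  revert phi F; induction n as [|n IH]; simpl; intros phi F; [reflexivity|].
  rewrite <- lsum_scal; apply lsum_ext; intros a _.
  rewrite <- lsum_scal; apply lsum_ext; intros b _.
  rewrite (IH _ (fun l1 l2 => F (a :: l1) (b :: l2))); ring.
Qed.

Lemma Ex_zero n phi : EX n phi (fun _ _ => 0) = 0.
Proof.
  revert phi; induction n as [|n IH]; simpl; intros phi; [reflexivity|].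
  rewrite (lsum_ext _ _ (fun _ => 0)); [apply lsum_zero|]; intros a _.
  rewrite (lsum_ext _ _ (fun _ => 0)); [apply lsum_zero|]; intros b _.
  rewrite IH; ring.
Qed.

Lemma Ex_lsum {T} n phi (A : list T) (F : T -> list nat -> list nat -> R) :
  EX n phi (fun y1 y2 => lsum A (fun t => F t y1 y2)) = lsum A (fun t => EX n phi (F t)).
Proof.
  induction A as [|t A IH]; simpl.
  - apply Ex_zero.
  - rewrite Ex_plus, IH; reflexivity.
Qed.

Lemma Ex_strategy_ext n phi phi' F :
  (forall l1 l2, length l1 = length l2 -> (length l1 < n)%nat -> phi l1 l2 = phi' l1 l2) ->
  EX n phi F = EX n phi' F.
Proof.
  revert phi phi' F; induction n as [|n IH]; simpl; intros phi phi' F H; [reflexivity|].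
  apply lsum_ext; intros a _; apply lsum_ext; intros b _.
  rewrite (H nil nil) by (simpl; lia). f_equal. apply IH.
  intros l1 l2 He Hl; apply H; simpl; lia.
Qed.

Hypothesis (HW1 : is_channel NX NY W1) (HW2 : is_channel NX NY W2).

Lemma channel_nonneg W x y :
  is_channel NX NY W -> (x < NX)%nat -> In y YY -> 0 <= W x y.
Proof. intros H Hx Hy; apply in_seq in Hy; apply (proj1 (H x Hx)); lia. Qed.

Lemma channel_sum W x :
  is_channel NX NY W -> (x < NX)%nat -> lsum YY (W x) = 1.
Proof. intros H Hx; rewrite <- (proj2 (H x Hx)), sumR_lsum; reflexivity. Qed.

Lemma Ex_le n phi F G : valid_strategy phi ->
  (forall y1 y2, length y1 = n -> length y2 = n -> path_pos NY W1 W2 phi y1 y2 ->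
     F y1 y2 <= G y1 y2) ->
  EX n phi F <= EX n phi G.
Proof.
  revert phi F G; induction n as [|n IH]; simpl; intros phi F G Hphi H.
  - apply H; simpl; auto.
  - apply lsum_le; intros a Ha; apply lsum_le; intros b Hb.
    pose proof (channel_nonneg W1 _ a HW1 (Hphi nil nil) Ha) as [H1|H1];
    pose proof (channel_nonneg W2 _ b HW2 (Hphi nil nil) Hb) as [H2|H2];
      try (rewrite <- H1; lra); try (rewrite <- H2; lra).
    apply Rmult_le_compat_l; [apply Rlt_le, Rmult_lt_0_compat; assumption|].
    apply IH; [apply valid_next; assumption|].
    intros y1 y2 L1 L2 Hp; apply H; simpl; try congruence; auto.
Qed.

Lemma Ex_ext n phi F G : valid_strategy phi ->
  (forall y1 y2, length y1 = n -> length y2 = n -> path_pos NY W1 W2 phi y1 y2 ->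
     F y1 y2 = G y1 y2) ->
  EX n phi F = EX n phi G.
Proof.
  intros Hphi H; apply Rle_antisym; apply Ex_le; auto; intros; rewrite H; auto; lra.
Qed.

Lemma Ex_one n phi : valid_strategy phi -> EX n phi (fun _ _ => 1) = 1.
Proof.
  revert phi; induction n as [|n IH]; simpl; intros phi Hphi; [reflexivity|].
  transitivity (lsum YY (W1 (phi [] []))); [|apply channel_sum; auto].
  apply lsum_ext; intros a _.
  rewrite (lsum_ext _ _ (fun b => W1 (phi [] []) a * W2 (phi [] []) b)).
  - rewrite lsum_scal, (channel_sum W2 _ HW2 (Hphi nil nil)); ring.
  - intros b _; rewrite IH by (apply valid_next; assumption); ring.
Qed.

Lemma Ex_const n phi c : valid_strategy phi -> EX n phi (fun _ _ => c) = c.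
Proof.
  intros Hphi. transitivity (EX n phi (fun _ _ => c * 1)).
  - apply Ex_ext; auto; intros; ring.
  - rewrite Ex_scal, Ex_one by assumption; ring.
Qed.

Lemma Ex_nonneg n phi F : valid_strategy phi ->
  (forall y1 y2, 0 <= F y1 y2) -> 0 <= EX n phi F.
Proof.
  intros Hphi H; rewrite <- (Ex_const n phi 0 Hphi); apply Ex_le; auto.
Qed.

Lemma Ex_app n m phi F :
  EX (n + m) phi F =
  EX n phi (fun y1 y2 => EX m (fun l1 l2 => phi (y1 ++ l1) (y2 ++ l2))
     (fun l1 l2 => F (y1 ++ l1) (y2 ++ l2))).
Proof.
  revert phi F; induction n as [|n IH]; simpl; intros phi F; [reflexivity|].
  apply lsum_ext; intros a _; apply lsum_ext; intros b _.
  rewrite IH; reflexivity.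
Qed.

(* The one-step hypothesis says that [U] is a subsolution of the backward equation of
   every controlled walk with increments [z], whatever the control. *)
Lemma Ex_subsolution (z : nat -> nat -> nat -> R) (U : nat -> R -> R) n phi t :
  (forall k s x, (x < NX)%nat ->
     U (S k) s <= lsum YY (fun a => lsum YY (fun b =>
       W1 x a * W2 x b * U k (s + z x a b)))) ->
  valid_strategy phi ->
  U n t <= EX n phi (fun y1 y2 => U 0%nat (t + path_sum z phi y1 y2)).
Proof.
  intros HU; revert phi t; induction n as [|n IH]; intros phi t Hphi.
  - simpl; rewrite Rplus_0_r; lra.
  - eapply Rle_trans; [apply (HU n t (phi nil nil)), Hphi|].
    simpl; apply lsum_le; intros a Ha; apply lsum_le; intros b Hb.
    apply Rmult_le_compat_l.
    + apply Rmult_le_pos; [apply (channel_nonneg W1)|apply (channel_nonneg W2)]; auto.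
    + eapply Rle_trans; [apply (IH (next_strategy phi a b)), valid_next; assumption|].
      apply Ex_le; [apply valid_next; assumption|].
      intros; right; f_equal; ring.
Qed.

End Expectation.

(** Lets results proved for the first output serve for the second user as well. *)
Lemma Ex_swap_users NY W1 W2 n phi F :
  Ex NY W1 W2 n phi F = Ex NY W2 W1 n (fun l1 l2 => phi l2 l1) (fun l1 l2 => F l2 l1).
Proof.
  revert phi F; induction n as [|n IH]; intros phi F; [reflexivity|].
  simpl. rewrite lsum_swap. apply lsum_ext; intros b _; apply lsum_ext; intros a _.
  rewrite IH; unfold next_strategy; ring.
Qed.

(** * Expectations over independent letters *)

(** Used in two roles: for randomly drawn codewords, and, with an output law as weight, for the
    memoryless output measure of the converse. *)
Fixpoint Ec {T : Type} (A : list T) (w : T -> R) (n : nat) (F : list T -> R) : R :=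
  match n with
  | O => F nil
  | S m => lsum A (fun t => w t * Ec A w m (fun c => F (t :: c)))
  end.

Section Codewords.
Context {T : Type} (A : list T) (w : T -> R).
Implicit Types (F G : list T -> R).

Lemma Ec_plus n F G : Ec A w n (fun c => F c + G c) = Ec A w n F + Ec A w n G.
Proof.
  revert F G; induction n as [|n IH]; simpl; intros F G; [reflexivity|].
  rewrite <- lsum_plus; apply lsum_ext; intros t _.
  rewrite (IH (fun c => F (t :: c))); ring.
Qed.

Lemma Ec_scal n k F : Ec A w n (fun c => k * F c) = k * Ec A w n F.
Proof.
  revert F; induction n as [|n IH]; simpl; intros F; [reflexivity|].
  rewrite <- lsum_scal; apply lsum_ext; intros t _.
  rewrite (IH (fun c => F (t :: c))); ring.
Qed.

Lemma Ec_zero n : Ec A w n (fun _ => 0) = 0.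
Proof.
  induction n as [|n IH]; simpl; [reflexivity|].
  rewrite (lsum_ext _ _ (fun _ => 0)); [apply lsum_zero|intros; rewrite IH; ring].
Qed.

Hypothesis (Hw : forall t, In t A -> 0 <= w t).

Lemma Ec_le n F G :
  (forall c, length c = n -> Forall (fun t => In t A) c -> F c <= G c) ->
  Ec A w n F <= Ec A w n G.
Proof.
  revert F G; induction n as [|n IH]; simpl; intros F G H; [apply H; auto|].
  apply lsum_le; intros t Ht; apply Rmult_le_compat_l; auto.
  apply IH; intros c Hc Hf; apply H; simpl; auto.
Qed.

Lemma Ec_ext n F G :
  (forall c, length c = n -> Forall (fun t => In t A) c -> F c = G c) ->
  Ec A w n F = Ec A w n G.
Proof. intros H; apply Rle_antisym; apply Ec_le; intros; rewrite H; auto; lra. Qed.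

Lemma Ec_nonneg n F : (forall c, 0 <= F c) -> 0 <= Ec A w n F.
Proof. intros H; rewrite <- (Ec_zero n); apply Ec_le; auto. Qed.

Hypothesis (Hw1 : lsum A w = 1).

Lemma Ec_const n k : Ec A w n (fun _ => k) = k.
Proof.
  induction n as [|n IH]; simpl; [reflexivity|].
  rewrite (lsum_ext _ _ (fun t => k * w t)) by (intros; rewrite IH; ring).
  rewrite lsum_scal, Hw1; ring.
Qed.

Lemma Ec_lsum {U} n (B : list U) (F : U -> list T -> R) :
  Ec A w n (fun c => lsum B (fun u => F u c)) = lsum B (fun u => Ec A w n (F u)).
Proof.
  induction B as [|u B IH]; simpl; [apply Ec_const|].
  rewrite Ec_plus, IH; reflexivity.
Qed.

Lemma Ec_exists n F k : Ec A w n F <= k ->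
  exists c, length c = n /\ Forall (fun t => In t A) c /\ F c <= k.
Proof.
  revert F k; induction n as [|n IH]; simpl; intros F k H.
  - exists nil; auto.
  - destruct (lsum_average_exists _ _ _ _ Hw Hw1 H) as [t [Ht Hk]].
    destruct (IH _ _ Hk) as [c [Hc [Hf HF]]].
    exists (t :: c); simpl; auto.
Qed.

Lemma Ec_Ex NY W1 W2 n m phi (F : list T -> list nat -> list nat -> R) :
  Ec A w n (fun c => Ex NY W1 W2 m phi (F c)) =
  Ex NY W1 W2 m phi (fun y1 y2 => Ec A w n (fun c => F c y1 y2)).
Proof.
  revert phi F; induction m as [|m IH]; intros phi F; [reflexivity|].
  simpl. rewrite Ec_lsum; apply lsum_ext; intros a _.
  rewrite Ec_lsum; apply lsum_ext; intros b _.
  rewrite Ec_scal, IH; reflexivity.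
Qed.

End Codewords.

(** * The Gaussian distribution function *)

Lemma exp_le_compat (a b : R) : a <= b -> exp a <= exp b.
Proof. intros [H|H]; [apply Rlt_le, exp_increasing; exact H|subst; lra]. Qed.

Lemma is_derive_val (f : R -> R) (x l l' : R) : is_derive f x l -> l = l' -> is_derive f x l'.
Proof. intros H E; rewrite <- E; exact H. Qed.

Lemma derive_mvt (f df : R -> R) (a b : R) : a <= b ->
  (forall t, a <= t <= b -> is_derive f t (df t)) ->
  exists c, a <= c <= b /\ f b - f a = df c * (b - a).
Proof.
  intros Hab D. destruct (MVT_gen f a b df) as [c [Hc HE]];
    rewrite ?Rmin_left, ?Rmax_right in * by exact Hab.
  - intros t Ht; apply D; lra.
  - intros t Ht. apply continuity_pt_filterlim, (ex_derive_continuous f).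
    eexists; apply D; exact Ht.
  - exists c; auto.
Qed.

Lemma derive_zero_const (f : R -> R) (x y : R) : (forall t, is_derive f t 0) -> f x = f y.
Proof.
  intros D. destruct (Rle_dec x y) as [H|H]; [|apply Rnot_le_lt, Rlt_le in H].
  - destruct (derive_mvt f (fun _ => 0) x y H) as [c [_ E]]; [auto|lra].
  - destruct (derive_mvt f (fun _ => 0) y x H) as [c [_ E]]; [auto|lra].
Qed.

Definition bell (u : R) : R := exp (- (u ^ 2) / 2).

Lemma is_derive_bell (u : R) : is_derive bell u (- u * bell u).
Proof. unfold bell; auto_derive; [trivial|]. simpl; unfold Rdiv; field. Qed.

Lemma continuous_bell (u : R) : continuous bell u.
Proof. apply (ex_derive_continuous bell); eexists; apply is_derive_bell. Qed.

Lemma ex_RInt_bell (a b : R) : ex_RInt bell a b.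
Proof. apply (@ex_RInt_continuous R_CompleteNormedModule); intros; apply continuous_bell. Qed.

Lemma is_derive_RInt_bell (x : R) : is_derive (fun x => RInt bell 0 x) x (bell x).
Proof.
  apply (is_derive_RInt bell _ 0 x); [|apply continuous_bell].
  apply filter_forall; intros y; apply (@RInt_correct R_CompleteNormedModule), ex_RInt_bell.
Qed.

(* The kernel of the classical companion integral: its derivative in [x] is
   [- bell x * RInt bell 0 x], which cancels that of [RInt bell 0 x ^ 2 / 2]. *)
Definition companion_kernel (x t : R) : R := exp (- (x ^ 2) * (1 + t ^ 2) / 2) / (1 + t ^ 2).

Definition companion (x : R) : R := RInt (companion_kernel x) 0 1.

Lemma is_derive_companion_kernel (x t : R) :
  is_derive (fun x => companion_kernel x t) x (- x * exp (- (x ^ 2) * (1 + t ^ 2) / 2)).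
Proof.
  unfold companion_kernel; auto_derive; [nra|]. 
  simpl; unfold Rdiv. field. nra.
Qed.

Lemma continuous_companion_kernel (x t : R) : continuous (companion_kernel x) t.
Proof.
  apply (ex_derive_continuous (companion_kernel x)); unfold companion_kernel.
  auto_derive; nra.
Qed.

Lemma is_derive_companion (x : R) : is_derive companion x (- (bell x * RInt bell 0 x)).
Proof.
  assert (HD : forall u v, Derive (fun z => companion_kernel z v) u
     = - u * exp (- (u ^ 2) * (1 + v ^ 2) / 2)).
  { intros; apply is_derive_unique, is_derive_companion_kernel. }
  assert (H : is_derive companion x
    (RInt (fun t => Derive (fun u => companion_kernel u t) x) 0 1)).
  { apply (is_derive_RInt_param companion_kernel 0 1 x).
    - apply filter_forall; intros y t _; eexists; apply is_derive_companion_kernel.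
    - intros t _.
      apply (continuity_2d_pt_ext (fun u v => - u * exp (- (u ^ 2) * (1 + v ^ 2) / 2))).
      { intros; symmetry; apply HD. }
      apply continuity_2d_pt_mult.
      + apply continuity_2d_pt_opp, continuity_2d_pt_id1.
      + apply (continuity_1d_2d_pt_comp exp).
        { apply derivable_continuous_pt, derivable_pt_exp. }
        apply (continuity_2d_pt_ext (fun u v => - (u * u) * (1 + v * v) * / 2)).
        { intros; field. }
        repeat first [ apply continuity_2d_pt_mult | apply continuity_2d_pt_opp
          | apply continuity_2d_pt_plus | apply continuity_2d_pt_const
          | apply continuity_2d_pt_id1 | apply continuity_2d_pt_id2 ].
    - apply filter_forall; intros y; apply (@ex_RInt_continuous R_CompleteNormedModule); intros.
      apply continuous_companion_kernel. }
  replace (- (bell x * RInt bell 0 x)) with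
    (RInt (fun t => Derive (fun u => companion_kernel u t) x) 0 1); [exact H|].
  apply is_RInt_unique.
  apply (is_RInt_ext (fun t => scal (- bell x) (scal x (bell (x * t + 0))))).
  - intros t _. rewrite HD. unfold bell, scal; simpl; unfold mult; simpl.
    replace (- (x * (x * 1)) * (1 + t * (t * 1)) / 2)
      with (- (x * (x * 1)) / 2 + - ((x * t + 0) * ((x * t + 0) * 1)) / 2) by field.
    rewrite exp_plus. ring.
  - replace (- (bell x * RInt bell 0 x)) with (scal (- bell x) (RInt bell 0 x))
      by (unfold scal; simpl; unfold mult; simpl; ring).
    apply (is_RInt_scal (V := R_NormedModule)), (is_RInt_comp_lin bell x 0 0 1).
    replace (x * 0 + 0) with 0 by (simpl; lra). replace (x * 1 + 0) with x by (simpl; lra).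
    apply (@RInt_correct R_CompleteNormedModule), ex_RInt_bell.
Qed.

Lemma companion_0 : companion 0 = PI / 4.
Proof.
  unfold companion. rewrite (RInt_ext _ (fun t => / (1 + t ^ 2))).
  - rewrite <- atan_1. replace (atan 1) with (minus (atan 1) (atan 0))
      by (rewrite atan_0; unfold minus, plus, opp; simpl; ring).
    apply is_RInt_unique, (is_RInt_derive atan (fun t => / (1 + t ^ 2))).
    + intros t _. apply is_derive_Reals, derivable_pt_lim_atan.
    + intros t _. apply (ex_derive_continuous (fun t => / (1 + t ^ 2))). auto_derive; nra.
  - intros t _. unfold companion_kernel.
    replace (- 0 ^ 2 * (1 + t ^ 2) / 2) with 0 by field. rewrite exp_0. simpl; field; nra.
Qed.

Lemma companion_bounds (x : R) : 0 <= companion x <= bell x.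
Proof.
  assert (HE : ex_RInt (companion_kernel x) 0 1)
    by (apply (@ex_RInt_continuous R_CompleteNormedModule); intros; apply continuous_companion_kernel).
  split.
  - apply RInt_ge_0; [lra|exact HE|]. intros t _. unfold companion_kernel.
    apply Rdiv_le_0_compat; [apply Rlt_le, exp_pos|nra].
  - replace (bell x) with (RInt (fun _ => bell x) 0 1)
      by (rewrite RInt_const; unfold scal; simpl; unfold mult; simpl; ring).
    apply RInt_le; [lra|exact HE|apply ex_RInt_const|]. intros t Ht.
    unfold companion_kernel, bell.
    apply Rle_trans with (exp (- x ^ 2 * (1 + t ^ 2) / 2)).
    + apply Rle_div_l; [nra|]. pose proof (exp_pos (- x ^ 2 * (1 + t ^ 2) / 2)). nra.
    + apply exp_le_compat. pose proof (pow2_ge_0 x). pose proof (pow2_ge_0 t). nra.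
Qed.

(** The square plus twice the companion integral has zero derivative, and its value at 0 is
    [PI / 2]. As the companion lies between 0 and [bell x], this gives the Gaussian normalisation
    and a tail bound at once. *)
Lemma RInt_bell_square (x : R) : (RInt bell 0 x) ^ 2 = PI / 2 - 2 * companion x.
Proof.
  set (f := fun x => (RInt bell 0 x) ^ 2 + 2 * companion x).
  assert (Hd : forall y, is_derive f y 0).
  { intros y. unfold f.
    apply (is_derive_val _ _ (plus (INR 2 * bell y * RInt bell 0 y ^ Nat.pred 2)
      (scal 2 (- (bell y * RInt bell 0 y))))).
    - apply (is_derive_plus (fun x => RInt bell 0 x ^ 2)).
      + apply (is_derive_pow (fun x => RInt bell 0 x)), is_derive_RInt_bell.
      + apply (is_derive_scal companion), is_derive_companion.
    - unfold scal, plus; simpl; unfold mult; simpl; ring. }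
  pose proof (derive_zero_const f x 0 Hd) as Hf.
  unfold f in Hf. rewrite RInt_point, companion_0 in Hf.
  unfold zero in Hf; simpl in Hf. simpl. lra.
Qed.

(** Fixing the value [1/2] at 0 avoids an improper integral; that the limits are 0 and 1 is the
    content of the tail bounds below. *)
Definition Phi (x : R) : R := / 2 + RInt gauss_pdf 0 x.

Lemma sqrt_2PI_pos : 0 < sqrt (2 * PI).
Proof. apply sqrt_lt_R0; pose proof PI_RGT_0; lra. Qed.

Lemma gauss_pdf_bell (u : R) : gauss_pdf u = / sqrt (2 * PI) * bell u.
Proof. reflexivity. Qed.

Lemma Phi_bell (x : R) : Phi x = / 2 + / sqrt (2 * PI) * RInt bell 0 x.
Proof.
  unfold Phi. f_equal.
  change (RInt gauss_pdf 0 x = scal (/ sqrt (2 * PI)) (RInt bell 0 x)).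
  rewrite <- RInt_scal by apply ex_RInt_bell. reflexivity.
Qed.

Lemma is_derive_gauss_pdf (u : R) : is_derive gauss_pdf u (- u * gauss_pdf u).
Proof.
  unfold gauss_pdf. replace (- u * (/ sqrt (2 * PI) * exp (- u ^ 2 / 2)))
    with (scal (/ sqrt (2 * PI)) (- u * bell u))
    by (unfold scal, bell; simpl; unfold mult; simpl; ring).
  apply (is_derive_scal bell), is_derive_bell.
Qed.

Lemma continuous_gauss_pdf (u : R) : continuous gauss_pdf u.
Proof. apply (ex_derive_continuous gauss_pdf); eexists; apply is_derive_gauss_pdf. Qed.

Lemma ex_RInt_gauss_pdf (a b : R) : ex_RInt gauss_pdf a b.
Proof. apply (@ex_RInt_continuous R_CompleteNormedModule); intros; apply continuous_gauss_pdf. Qed.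

Lemma is_derive_Phi (x : R) : is_derive Phi x (gauss_pdf x).
Proof.
  unfold Phi. replace (gauss_pdf x) with (plus 0 (gauss_pdf x)) by (unfold plus; simpl; ring).
  apply (is_derive_plus (fun _ => / 2)); [apply (is_derive_const (/ 2))|].
  apply (is_derive_RInt gauss_pdf _ 0 x); [|apply continuous_gauss_pdf].
  apply filter_forall; intros y; apply (@RInt_correct R_CompleteNormedModule), ex_RInt_gauss_pdf.
Qed.

Lemma gauss_pdf_pos (u : R) : 0 < gauss_pdf u.
Proof.
  rewrite gauss_pdf_bell. apply Rmult_lt_0_compat; [apply Rinv_0_lt_compat, sqrt_2PI_pos|apply exp_pos].
Qed.

Lemma Phi_mvt (a b : R) : a <= b -> exists c, a <= c <= b /\ Phi b - Phi a = gauss_pdf c * (b - a).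
Proof.
  intros Hab. apply derive_mvt; [exact Hab|]. intros; apply is_derive_Phi.
Qed.

Lemma Phi_le (a b : R) : a <= b -> Phi a <= Phi b.
Proof.
  intros H; destruct (Phi_mvt a b H) as [c [_ Hc]]. pose proof (gauss_pdf_pos c). nra.
Qed.

Lemma Phi_opp (x : R) : Phi (- x) = 1 - Phi x.
Proof.
  set (f := fun x => Phi (- x) + Phi x).
  assert (Hd : forall y, is_derive f y 0).
  { intros y. unfold f. auto_derive.
    - repeat split; eexists; apply is_derive_Phi.
    - rewrite !(is_derive_unique _ _ _ (is_derive_Phi _)). unfold gauss_pdf.
      replace ((- y) ^ 2) with (y ^ 2) by ring. ring. }
  pose proof (derive_zero_const f x 0 Hd) as Hf.
  unfold f in Hf. rewrite Ropp_0 in Hf. 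
  assert (H0 : Phi 0 = / 2) by (unfold Phi; rewrite RInt_point; unfold zero; simpl; lra).
  lra.
Qed.

Lemma RInt_bell_nonneg (x : R) : 0 <= x -> 0 <= RInt bell 0 x.
Proof.
  intros Hx; apply RInt_ge_0; [exact Hx|apply ex_RInt_bell|].
  intros; apply Rlt_le, exp_pos.
Qed.

(* [Phi x - 1/2] squares to [1/4 - companion x / PI], so the tail is at most [2 companion x / PI]. *)
Lemma Phi_tail (x : R) : 0 <= x -> 1 - bell x <= Phi x <= 1.
Proof.
  intros Hx. rewrite Phi_bell.
  set (G := / sqrt (2 * PI) * RInt bell 0 x).
  assert (HG : G ^ 2 = / 4 - companion x / PI).
  { unfold G. rewrite Rpow_mult_distr, RInt_bell_square, pow_inv, pow2_sqrt
      by (pose proof PI_RGT_0; lra).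
    field. apply PI_neq0. }
  assert (HG0 : 0 <= G).
  { apply Rmult_le_pos; [apply Rlt_le, Rinv_0_lt_compat, sqrt_2PI_pos|apply RInt_bell_nonneg; auto]. }
  pose proof (companion_bounds x) as [Hc0 Hc1]. pose proof PI_RGT_0.
  assert (HPI : 2 < PI) by (pose proof PI2_1; lra).
  assert (0 <= companion x / PI) by (apply Rdiv_le_0_compat; lra).
  assert (companion x / PI <= bell x / 2).
  { apply Rle_div_l; [lra|]. nra. }
  split; nra.
Qed.

Lemma bell_le_inv_square (x : R) : 0 < x -> bell x <= 2 / x ^ 2.
Proof.
  intros Hx. unfold bell. replace (- x ^ 2 / 2) with (- (x ^ 2 / 2)) by field.
  rewrite exp_Ropp. pose proof (exp_ineq1_le (x ^ 2 / 2)).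
  assert (0 < x ^ 2 / 2) by nra.
  replace (2 / x ^ 2) with (/ (x ^ 2 / 2)) by (field; lra).
  apply Rinv_le_contravar; lra.
Qed.

Lemma Phi_lower_tail (x : R) : 0 < x -> 0 <= Phi (- x) <= 2 / x ^ 2.
Proof.
  intros Hx. rewrite Phi_opp. pose proof (Phi_tail x ltac:(lra)).
  pose proof (bell_le_inv_square x Hx). lra.
Qed.

Lemma Phi_nonneg (x : R) : 0 <= Phi x.
Proof.
  destruct (Rle_dec 0 x) as [H|H].
  - unfold Phi. pose proof (RInt_ge_0 gauss_pdf 0 x H (ex_RInt_gauss_pdf 0 x)
      (fun u _ => Rlt_le _ _ (gauss_pdf_pos u))). lra.
  - apply Rnot_le_lt in H. pose proof (Phi_lower_tail (- x) ltac:(lra)) as [H0 _]. rewrite Ropp_involutive in H0. exact H0.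
Qed.

(** The integral from [t] to [b] is [Phi b - Phi t], and [Phi b] tends to 1, so the improper
    integral can only be [1 - Phi t]. *)
Lemma gauss_tail_Phi (t q : R) : gauss_tail t q -> Phi (- t) = q.
Proof.
  intros H. rewrite Phi_opp. apply Rminus_diag_uniq.
  destruct (Req_dec (1 - Phi t - q) 0) as [E|E]; [exact E|exfalso].
  set (e := Rabs (1 - Phi t - q)).
  assert (He : 0 < e) by (apply Rabs_pos_lt; exact E).
  destruct (H (e / 2) ltac:(lra)) as [B HB].
  (* Beyond [B] the hypothesis applies; [b >= 1 + 4 / e] gives [b ^ 2 >= 4 / e], which makes the
     tail bound [2 / b ^ 2] at most [e / 2]. *)
  set (b := Rmax B (Rmax t (1 + 4 / e))).
  assert (Hb1 : B <= b) by apply Rmax_l.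
  assert (Hb2 : t <= b) by (eapply Rle_trans; [apply Rmax_l|apply Rmax_r]).
  assert (Hb3 : 1 + 4 / e <= b) by (eapply Rle_trans; [apply Rmax_r|apply Rmax_r]).
  assert (pr : Riemann_integrable gauss_pdf t b)
    by (apply ex_RInt_Reals_0, ex_RInt_gauss_pdf).
  specialize (HB b pr (Rle_ge _ _ Hb1)).
  rewrite <- RInt_Reals in HB.
  assert (HR : RInt gauss_pdf t b = Phi b - Phi t).
  { unfold Phi. pose proof (RInt_Chasles gauss_pdf 0 t b (ex_RInt_gauss_pdf _ _)
      (ex_RInt_gauss_pdf _ _)) as HCh.
    unfold plus in HCh; simpl in HCh. lra. }
  rewrite HR in HB.
  assert (Hpos : 0 < 4 / e) by (apply Rdiv_lt_0_compat; lra).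
  pose proof (Phi_tail b ltac:(lra)) as [Hl Hu].
  pose proof (bell_le_inv_square b ltac:(lra)) as Hbell.
  assert (Hsmall : 2 / b ^ 2 <= e / 2).
  { apply Rle_div_l; [nra|].
    assert (b <= b ^ 2) by nra. assert (4 / e <= b ^ 2) by lra.
    apply (Rmult_le_compat_l (e / 2)) in H1; [|lra].
    replace (e / 2 * (4 / e)) with 2 in H1 by (field; lra). exact H1. }
  unfold e in *.
  revert HB Hsmall; unfold Rabs; destruct Rcase_abs; destruct Rcase_abs; lra.
Qed.

(** * A Lindeberg argument for controlled walks *)

(** The bell is the square of [exp (- u ^ 2 / 4)], and each factor is controlled by
    [1 + x <= exp x]. This tames every polynomial of degree at most four against the Gaussian
    density. *)
Lemma bell_quartic (u : R) : bell u * (1 + u ^ 2 / 4) ^ 2 <= 1.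
Proof.
  unfold bell. replace (- u ^ 2 / 2) with (- (u ^ 2 / 4) + - (u ^ 2 / 4)) by field.
  rewrite exp_plus. pose proof (exp_ineq1_le (u ^ 2 / 4)).
  assert (H0 : exp (- (u ^ 2 / 4)) * (1 + u ^ 2 / 4) <= 1).
  { rewrite exp_Ropp. apply Rmult_le_reg_l with (exp (u ^ 2 / 4)); [apply exp_pos|].
    rewrite <- Rmult_assoc, Rinv_r by (apply Rgt_not_eq, exp_pos). lra. }
  pose proof (exp_pos (- (u ^ 2 / 4))). pose proof (pow2_ge_0 u).
  assert (0 <= exp (- (u ^ 2 / 4)) * (1 + u ^ 2 / 4)) by (apply Rmult_le_pos; lra).
  set (E := exp (- (u ^ 2 / 4)) * (1 + u ^ 2 / 4)) in *.
  replace (exp (- (u ^ 2 / 4)) * exp (- (u ^ 2 / 4)) * (1 + u ^ 2 / 4) ^ 2) with (E * E)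
    by (unfold E; ring). nra.
Qed.

Lemma inv_sqrt_2PI_le : 0 < / sqrt (2 * PI) <= 1.
Proof.
  split; [apply Rinv_0_lt_compat, sqrt_2PI_pos|].
  rewrite <- Rinv_1. apply Rinv_le_contravar; [lra|].
  rewrite <- sqrt_1. apply sqrt_le_1_alt. pose proof PI2_1; lra.
Qed.

Lemma gauss_pdf_quartic (u : R) : gauss_pdf u <= 1 /\ gauss_pdf u * u ^ 4 <= 16.
Proof.
  rewrite gauss_pdf_bell. pose proof (bell_quartic u). pose proof inv_sqrt_2PI_le.
  assert (0 < bell u) by apply exp_pos.
  pose proof (pow2_ge_0 u) as H2. replace (u ^ 4) with (u ^ 2 * u ^ 2) by ring.
  set (v := u ^ 2) in *. set (c := / sqrt (2 * PI)) in *.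
  assert (Hb : bell u <= 1) by nra.
  assert (Hq : bell u * (v * v) <= 16) by nra.
  assert (0 <= bell u * (v * v)) by (apply Rmult_le_pos; nra).
  split; nra.
Qed.

(** The two bounds of [gauss_pdf_quartic] give [4 * (1 + 16) = 68]; [100] is a round majorant. *)
Lemma gauss_poly_bound (u P : R) :
  Rabs P <= 4 * (1 + u ^ 4) -> Rabs (P * gauss_pdf u) <= 100.
Proof.
  intros HP. rewrite Rabs_mult, (Rabs_right (gauss_pdf u)) by (apply Rle_ge, Rlt_le, gauss_pdf_pos).
  pose proof (gauss_pdf_quartic u) as [H1 H2]. pose proof (gauss_pdf_pos u).
  apply Rle_trans with (4 * (1 + u ^ 4) * gauss_pdf u); [|lra].
  apply Rmult_le_compat_r; lra.
Qed.

Lemma taylor_2 (f f1 f2 : R -> R) (a b K : R) :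
  a <= b -> (forall t, a <= t <= b -> is_derive f t (f1 t)) ->
  (forall t, a <= t <= b -> is_derive f1 t (f2 t)) ->
  (forall t, a <= t <= b -> Rabs (f2 t) <= K) ->
  Rabs (f b - f a - (b - a) * f1 a) <= K * (b - a) ^ 2.
Proof.
  intros Hab D1 D2 HK.
  destruct (derive_mvt f f1 a b Hab D1) as [c [Hc Ec]].
  destruct (derive_mvt f1 f2 a c ltac:(lra)) as [d [Hd Ed]]; [intros; apply D2; lra|].
  rewrite Ec. replace (f1 c * (b - a) - (b - a) * f1 a) with ((f1 c - f1 a) * (b - a)) by ring.
  rewrite Ed, !Rabs_mult. specialize (HK d ltac:(lra)).
  rewrite (Rabs_right (c - a)), (Rabs_right (b - a)) by lra.
  pose proof (Rabs_pos (f2 d)).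
  replace (K * (b - a) ^ 2) with (K * (b - a) * (b - a)) by ring.
  apply Rmult_le_compat_r; [lra|]. apply Rmult_le_compat; lra.
Qed.

Lemma taylor_3 (f f1 f2 f3 : R -> R) (K a h : R) :
  (forall t, is_derive f t (f1 t)) -> (forall t, is_derive f1 t (f2 t)) ->
  (forall t, is_derive f2 t (f3 t)) -> (forall t, Rabs (f3 t) <= K) ->
  Rabs (f (a + h) - f a - h * f1 a - h ^ 2 / 2 * f2 a) <= K * Rabs h ^ 3.
Proof.
  intros D1 D2 D3 HK.
  assert (HK0 : 0 <= K) by (eapply Rle_trans; [apply Rabs_pos|apply (HK 0)]).
  (* The remainder is followed along the segment from [a] to [a + h], parametrised by the unit
     interval, so that both signs of [h] are treated together. *)
  set (psi := fun t => f (a + t * h) - f a - t * h * f1 a - (t * h) ^ 2 / 2 * f2 a).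
  set (psi1 := fun t => h * (f1 (a + t * h) - f1 a - t * h * f2 a)).
  assert (Dpsi : forall t, is_derive psi t (psi1 t)).
  { intros t. unfold psi, psi1. auto_derive.
    - repeat split; eexists; apply D1.
    - rewrite (is_derive_unique _ _ _ (D1 _)). field. }
  destruct (derive_mvt psi psi1 0 1 ltac:(lra) ltac:(intros; apply Dpsi)) as [c [Hc HE]].
  assert (Hin : Rabs (f1 (a + c * h) - f1 a - c * h * f2 a) <= K * h ^ 2).
  { pose proof (taylor_2 (fun t => f1 (a + t * h)) (fun t => h * f2 (a + t * h))
      (fun t => h * (h * f3 (a + t * h))) 0 c (K * h ^ 2) ltac:(lra)) as HT.
    cbv beta in HT. replace (a + 0 * h) with a in HT by ring.
    replace (c * h * f2 a) with ((c - 0) * (h * f2 a)) by ring.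
    eapply Rle_trans; [apply HT|].
    - intros t _. auto_derive; [repeat split; eexists; apply D2|].
      rewrite (is_derive_unique _ _ _ (D2 _)). ring.
    - intros t _. auto_derive; [repeat split; eexists; apply D3|].
      rewrite (is_derive_unique _ _ _ (D3 _)). ring.
    - intros t _. rewrite !Rabs_mult, <- Rmult_assoc, <- Rabs_mult.
      replace (h * h) with (h ^ 2) by ring. rewrite (Rabs_right (h ^ 2)) by nra.
      rewrite Rmult_comm. apply Rmult_le_compat_r; [nra|apply HK].
    - pose proof (pow2_ge_0 h). assert (0 <= K * h ^ 2) by (apply Rmult_le_pos; lra).
      assert ((c - 0) ^ 2 <= 1) by nra. nra. }
  replace (f (a + h) - f a - h * f1 a - h ^ 2 / 2 * f2 a) with (psi 1 - psi 0).
  - rewrite HE. unfold psi1. replace (1 - 0) with 1 by ring. rewrite Rmult_1_r, Rabs_mult.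
    replace (Rabs h ^ 3) with (Rabs h * h ^ 2) by (rewrite <- (pow2_abs h); ring).
    pose proof (Rabs_pos h). nra.
  - unfold psi. replace (a + 1 * h) with (a + h) by ring. replace (a + 0 * h) with a by ring.
    field.
Qed.

Definition gauss_d1 (u : R) : R := - u * gauss_pdf u.
Definition gauss_d2 (u : R) : R := (u ^ 2 - 1) * gauss_pdf u.

Lemma is_derive_gauss_d1 (u : R) : is_derive gauss_d1 u (gauss_d2 u).
Proof.
  unfold gauss_d1, gauss_d2. auto_derive.
  - eexists; apply is_derive_gauss_pdf.
  - rewrite (is_derive_unique _ _ _ (is_derive_gauss_pdf _)). ring.
Qed.

Lemma gauss_d2_bound (u : R) : Rabs (gauss_d2 u) <= 100.
Proof.
  apply gauss_poly_bound. replace (u ^ 4) with (u ^ 2 * u ^ 2) by ring.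
  pose proof (pow2_ge_0 u). set (v := u ^ 2) in *. apply Rabs_le; split; nra.
Qed.

Lemma Phi_taylor (a h : R) :
  Rabs (Phi (a + h) - Phi a - h * gauss_pdf a - h ^ 2 / 2 * gauss_d1 a) <= 100 * Rabs h ^ 3.
Proof.
  apply (taylor_3 Phi gauss_pdf gauss_d1 gauss_d2 100).
  - apply is_derive_Phi.
  - apply is_derive_gauss_pdf.
  - apply is_derive_gauss_d1.
  - apply gauss_d2_bound.
Qed.

(* [Phi (x / sqrt s)] solves the heat equation: its [s]-derivative is half its second [x]-derivative. *)
Lemma Phi_heat_step (x s v : R) : 0 < s -> 0 <= v ->
  Rabs (Phi (x / sqrt (s + v)) - Phi (x / sqrt s) - v * (gauss_d1 (x / sqrt s) / (2 * s)))
  <= 25 / s ^ 2 * v ^ 2.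
Proof.
  intros Hs Hv.
  set (f2 := fun t => (3 * (x / sqrt t) - (x / sqrt t) ^ 3) * gauss_pdf (x / sqrt t) / (4 * t ^ 2)).
  pose proof (taylor_2 (fun t => Phi (x / sqrt t)) (fun t => gauss_d1 (x / sqrt t) / (2 * t))
    f2 s (s + v) (25 / s ^ 2) ltac:(lra)) as HT.
  cbv beta in HT. replace (s + v - s) with v in HT by ring. apply HT; clear HT.
  - intros t Ht. assert (Hst : 0 < sqrt t) by (apply sqrt_lt_R0; lra).
    assert (Ht2 : sqrt t * sqrt t = t) by (apply sqrt_sqrt; lra).
    auto_derive.
    + repeat split; try lra. eexists; apply is_derive_Phi.
    + rewrite (is_derive_unique _ _ _ (is_derive_Phi _)). unfold gauss_d1, Rdiv.
      generalize (gauss_pdf (x * / sqrt t)); intros w. set (r := sqrt t) in *.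
      rewrite <- Ht2. field. lra.
  - intros t Ht. assert (Hst : 0 < sqrt t) by (apply sqrt_lt_R0; lra).
    assert (Ht2 : sqrt t * sqrt t = t) by (apply sqrt_sqrt; lra).
    auto_derive.
    + repeat split; try lra. eexists; apply is_derive_gauss_d1.
    + rewrite (is_derive_unique _ _ _ (is_derive_gauss_d1 _)). unfold f2, gauss_d1, gauss_d2, Rdiv.
      generalize (gauss_pdf (x * / sqrt t)); intros w. set (r := sqrt t) in *.
      rewrite <- Ht2. field. lra.
  - intros t Ht. unfold f2, Rdiv. rewrite Rabs_mult.
    replace (25 * / s ^ 2) with (100 * / (4 * s ^ 2)) by (field; lra).
    apply Rmult_le_compat; try apply Rabs_pos.
    + apply gauss_poly_bound. set (u := x * / sqrt t).
      pose proof (pow2_ge_0 (u ^ 2 - u / 2)). pose proof (pow2_ge_0 (u ^ 2 + u / 2)).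
      pose proof (pow2_ge_0 (u ^ 2 - 1)). pose proof (pow2_ge_0 (u - / 4)).
      pose proof (pow2_ge_0 (u + / 4)). pose proof (pow2_ge_0 u).
      apply Rabs_le; split; nra.
    + rewrite Rabs_right; [|apply Rle_ge, Rlt_le, Rinv_0_lt_compat; nra].
      apply Rinv_le_contravar; nra.
Qed.

Section Lindeberg.
Context {T : Type} (A : list T) (w z : T -> R) (V B : R).
Hypothesis (Hw : forall t, In t A -> 0 <= w t) (Hw1 : lsum A w = 1)
  (Hmean : lsum A (fun t => w t * z t) = 0)
  (Hvar : lsum A (fun t => w t * z t ^ 2) = V)
  (Hbound : forall t, In t A -> 0 < w t -> Rabs (z t) <= B).

(** Both quantities are close to [main]. Averaging the spatial expansion removes the first-order
    term by centring and leaves [V / 2] times the second derivative; by the heat equation, raising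
    the variance from [r ^ 2] to [r ^ 2 + V] produces the same term. *)
Lemma Phi_walk_step x r : 1 <= r ->
  Rabs (lsum A (fun t => w t * Phi ((x + z t) / r)) - Phi (x / sqrt (r ^ 2 + V)))
  <= (100 * B ^ 3 + 25 * V ^ 2) / r ^ 3.
Proof.
  intros Hr.
  assert (HV : 0 <= V).
  { rewrite <- Hvar. apply lsum_nonneg; intros t Ht. apply Rmult_le_pos; [auto|apply pow2_ge_0]. }
  set (a := x / r).
  set (main := Phi a + V / (2 * r ^ 2) * gauss_d1 a).
  assert (H1 : Rabs (lsum A (fun t => w t * Phi ((x + z t) / r)) - main) <= 100 * B ^ 3 / r ^ 3).
  { assert (Hm : main = lsum A (fun t => w t *
      (Phi a + z t / r * gauss_pdf a + (z t / r) ^ 2 / 2 * gauss_d1 a))).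
    { rewrite (lsum_ext _ _ (fun t => Phi a * w t + (/ r * gauss_pdf a * (w t * z t) +
        / (2 * r ^ 2) * gauss_d1 a * (w t * z t ^ 2)))) by (intros; field; lra).
      rewrite !lsum_plus, !lsum_scal, Hw1, Hmean, Hvar. unfold main. field. lra. }
    assert (Hpt : forall t, In t A -> Rabs (w t * Phi ((x + z t) / r) - w t *
      (Phi a + z t / r * gauss_pdf a + (z t / r) ^ 2 / 2 * gauss_d1 a)) <=
       100 * B ^ 3 / r ^ 3 * w t).
    { intros t Ht. destruct (Hw t Ht) as [H0|H0].
      - rewrite <- Rmult_minus_distr_l, Rabs_mult, (Rabs_right (w t)) by lra.
        rewrite Rmult_comm. apply Rmult_le_compat_r; [lra|].
        replace ((x + z t) / r) with (a + z t / r) by (unfold a; field; lra).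
        eapply Rle_trans; [|eapply Rle_trans; [apply (Phi_taylor a (z t / r))|]].
        + right; f_equal; ring.
        + unfold Rdiv. rewrite Rmult_assoc. apply Rmult_le_compat_l; [lra|].
          rewrite Rabs_mult, Rpow_mult_distr.
          rewrite (Rabs_right (/ r)) by (apply Rle_ge, Rlt_le, Rinv_0_lt_compat; lra).
          rewrite pow_inv. apply Rmult_le_compat_r.
          * apply Rlt_le, Rinv_0_lt_compat, pow_lt; lra.
          * apply pow_incr; split; [apply Rabs_pos|auto].
      - rewrite <- H0. rewrite !Rmult_0_l, Rminus_0_r, Rabs_R0; lra. }
    rewrite Hm. apply Rabs_le; split.
    - assert (HL : lsum A (fun t => w t * (Phi a + z t / r * gauss_pdf a +
         (z t / r) ^ 2 / 2 * gauss_d1 a)) <=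
        lsum A (fun t => w t * Phi ((x + z t) / r) + 100 * B ^ 3 / r ^ 3 * w t)).
      { apply lsum_le; intros t Ht. specialize (Hpt t Ht). apply Rabs_le_between in Hpt. lra. }
      rewrite lsum_plus, lsum_scal, Hw1 in HL. lra.
    - assert (HL : lsum A (fun t => w t * Phi ((x + z t) / r)) <=
        lsum A (fun t => w t * (Phi a + z t / r * gauss_pdf a +
         (z t / r) ^ 2 / 2 * gauss_d1 a) + 100 * B ^ 3 / r ^ 3 * w t)).
      { apply lsum_le; intros t Ht. specialize (Hpt t Ht). apply Rabs_le_between in Hpt. lra. }
      rewrite lsum_plus, lsum_scal, Hw1 in HL. lra. }
  assert (H2 : Rabs (Phi (x / sqrt (r ^ 2 + V)) - main) <= 25 * V ^ 2 / r ^ 3).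
  { pose proof (Phi_heat_step x (r ^ 2) V ltac:(nra) HV) as HH.
    rewrite sqrt_pow2 in HH by lra. fold a in HH.
    unfold main. eapply Rle_trans; [|eapply Rle_trans; [apply HH|]].
    - right; f_equal. field. lra.
    - replace (25 / (r ^ 2) ^ 2 * V ^ 2) with (25 * V ^ 2 / r ^ 4) by (field; lra).
      apply Rmult_le_compat_l; [nra|]. apply Rinv_le_contravar; [apply pow_lt; lra|].
      apply Rle_pow; [lra|lia]. }
  apply Rabs_le_between in H1. apply Rabs_le_between in H2.
  replace ((100 * B ^ 3 + 25 * V ^ 2) / r ^ 3)
    with (100 * B ^ 3 / r ^ 3 + 25 * V ^ 2 / r ^ 3) by (field; lra).
  apply Rabs_le. lra.
Qed.

End Lindeberg.

(* [kappa / r] absorbs the per-step error [K / r ^ 3] by telescoping. *)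
Lemma telescoping_inv_sqrt K V r : 0 <= K -> 0 < V -> 1 <= r ->
  let kappa := 2 * K * (1 + V) ^ 2 / V in
  kappa / sqrt (r ^ 2 + V) + K / r ^ 3 <= kappa / r.
Proof.
  intros HK HV Hr kappa.
  set (q := sqrt (r ^ 2 + V)).
  assert (Hq2 : q ^ 2 = r ^ 2 + V) by (apply pow2_sqrt; nra).
  assert (Hq0 : 0 <= q) by apply sqrt_pos.
  assert (Hqr : r < q) by nra.
  assert (Hle : q <= (1 + V) * r) by nra.
  assert (Hk : K / r ^ 3 <= kappa * (/ r - / q)).
  { replace (/ r - / q) with (V / (r * q * (q + r))).
    2:{ replace V with (q ^ 2 - r ^ 2) by lra. field. lra. }
    unfold kappa.
    replace (2 * K * (1 + V) ^ 2 / V * (V / (r * q * (q + r)))) with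
      (K * (2 * (1 + V) ^ 2 / (r * q * (q + r)))) by (field; repeat split; nra).
    unfold Rdiv at 1. apply Rmult_le_compat_l; [lra|].
    assert (Hpos : 0 < r * q * (q + r)) by (repeat apply Rmult_lt_0_compat; lra).
    apply Rle_div_r; [exact Hpos|].
    rewrite Rmult_comm. apply Rle_div_l; [apply pow_lt; lra|].
    assert (Hb : r * q * (q + r) <= r * ((1 + V) * r) * (2 * ((1 + V) * r))).
    { apply Rmult_le_compat; try nra. }
    eapply Rle_trans; [exact Hb|]. right; ring. }
  unfold Rdiv in *. nra.
Qed.

Definition le_ind (s t : R) : R := if Rle_dec s t then 1 else 0.

Lemma path_sum_opp z phi y1 y2 :
  path_sum (fun x a b => - z x a b) phi y1 y2 = - path_sum z phi y1 y2.
Proof.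
  revert phi y2; induction y1 as [|a l1 IH]; intros phi [|b l2]; simpl; try ring.
  rewrite IH; ring.
Qed.

(** Mean and variance are prescribed for each input letter separately, because an encoder with
    feedback may choose the letter as a function of the past. *)
Definition walk_law (NX NY : nat) (W1 W2 : nat -> nat -> R) (z : nat -> nat -> nat -> R) (V B : R) : Prop :=
  forall x, (x < NX)%nat ->
    lsum (seq 0 NY) (fun a => lsum (seq 0 NY) (fun b => W1 x a * W2 x b * z x a b)) = 0 /\
    lsum (seq 0 NY) (fun a => lsum (seq 0 NY) (fun b => W1 x a * W2 x b * z x a b ^ 2)) = V /\
    forall a b, In a (seq 0 NY) -> In b (seq 0 NY) -> Rabs (z x a b) <= B.

Lemma walk_law_opp NX NY W1 W2 z V B : walk_law NX NY W1 W2 z V B ->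
  walk_law NX NY W1 W2 (fun x a b => - z x a b) V B.
Proof.
  intros H x Hx. destruct (H x Hx) as [Hm [Hv Hb]]. repeat split.
  - rewrite <- (Rmult_0_r (-1)), <- Hm, <- lsum_scal. apply lsum_ext; intros a _.
    rewrite <- lsum_scal. apply lsum_ext; intros b _; ring.
  - rewrite <- Hv. apply lsum_ext; intros a _; apply lsum_ext; intros b _; ring.
  - intros a b Ha Hb'. rewrite Rabs_Ropp; auto.
Qed.

Section WalkCLT.
Context (NX NY : nat) (W1 W2 : nat -> nat -> R) (z : nat -> nat -> nat -> R) (V B : R).
Local Notation YY := (seq 0 NY).
Hypothesis (HW1 : is_channel NX NY W1) (HW2 : is_channel NX NY W2)
  (Hz : walk_law NX NY W1 W2 z V B) (HV : 0 < V) (HB : 0 <= B).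

Let K := 100 * B ^ 3 + 25 * V ^ 2.
Definition clt_const := 2 * K * (1 + V) ^ 2 / V.

Lemma clt_const_nonneg : 0 <= clt_const.
Proof.
  unfold clt_const, K. apply Rdiv_le_0_compat; [|lra].
  pose proof (pow_le B 3 HB). pose proof (pow2_ge_0 V).
  repeat apply Rmult_le_pos; nra.
Qed.

(** The standard deviation of [k] remaining steps together with an auxiliary Gaussian of deviation
    [del]. This smoothing keeps the scale at least 1 and bounds the telescoped error by a multiple
    of [1 / del]. *)
Let sg (del : R) (k : nat) := sqrt (del ^ 2 + INR k * V).

Lemma sg_step del k : 1 <= del ->
  1 <= sg del k /\ sg del (S k) = sqrt (sg del k ^ 2 + V).
Proof.
  intros Hd. unfold sg. pose proof (pos_INR k).
  assert (Hp : 1 <= del ^ 2 + INR k * V) by nra.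
  split.
  - rewrite <- sqrt_1. apply sqrt_le_1_alt; exact Hp.
  - rewrite pow2_sqrt by lra. rewrite S_INR. f_equal; ring.
Qed.

Lemma walk_one_step x s r : (x < NX)%nat -> 1 <= r ->
  Rabs (lsum YY (fun a => lsum YY (fun b =>
     W1 x a * W2 x b * Phi ((s + - z x a b) / r))) - Phi (s / sqrt (r ^ 2 + V))) <= K / r ^ 3.
Proof.
  intros Hx Hr.
  destruct (walk_law_opp _ _ _ _ _ _ _ Hz x Hx) as [Hm [Hv Hb]].
  pose proof (Phi_walk_step (list_prod YY YY)
    (fun t => W1 x (fst t) * W2 x (snd t)) (fun t => - z x (fst t) (snd t)) V B) as H.
  rewrite !lsum_list_prod in H. simpl fst in H; simpl snd in H.
  specialize (H ltac:(intros [a b] Hab; apply in_prod_iff in Hab; simpl;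
     apply Rmult_le_pos; [apply (channel_nonneg NX NY W1)|apply (channel_nonneg NX NY W2)]; tauto)).
  assert (H1 : lsum YY (fun t => lsum YY (fun u => W1 x t * W2 x u)) = 1).
  { rewrite (lsum_ext _ _ (fun a => 1 * W1 x a)).
    - rewrite lsum_scal, (channel_sum NX NY W1 x HW1 Hx); ring.
    - intros; rewrite lsum_scal, (channel_sum NX NY W2 x HW2 Hx); ring. }
  specialize (H H1 Hm Hv ltac:(intros [a b] Hab _; apply in_prod_iff in Hab; apply Hb; tauto) s r Hr).
  rewrite lsum_list_prod in H. exact H.
Qed.

(** The Gaussian profile of width [del] centred [d] below the threshold is a smooth minorant of the
    indicator, up to a Gaussian tail at distance [d / del]. Its backward evolution is a subsolution
    up to the error absorbed by [clt_const]. *)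
Lemma walk_cdf_lower n phi del d th : 1 <= del -> 0 < d -> valid_strategy NX phi ->
  Phi ((th - d) / sqrt (del ^ 2 + INR n * V)) - clt_const / del - 2 / (d / del) ^ 2
  <= Ex NY W1 W2 n phi (fun y1 y2 => le_ind (path_sum z phi y1 y2) th).
Proof.
  intros Hdel Hd Hphi.
  pose proof clt_const_nonneg as Hk.
  (* The second term pays for the error of each step; the last one makes the correction vanish at
     [k = 0], so that [U 0] is the pure Gaussian profile. *)
  set (U := fun k s => Phi (s / sg del k) + clt_const / sg del k - clt_const / del).
  pose proof (Ex_subsolution NX NY W1 W2 HW1 HW2 (fun x a b => - z x a b) U n phi (th - d)) as H.
  assert (HU : forall k s x, (x < NX)%nat ->
     U (S k) s <= lsum YY (fun a => lsum YY (fun b =>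
       W1 x a * W2 x b * U k (s + - z x a b)))).
  { intros k s x Hx. unfold U. destruct (sg_step del k Hdel) as [Hr HS].
    rewrite HS. set (r := sg del k) in *.
    pose proof (walk_one_step x s r Hx Hr) as Hst. apply Rabs_le_between in Hst.
    assert (HK0 : 0 <= K).
    { unfold K. pose proof (pow_le B 3 HB). pose proof (pow2_ge_0 V). lra. }
    pose proof (telescoping_inv_sqrt K V r HK0 HV Hr) as Ht. cbv zeta in Ht. fold clt_const in Ht.
    set (c := clt_const / r - clt_const / del).
    rewrite (lsum_ext _ _ (fun a => lsum YY (fun b => W1 x a * W2 x b *
       Phi ((s + - z x a b) / r)) + c * W1 x a)).
    - rewrite lsum_plus, lsum_scal, (channel_sum NX NY W1 x HW1 Hx). unfold c. lra.
    - intros a _. rewrite (lsum_ext _ _ (fun b => W1 x a * W2 x b *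
       Phi ((s + - z x a b) / r) + c * W1 x a * W2 x b)) by (intros; unfold c; ring).
      rewrite lsum_plus, lsum_scal, (channel_sum NX NY W2 x HW2 Hx). ring. }
  specialize (H HU Hphi).
  assert (H0 : Phi ((th - d) / sqrt (del ^ 2 + INR n * V)) - clt_const / del <= U n (th - d)).
  { unfold U, sg. assert (0 <= clt_const / sqrt (del ^ 2 + INR n * V)); [|lra].
    apply Rdiv_le_0_compat; [exact Hk|]. apply sqrt_lt_R0. pose proof (pos_INR n). nra. }
  assert (HX : Ex NY W1 W2 n phi (fun y1 y2 => U 0%nat (th - d + path_sum (fun x a b => - z x a b) phi y1 y2))
    <= Ex NY W1 W2 n phi (fun y1 y2 => le_ind (path_sum z phi y1 y2) th + 2 / (d / del) ^ 2)).
  { apply (Ex_le NX); auto. intros y1 y2 _ _ _.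
    rewrite path_sum_opp. set (S := path_sum z phi y1 y2).
    unfold U, sg. simpl INR. rewrite Rmult_0_l, Rplus_0_r, sqrt_pow2 by lra.
    assert (Hdd : 0 < d / del) by (apply Rdiv_lt_0_compat; lra).
    unfold le_ind. destruct (Rle_dec S th) as [HS|HS].
    - assert (Phi ((th - d + - S) / del) <= 1).
      { destruct (Rle_dec 0 ((th - d + - S) / del)) as [Q|Q].
        - apply Phi_tail; exact Q.
        - apply Rnot_le_lt in Q. pose proof (Phi_opp ((th - d + - S) / del)).
          pose proof (Phi_nonneg (- ((th - d + - S) / del))). lra. }
      assert (0 <= 2 / (d / del) ^ 2) by (apply Rdiv_le_0_compat; [lra|apply pow_lt; lra]). lra.
    - apply Rnot_le_lt in HS. pose proof (Phi_lower_tail (d / del) Hdd).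
      assert (Phi ((th - d + - S) / del) <= Phi (- (d / del))).
      { apply Phi_le. apply Rmult_le_reg_r with del; [lra|].
        unfold Rdiv. rewrite Rmult_assoc, Rinv_l, Rmult_1_r by lra.
        replace (- (d * / del) * del) with (- d) by (field; lra). lra. }
      lra. }
  rewrite Ex_plus, (Ex_const NX NY W1 W2 HW1 HW2 n phi _ Hphi) in HX. lra.
Qed.

End WalkCLT.

(** The lower bound is applied to the reflected walk: the events that the sum is at most [th] and at
    least [th + d] are disjoint. *)
Lemma walk_cdf_upper NX NY W1 W2 z V B n phi del d th :
  is_channel NX NY W1 -> is_channel NX NY W2 -> walk_law NX NY W1 W2 z V B ->
  0 < V -> 0 <= B -> 1 <= del -> 0 < d -> valid_strategy NX phi ->
  Ex NY W1 W2 n phi (fun y1 y2 => le_ind (path_sum z phi y1 y2) th) <=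
  Phi ((th + 2 * d) / sqrt (del ^ 2 + INR n * V)) + clt_const V B / del + 2 / (d / del) ^ 2.
Proof.
  intros HW1 HW2 Hz HV HB Hdel Hd Hphi.
  pose proof (walk_cdf_lower NX NY W1 W2 _ V B HW1 HW2 (walk_law_opp _ _ _ _ _ _ _ Hz) HV HB
    n phi del d (- th - d) Hdel Hd Hphi) as H.
  replace ((- th - d - d) / sqrt (del ^ 2 + INR n * V)) with
    (- ((th + 2 * d) / sqrt (del ^ 2 + INR n * V))) in H.
  2:{ field. apply Rgt_not_eq, sqrt_lt_R0. pose proof (pos_INR n). nra. }
  rewrite Phi_opp in H.
  assert (H2 : Ex NY W1 W2 n phi (fun y1 y2 => le_ind (path_sum z phi y1 y2) th +
     le_ind (path_sum (fun x a b => - z x a b) phi y1 y2) (- th - d)) <= 1).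
  { rewrite <- (Ex_one NX NY W1 W2 HW1 HW2 n phi Hphi). apply (Ex_le NX); auto.
    intros y1 y2 _ _ _. rewrite path_sum_opp. unfold le_ind.
    destruct Rle_dec; destruct Rle_dec; lra. }
  rewrite Ex_plus in H2. lra.
Qed.

(** * Mutual information near the optimal input distribution *)

Lemma ln_le_pred u : 0 < u -> ln u <= u - 1.
Proof. intros H. pose proof (exp_ineq1_le (ln u)) as E. rewrite exp_ln in E by exact H. lra. Qed.

Lemma is_dist_lsum NX P : is_dist NX P ->
  (forall x, In x (seq 0 NX) -> 0 <= P x) /\ lsum (seq 0 NX) P = 1.
Proof.
  intros [H0 H1]; split.
  - intros x Hx; apply in_seq in Hx; apply H0; lia.
  - rewrite <- sumR_lsum; exact H1.
Qed.

Section OneChannel.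
Context (NX NY : nat) (W : nat -> nat -> R) (Pstar : nat -> R).
Hypothesis (HW : is_channel NX NY W) (HPd : is_dist NX Pstar)
  (HPpos : forall x, (x < NX)%nat -> 0 < Pstar x).

Local Notation XX := (seq 0 NX).
Local Notation YY := (seq 0 NY).
Local Notation q := (PW NX Pstar W).

Lemma in_XX x : In x XX -> (x < NX)%nat.
Proof. intros H; apply in_seq in H; lia. Qed.

Lemma W_nonneg x y : In x XX -> In y YY -> 0 <= W x y.
Proof. intros Hx Hy; apply (channel_nonneg NX NY W); auto using in_XX. Qed.

Lemma KL_lsum x Q : (x < NX)%nat -> KL NY W x Q = lsum YY (fun y => W x y * ln (W x y / Q y)).
Proof.
  intros Hx. unfold KL. rewrite sumR_lsum. apply lsum_ext; intros y Hy.
  destruct (Rlt_dec 0 (W x y)) as [H|H]; [reflexivity|].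
  pose proof (channel_nonneg NX NY W x y HW Hx Hy). replace (W x y) with 0 by lra. ring.
Qed.

Lemma var_dens_lsum x : (x < NX)%nat -> var_dens NX NY Pstar W x =
  lsum YY (fun y => W x y * (ln (W x y / q y) - KL NY W x q) ^ 2).
Proof.
  intros Hx. unfold var_dens, info_dens. rewrite sumR_lsum. apply lsum_ext; intros y Hy.
  destruct (Rlt_dec 0 (W x y)) as [H|H]; [reflexivity|].
  pose proof (channel_nonneg NX NY W x y HW Hx Hy). replace (W x y) with 0 by lra. ring.
Qed.

Lemma PW_lsum P y : PW NX P W y = lsum XX (fun x => P x * W x y).
Proof. unfold PW; apply sumR_lsum. Qed.

Lemma PW_nonneg P y : is_dist NX P -> In y YY -> 0 <= PW NX P W y.
Proof.
  intros HP Hy; rewrite PW_lsum; apply lsum_nonneg; intros x Hx.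
  apply Rmult_le_pos; [apply (is_dist_lsum NX P HP); exact Hx|apply W_nonneg; auto].
Qed.

Lemma PW_sum P : lsum XX P = 1 -> lsum YY (PW NX P W) = 1.
Proof.
  intros HP. rewrite (lsum_ext _ _ (fun y => lsum XX (fun x => P x * W x y)))
    by (intros; apply PW_lsum).
  rewrite lsum_swap. rewrite <- HP. apply lsum_ext; intros x Hx.
  rewrite lsum_scal, (channel_sum NX NY W x HW (in_XX x Hx)); ring.
Qed.

Lemma PW_pos P x y : is_dist NX P -> In x XX -> In y YY -> 0 < P x -> 0 < W x y ->
  0 < PW NX P W y.
Proof.
  intros HP Hx Hy HPx HWx. rewrite PW_lsum.
  apply Rlt_le_trans with (P x * W x y); [nra|].
  apply (lsum_ge_term XX (fun x => P x * W x y)); [|exact Hx].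
  intros u Hu. apply Rmult_le_pos; [apply (is_dist_lsum NX P HP); exact Hu|apply W_nonneg; auto].
Qed.

Lemma q_pos x y : In x XX -> In y YY -> 0 < W x y -> 0 < q y.
Proof. intros Hx Hy H; apply (PW_pos Pstar x y); auto; apply HPpos, in_XX, Hx. Qed.

Lemma MI_lsum P : MI NX NY P W =
  lsum XX (fun x => lsum YY (fun y => P x * (W x y * ln (W x y / PW NX P W y)))).
Proof.
  unfold MI. rewrite sumR_lsum. apply lsum_ext; intros x Hx.
  rewrite KL_lsum, lsum_scal by (apply in_XX; exact Hx). reflexivity.
Qed.

Lemma ln_ratio_split a b c : 0 < a -> 0 < b -> 0 < c -> ln (a / b) = ln (a / c) + ln (c / b).
Proof.
  intros Ha Hb Hc. rewrite <- ln_mult; try (apply Rdiv_lt_0_compat; assumption).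
  f_equal; field; lra.
Qed.

Lemma avg_KL_lsum P : lsum XX (fun x => P x * KL NY W x q) =
  lsum XX (fun x => lsum YY (fun y => P x * (W x y * ln (W x y / q y)))).
Proof.
  apply lsum_ext; intros x Hx. rewrite KL_lsum, lsum_scal by (apply in_XX; exact Hx). reflexivity.
Qed.

(** The gap between the two sides is the divergence of the output law of [P] from that of [Pstar];
    [ln u <= u - 1] shows that it is nonnegative. *)
Lemma MI_le_avg_KL P : is_dist NX P -> MI NX NY P W <= lsum XX (fun x => P x * KL NY W x q).
Proof.
  intros HP. destruct (is_dist_lsum NX P HP) as [HP0 HP1].
  destruct (is_dist_lsum NX Pstar HPd) as [_ HS1].
  rewrite MI_lsum, avg_KL_lsum.
  set (e := fun x y => P x * W x y * (q y / PW NX P W y - 1)).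
  apply Rle_trans with (lsum XX (fun x => lsum YY (fun y =>
     P x * (W x y * ln (W x y / q y)) + e x y))).
  - apply lsum_le; intros x Hx; apply lsum_le; intros y Hy. unfold e.
    destruct (HP0 x Hx) as [HPx|HPx]; [|rewrite <- HPx; lra].
    destruct (W_nonneg x y Hx Hy) as [HWx|HWx]; [|rewrite <- HWx; lra].
    pose proof (PW_pos P x y HP Hx Hy HPx HWx) as H1. pose proof (q_pos x y Hx Hy HWx) as H2.
    rewrite (ln_ratio_split (W x y) (PW NX P W y) (q y)) by assumption.
    assert (HL : ln (q y / PW NX P W y) <= q y / PW NX P W y - 1).
    { apply ln_le_pred, Rdiv_lt_0_compat; assumption. }
    assert (0 < P x * W x y) by nra. nra.
  - rewrite (lsum_ext XX _ (fun x => lsum YY (fun y => P x * (W x y * ln (W x y / q y))) +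
      lsum YY (fun y => e x y))) by (intros; apply lsum_plus).
    rewrite lsum_plus. assert (lsum XX (fun x => lsum YY (fun y => e x y)) <= 0); [|lra].
    rewrite (lsum_swap XX YY e).
    apply Rle_trans with (lsum YY (fun y => q y + -1 * PW NX P W y)).
    + apply lsum_le; intros y Hy. unfold e.
      rewrite (lsum_ext _ _ (fun x => (q y / PW NX P W y - 1) * (P x * W x y))) by (intros; ring).
      rewrite lsum_scal, <- PW_lsum. pose proof (PW_nonneg Pstar y HPd Hy).
      destruct (PW_nonneg P y HP Hy) as [Hp|Hp].
      * right; field; lra.
      * rewrite <- Hp; lra.
    + rewrite lsum_plus, lsum_scal, !PW_sum by assumption. lra.
Qed.

Definition shifted (v : nat -> R) (t : R) (x : nat) : R := Pstar x + t * v x.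

(** The chi-square form of the output perturbation; it majorises the second-order loss of the mutual
    information along [v]. *)
Definition curvature (v : nat -> R) : R := lsum YY (fun y => PW NX v W y ^ 2 / q y).

Lemma curvature_nonneg v : 0 <= curvature v.
Proof.
  apply lsum_nonneg; intros y Hy. destruct (PW_nonneg Pstar y HPd Hy) as [H|H].
  - apply Rmult_le_pos; [apply pow2_ge_0|apply Rlt_le, Rinv_0_lt_compat, H].
  - rewrite <- H. unfold Rdiv. rewrite Rinv_0. lra.
Qed.

Lemma PW_shifted v t y : PW NX (shifted v t) W y = q y + t * PW NX v W y.
Proof.
  rewrite !PW_lsum, <- lsum_scal, <- lsum_plus. apply lsum_ext; intros; unfold shifted; ring.
Qed.

Lemma q_zero y : In y YY -> q y = 0 -> forall x, In x XX -> W x y = 0.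
Proof.
  intros Hy H x Hx. rewrite PW_lsum in H.
  assert (E : Pstar x * W x y = 0).
  { apply (lsum_eq0_term XX (fun x => Pstar x * W x y)); auto.
    intros u Hu. apply Rmult_le_pos; [apply Rlt_le, HPpos, in_XX, Hu|apply W_nonneg; auto]. }
  specialize (HPpos x (in_XX x Hx)). apply Rmult_integral in E. destruct E; [lra|assumption].
Qed.

(** The information is the first-order term minus the divergence of the new output law from the old
    one. A divergence is at most the corresponding chi-square distance, which here equals
    [curvature v * t ^ 2] exactly. *)
Lemma MI_shifted_ge v t : lsum XX v = 0 -> is_dist NX (shifted v t) ->
  MI NX NY Pstar W + t * dI NX NY Pstar W v - curvature v * t ^ 2 <= MI NX NY (shifted v t) W.
Proof.
  intros Hv HP. destruct (is_dist_lsum NX _ HP) as [HP0 HP1].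
  set (P := shifted v t) in *. set (e := fun x y => P x * W x y * (PW NX P W y / q y - 1)).
  assert (HL : lsum XX (fun x => P x * KL NY W x q) = MI NX NY Pstar W + t * dI NX NY Pstar W v).
  { unfold MI, dI. rewrite !sumR_lsum, <- lsum_scal, <- lsum_plus.
    apply lsum_ext; intros; unfold P, shifted; ring. }
  rewrite <- HL, avg_KL_lsum, MI_lsum.
  assert (He : lsum XX (fun x => lsum YY (fun y => e x y)) = curvature v * t ^ 2).
  { rewrite (lsum_swap XX YY e).
    rewrite (lsum_ext _ _ (fun y => t * PW NX v W y + t ^ 2 * (PW NX v W y ^ 2 / q y))).
    - rewrite lsum_plus, !lsum_scal. fold (curvature v).
      assert (lsum YY (PW NX v W) = 0) as ->; [|ring].
      rewrite (lsum_ext _ _ (fun y => lsum XX (fun x => v x * W x y)))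
        by (intros; apply PW_lsum).
      rewrite lsum_swap. rewrite <- Hv. apply lsum_ext; intros x Hx.
      rewrite lsum_scal, (channel_sum NX NY W x HW (in_XX x Hx)); ring.
    - intros y Hy. unfold e.
      rewrite (lsum_ext _ _ (fun x => (PW NX P W y / q y - 1) * (P x * W x y))) by (intros; ring).
      rewrite lsum_scal, <- PW_lsum. unfold P. rewrite PW_shifted.
      destruct (PW_nonneg Pstar y HPd Hy) as [Hq|Hq]; [field; lra|].
      assert (Hvz : PW NX v W y = 0).
      { rewrite PW_lsum, (lsum_ext _ _ (fun _ => 0)); [apply lsum_zero|].
        intros x Hx. rewrite (q_zero y Hy (eq_sym Hq) x Hx); ring. }
      rewrite Hvz, <- Hq. unfold Rdiv. ring. }
  assert (Hle : lsum XX (fun x => lsum YY (fun y => P x * (W x y * ln (W x y / q y)))) <=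
    lsum XX (fun x => lsum YY (fun y => P x * (W x y * ln (W x y / PW NX P W y))) + lsum YY (fun y => e x y))).
  { apply lsum_le; intros x Hx; rewrite <- lsum_plus; apply lsum_le; intros y Hy. unfold e.
    destruct (HP0 x Hx) as [HPx|HPx]; [|rewrite <- HPx; lra].
    destruct (W_nonneg x y Hx Hy) as [HWx|HWx]; [|rewrite <- HWx; lra].
    pose proof (PW_pos P x y HP Hx Hy HPx HWx) as H1. pose proof (q_pos x y Hx Hy HWx) as H2.
    rewrite (ln_ratio_split (W x y) (q y) (PW NX P W y)) by assumption.
    assert (ln (PW NX P W y / q y) <= PW NX P W y / q y - 1).
    { apply ln_le_pred, Rdiv_lt_0_compat; assumption. }
    assert (0 < P x * W x y) by nra. nra. }
  rewrite lsum_plus, He in Hle. lra.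
Qed.

(** A sum in place of a maximum. As [ln] is total, it may run over all pairs of letters, those of
    probability zero included. *)
Definition dens_bound : R := lsum XX (fun x => lsum YY (fun y => Rabs (ln (W x y / q y)))).

Lemma dens_bound_nonneg : 0 <= dens_bound.
Proof. apply lsum_nonneg; intros; apply lsum_nonneg; intros; apply Rabs_pos. Qed.

Lemma dens_le_bound x y : In x XX -> In y YY -> Rabs (ln (W x y / q y)) <= dens_bound.
Proof.
  intros Hx Hy. unfold dens_bound.
  eapply Rle_trans; [|apply (lsum_ge_term XX (fun x => lsum YY (fun y => Rabs (ln (W x y / q y)))) x)].
  - apply (lsum_ge_term YY (fun y => Rabs (ln (W x y / q y)))); [intros; apply Rabs_pos|exact Hy].
  - intros; apply lsum_nonneg; intros; apply Rabs_pos.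
  - exact Hx.
Qed.

Lemma shifted_q_range v t y :
  (forall x, In x XX -> Rabs (t * v x) <= Pstar x / 2) -> In y YY ->
  q y / 2 <= PW NX (shifted v t) W y <= 2 * q y.
Proof.
  intros Ht Hy. rewrite PW_shifted. rewrite !PW_lsum.
  assert (Hp : forall x, In x XX -> Rabs (t * (v x * W x y)) <= / 2 * (Pstar x * W x y)).
  { intros x Hx. rewrite <- Rmult_assoc, Rabs_mult.
    pose proof (W_nonneg x y Hx Hy). rewrite (Rabs_right (W x y)) by lra.
    specialize (Ht x Hx). nra. }
  assert (H1 : lsum XX (fun x => t * (v x * W x y)) <= lsum XX (fun x => / 2 * (Pstar x * W x y))).
  { apply lsum_le; intros x Hx; specialize (Hp x Hx).
    eapply Rle_trans; [apply Rle_abs|exact Hp]. }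
  assert (H2 : lsum XX (fun x => - / 2 * (Pstar x * W x y)) <= lsum XX (fun x => t * (v x * W x y))).
  { apply lsum_le; intros x Hx; specialize (Hp x Hx).
    pose proof (Rle_abs (- (t * (v x * W x y)))) as HA. rewrite Rabs_Ropp in HA. lra. }
  rewrite !lsum_scal in H1, H2. 
  assert (0 <= lsum XX (fun x => Pstar x * W x y)).
  { rewrite <- PW_lsum; apply PW_nonneg; auto. }
  lra.
Qed.

Lemma MI_abs_le P b : is_dist NX P ->
  (forall x y, In x XX -> In y YY -> 0 < W x y -> Rabs (ln (W x y / PW NX P W y)) <= b) ->
  Rabs (MI NX NY P W) <= b.
Proof.
  intros HP Hb. destruct (is_dist_lsum NX P HP) as [HP0 HP1].
  assert (Habs : forall x y, In x XX -> In y YY ->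
    - (b * (P x * W x y)) <= P x * (W x y * ln (W x y / PW NX P W y)) <= b * (P x * W x y)).
  { intros x y Hx Hy. destruct (W_nonneg x y Hx Hy) as [HWx|HWx]; [|rewrite <- HWx; lra].
    specialize (Hb x y Hx Hy HWx). specialize (HP0 x Hx).
    assert (0 <= P x * W x y) by nra.
    set (l := ln _) in *. assert (- b <= l <= b).
    { pose proof (Rle_abs l). pose proof (Rle_abs (- l)) as HA. rewrite Rabs_Ropp in HA. lra. }
    replace (P x * (W x y * l)) with ((P x * W x y) * l) by ring. nra. }
  assert (Hone : lsum XX (fun x => lsum YY (fun y => P x * W x y)) = 1).
  { rewrite <- HP1. apply lsum_ext; intros x Hx.
    rewrite lsum_scal, (channel_sum NX NY W x HW (in_XX x Hx)); ring. }
  assert (Hsc : forall k, lsum XX (fun x => lsum YY (fun y => k * (P x * W x y))) = k).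
  { intros k. rewrite (lsum_ext _ _ (fun x => k * lsum YY (fun y => P x * W x y)))
      by (intros; apply lsum_scal). rewrite lsum_scal, Hone; ring. }
  rewrite MI_lsum. apply Rabs_le; split.
  - rewrite <- (Hsc (- b)). apply lsum_le; intros x Hx; apply lsum_le; intros y Hy.
    specialize (Habs x y Hx Hy). lra.
  - rewrite <- (Hsc b). apply lsum_le; intros x Hx; apply lsum_le; intros y Hy.
    specialize (Habs x y Hx Hy). lra.
Qed.

(** The shift changes output probabilities by a factor between [1/2] and [2], hence log-densities by
    at most 1; subtracting the mean doubles the bound. *)
Lemma shifted_dens_bound v t : is_dist NX (shifted v t) ->
  (forall x, In x XX -> Rabs (t * v x) <= Pstar x / 2) ->
  forall x y, In x XX -> In y YY -> 0 < W x y ->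
    0 < PW NX (shifted v t) W y /\
    Rabs (ln (W x y / PW NX (shifted v t) W y) - MI NX NY (shifted v t) W) <= 2 * (dens_bound + 1).
Proof.
  intros HP Ht.
  assert (Hq : forall x y, In x XX -> In y YY -> 0 < W x y -> 0 < PW NX (shifted v t) W y /\
    Rabs (ln (W x y / PW NX (shifted v t) W y)) <= dens_bound + 1).
  { intros x y Hx Hy HWx. pose proof (q_pos x y Hx Hy HWx) as Hq.
    pose proof (shifted_q_range v t y Ht Hy) as [H1 H2]. split; [lra|].
    rewrite (ln_ratio_split (W x y) (PW NX (shifted v t) W y) (q y)) by lra.
    eapply Rle_trans; [apply Rabs_triang|].
    apply Rplus_le_compat; [apply dens_le_bound; auto|].
    set (r := q y / PW NX (shifted v t) W y).
    assert (Hr : / 2 <= r <= 2).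
    { unfold r; split.
      - apply Rmult_le_reg_r with (PW NX (shifted v t) W y); [lra|].
        unfold Rdiv; rewrite Rmult_assoc, Rinv_l by lra. lra.
      - apply Rmult_le_reg_r with (PW NX (shifted v t) W y); [lra|].
        unfold Rdiv; rewrite Rmult_assoc, Rinv_l by lra. lra. }
    assert (Hinv : / r <= 2).
    { rewrite <- (Rinv_inv 2). apply Rinv_le_contravar; lra. }
    pose proof (ln_le_pred r ltac:(lra)).
    pose proof (ln_le_pred (/ r) ltac:(apply Rinv_0_lt_compat; lra)) as Hi.
    rewrite ln_Rinv in Hi by lra.
    apply Rabs_le; lra. }
  intros x y Hx Hy HWx. destruct (Hq x y Hx Hy HWx) as [Hp Hb]. split; [exact Hp|].
  pose proof (MI_abs_le (shifted v t) (dens_bound + 1) HP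
    (fun x y Hx Hy HWx => proj2 (Hq x y Hx Hy HWx))) as HM.
  unfold Rminus. eapply Rle_trans; [apply Rabs_triang|]. rewrite Rabs_Ropp. lra.
Qed.

End OneChannel.

Section TwoChannels.
Context (NX NY : nat) (W1 W2 : nat -> nat -> R) (Pstar : nat -> R) (eta : R).
Hypothesis (HW1 : is_channel NX NY W1) (HW2 : is_channel NX NY W2)
  (HPd : is_dist NX Pstar) (HPpos : forall x, (x < NX)%nat -> 0 < Pstar x).
Hypothesis (HPmax : forall P, is_dist NX P ->
      Rmin (MI NX NY P W1) (MI NX NY P W2) <= Rmin (MI NX NY Pstar W1) (MI NX NY Pstar W2)).
Hypothesis (HC1 : exists P, is_dist NX P /\
      MI NX NY P W1 > Rmin (MI NX NY Pstar W1) (MI NX NY Pstar W2))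
  (HC2 : exists P, is_dist NX P /\
      MI NX NY P W2 > Rmin (MI NX NY Pstar W1) (MI NX NY Pstar W2)).
Hypothesis (Heta01 : 0 < eta < 1)
  (Heta : forall v, sumR NX v = 0 ->
      eta * dI NX NY Pstar W1 v + (1 - eta) * dI NX NY Pstar W2 v = 0).

Local Notation XX := (seq 0 NX).
Local Notation YY := (seq 0 NY).
Local Notation I1 := (MI NX NY Pstar W1).
Local Notation I2 := (MI NX NY Pstar W2).
Local Notation D1 x := (KL NY W1 x (PW NX Pstar W1)).
Local Notation D2 x := (KL NY W2 x (PW NX Pstar W2)).

(** The direction from [Pstar] to the point mass at [x0]. *)
Definition toward (x0 x : nat) : R := (if Nat.eqb x x0 then 1 else 0) - Pstar x.

Lemma lsum_point (A : list nat) x0 (f : nat -> R) : NoDup A -> In x0 A ->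
  lsum A (fun x => (if Nat.eqb x x0 then 1 else 0) * f x) = f x0.
Proof.
  induction A as [|a A IH]; simpl; intros Hn Hi; [contradiction|].
  inversion Hn as [|? ? Hna HnA]; subst.
  destruct (Nat.eqb_spec a x0) as [E|E].
  - subst a. rewrite (lsum_ext A _ (fun _ => 0)); [rewrite lsum_zero; ring|].
    intros x Hx. destruct (Nat.eqb_spec x x0); [subst; contradiction|ring].
  - destruct Hi as [Hi|Hi]; [contradiction|]. rewrite IH by assumption. ring.
Qed.

Lemma dI_toward W x0 : (x0 < NX)%nat ->
  dI NX NY Pstar W (toward x0) = KL NY W x0 (PW NX Pstar W) - MI NX NY Pstar W.
Proof.
  intros Hx. unfold dI, MI. rewrite !sumR_lsum.
  rewrite (lsum_ext _ _ (fun x => (if Nat.eqb x x0 then 1 else 0) * KL NY W x (PW NX Pstar W)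
    + -1 * (Pstar x * KL NY W x (PW NX Pstar W)))) by (intros; unfold toward; ring).
  rewrite lsum_plus, lsum_scal, lsum_point; [ring|apply seq_NoDup|apply in_seq; lia].
Qed.

Lemma sumR_toward x0 : (x0 < NX)%nat -> sumR NX (toward x0) = 0.
Proof.
  intros Hx. rewrite sumR_lsum.
  rewrite (lsum_ext _ _ (fun x => (if Nat.eqb x x0 then 1 else 0) * 1 + -1 * Pstar x))
    by (intros; unfold toward; ring).
  rewrite lsum_plus, lsum_scal, (lsum_point XX x0 (fun _ => 1)), (proj2 (is_dist_lsum NX Pstar HPd));
    [ring|apply seq_NoDup|apply in_seq; lia].
Qed.

(** Stationarity tested in the direction of a point mass. Consequently no choice of input can
    influence the conditional mean of the mixed density. *)
Lemma weighted_KL x : (x < NX)%nat -> eta * D1 x + (1 - eta) * D2 x = eta * I1 + (1 - eta) * I2.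
Proof.
  intros Hx. pose proof (Heta (toward x) (sumR_toward x Hx)) as H.
  rewrite !dI_toward in H by exact Hx. lra.
Qed.

Lemma MI_le_of_const_KL W P c : is_channel NX NY W -> is_dist NX P ->
  (forall x, (x < NX)%nat -> KL NY W x (PW NX Pstar W) = c) -> MI NX NY P W <= c.
Proof.
  intros HW HP Hc. eapply Rle_trans; [apply (MI_le_avg_KL NX NY W Pstar); auto|].
  rewrite (lsum_ext _ _ (fun x => c * P x)).
  - rewrite lsum_scal, (proj2 (is_dist_lsum NX P HP)); lra.
  - intros x Hx; rewrite Hc by (apply (in_XX NX), Hx); ring.
Qed.

(** If all divergences of user 1 were equal, stationarity would make those of user 2 equal too. Then
    [Pstar] would maximise each information separately, although [C] is one of the two values and
    both capacities exceed it. Hence some point mass gives a direction with nonzero [dI], and it is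
    rescaled so that the gain of one user matches the loss of the other in the ratio of the
    weights. *)
Lemma exists_trade_direction : exists v, sumR NX v = 0 /\
  dI NX NY Pstar W1 v = 1 - eta /\ dI NX NY Pstar W2 v = - eta.
Proof.
  destruct (classic (exists x, (x < NX)%nat /\ D1 x <> I1)) as [[x [Hx HD]]|HN].
  - set (k := (1 - eta) / (D1 x - I1)).
    assert (Hk : k * (D1 x - I1) = 1 - eta) by (unfold k; field; lra).
    exists (fun y => k * toward x y).
    assert (HdI : forall W, dI NX NY Pstar W (fun y => k * toward x y) =
      k * dI NX NY Pstar W (toward x)).
    { intros W. unfold dI. rewrite !sumR_lsum, <- lsum_scal. apply lsum_ext; intros; ring. }
    assert (H0 : sumR NX (fun y => k * toward x y) = 0).
    { rewrite sumR_lsum, lsum_scal, <- sumR_lsum, sumR_toward by exact Hx; ring. }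
    pose proof (Heta _ H0) as H.
    assert (H1 : dI NX NY Pstar W1 (fun y => k * toward x y) = 1 - eta).
    { rewrite HdI, dI_toward by exact Hx. exact Hk. }
    repeat split; auto. rewrite H1 in H. nra.
  - exfalso.
    assert (E1 : forall x, (x < NX)%nat -> D1 x = I1).
    { intros x Hx. apply NNPP; intros HH; apply HN; exists x; auto. }
    assert (E2 : forall x, (x < NX)%nat -> D2 x = I2).
    { intros x Hx. pose proof (weighted_KL x Hx) as H. rewrite (E1 x Hx) in H. nra. }
    destruct HC1 as [P1 [HP1 G1]]. destruct HC2 as [P2 [HP2 G2]].
    pose proof (MI_le_of_const_KL W1 P1 I1 HW1 HP1 E1).
    pose proof (MI_le_of_const_KL W2 P2 I2 HW2 HP2 E2).
    unfold Rmin in G1, G2. destruct Rle_dec; lra.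
Qed.

(** The sum dominates each relative perturbation, so steps up to this size change every probability
    by at most half of itself. *)
Definition small_shift (v : nat -> R) : R := / (1 + lsum XX (fun x => 2 * Rabs (v x) / Pstar x)).

Lemma small_shift_pos v : 0 < small_shift v.
Proof.
  apply Rinv_0_lt_compat.
  assert (0 <= lsum XX (fun x => 2 * Rabs (v x) / Pstar x)); [|lra].
  apply lsum_nonneg; intros x Hx. pose proof (HPpos x (in_XX NX x Hx)). pose proof (Rabs_pos (v x)).
  apply Rmult_le_pos; [lra|apply Rlt_le, Rinv_0_lt_compat; lra].
Qed.

Lemma small_shift_le_1 v : small_shift v <= 1.
Proof.
  pose proof (small_shift_pos v) as Hs. unfold small_shift in *.
  rewrite <- Rinv_1. apply Rinv_le_contravar; [lra|].
  assert (0 <= lsum XX (fun x => 2 * Rabs (v x) / Pstar x)); [|lra].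
  apply lsum_nonneg; intros x Hx. pose proof (HPpos x (in_XX NX x Hx)).
  pose proof (Rabs_pos (v x)).
  apply Rmult_le_pos; [lra|apply Rlt_le, Rinv_0_lt_compat; lra].
Qed.

Lemma small_shift_spec v t x : Rabs t <= small_shift v -> In x XX ->
  Rabs (t * v x) <= Pstar x / 2.
Proof.
  intros Ht Hx. pose proof (HPpos x (in_XX NX x Hx)) as HP.
  set (S := lsum XX (fun x => 2 * Rabs (v x) / Pstar x)).
  assert (HS : 2 * Rabs (v x) / Pstar x <= S).
  { apply (lsum_ge_term XX (fun x => 2 * Rabs (v x) / Pstar x)); [|exact Hx].
    intros u Hu. pose proof (HPpos u (in_XX NX u Hu)). pose proof (Rabs_pos (v u)).
    apply Rmult_le_pos; [lra|apply Rlt_le, Rinv_0_lt_compat; lra]. }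
  assert (HS0 : 0 < 1 + S).
  { pose proof (small_shift_pos v) as H. unfold small_shift in H. fold S in H.
    rewrite <- (Rinv_inv (1 + S)). apply Rinv_0_lt_compat; exact H. }
  rewrite Rabs_mult. unfold small_shift in Ht; fold S in Ht.
  assert (Hv : 2 * Rabs (v x) <= S * Pstar x).
  { apply (Rmult_le_compat_r (Pstar x)) in HS; [|lra].
    unfold Rdiv in HS. rewrite Rmult_assoc, Rinv_l, Rmult_1_r in HS by lra. exact HS. }
  assert (Ht2 : Rabs t * (1 + S) <= 1).
  { apply (Rmult_le_compat_r (1 + S)) in Ht; [|lra]. rewrite Rinv_l in Ht by lra. exact Ht. }
  pose proof (Rabs_pos t). pose proof (Rabs_pos (v x)).
  assert (Rabs t * (2 * Rabs (v x)) <= Rabs t * ((1 + S) * Pstar x)).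
  { apply Rmult_le_compat_l; [lra|]. nra. }
  nra.
Qed.

Lemma shifted_is_dist v t : sumR NX v = 0 -> Rabs t <= small_shift v ->
  is_dist NX (shifted Pstar v t).
Proof.
  intros Hv Ht; split.
  - intros x Hx. pose proof (small_shift_spec v t x Ht ltac:(apply in_seq; lia)) as H.
    pose proof (HPpos x Hx). unfold shifted.
    pose proof (Rle_abs (- (t * v x))) as HA. rewrite Rabs_Ropp in HA. lra.
  - rewrite sumR_lsum. unfold shifted. rewrite lsum_plus, lsum_scal, <- !sumR_lsum, Hv, (proj2 HPd); ring.
Qed.

Lemma MI_balanced : I1 = I2.
Proof.
  destruct exists_trade_direction as [v [Hv [Hd1 Hd2]]].
  set (k1 := curvature NX NY W1 Pstar v). set (k2 := curvature NX NY W2 Pstar v).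
  assert (Hk1 : 0 <= k1) by (apply (curvature_nonneg NX NY W1 Pstar HW1 HPd)).
  assert (Hk2 : 0 <= k2) by (apply (curvature_nonneg NX NY W2 Pstar HW2 HPd)).
  assert (HvL : lsum XX v = 0) by (rewrite <- sumR_lsum; exact Hv).
  assert (Hexp : forall t, Rabs t <= small_shift v ->
    is_dist NX (shifted Pstar v t) /\
    I1 + t * (1 - eta) - k1 * t ^ 2 <= MI NX NY (shifted Pstar v t) W1 /\
    I2 - t * eta - k2 * t ^ 2 <= MI NX NY (shifted Pstar v t) W2).
  { intros t Ht. pose proof (shifted_is_dist v t Hv Ht) as HD. split; [exact HD|].
    pose proof (MI_shifted_ge NX NY W1 Pstar HW1 HPd HPpos v t HvL HD) as H1.
    pose proof (MI_shifted_ge NX NY W2 Pstar HW2 HPd HPpos v t HvL HD) as H2.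
    rewrite Hd1 in H1. rewrite Hd2 in H2. fold k1 in H1. fold k2 in H2. lra. }
  (* A small step along [v] or [- v] would raise the smaller information and keep it the smaller one. *)
  assert (Hraise : forall s d d' W W', Rabs s = 1 -> 0 < d -> d' <= 1 ->
    (forall P, is_dist NX P -> Rmin (MI NX NY P W) (MI NX NY P W') <=
       Rmin (MI NX NY Pstar W) (MI NX NY Pstar W')) ->
    (forall t, Rabs (s * t) <= small_shift v ->
      MI NX NY Pstar W + t * d - (k1 + k2) * t ^ 2 <= MI NX NY (shifted Pstar v (s * t)) W /\
      MI NX NY Pstar W' - t * d' - (k1 + k2) * t ^ 2 <= MI NX NY (shifted Pstar v (s * t)) W') ->
    ~ MI NX NY Pstar W < MI NX NY Pstar W').
  { intros s d d' W W' Hs Hd Hd' Hmax Hgain Hlt.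
    set (gap := MI NX NY Pstar W' - MI NX NY Pstar W).
    assert (Hgap : 0 < gap) by (unfold gap; lra).
    pose proof (small_shift_pos v) as Hs0. pose proof (small_shift_le_1 v) as Hs1.
    (* With this step the quadratic loss is at most half of the linear gain of the smaller
       information, and the larger one falls by at most half the gap. *)
    set (t := Rmin (small_shift v) (Rmin gap d / (2 * (1 + k1 + k2)))).
    assert (Hm : 0 < Rmin gap d / (2 * (1 + k1 + k2))).
    { apply Rdiv_lt_0_compat; [apply Rmin_glb_lt; lra|lra]. }
    assert (Ht0 : 0 < t) by (apply Rmin_glb_lt; assumption).
    assert (Hts : t <= small_shift v) by apply Rmin_l.
    assert (Htr : t * (2 * (1 + k1 + k2)) <= Rmin gap d).
    { apply Rle_trans with (Rmin gap d / (2 * (1 + k1 + k2)) * (2 * (1 + k1 + k2))).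
      - apply Rmult_le_compat_r; [lra|apply Rmin_r].
      - right; field; lra. }
    pose proof (Rmin_l gap d). pose proof (Rmin_r gap d).
    assert (Hkt : 0 <= t * (k1 + k2)) by (apply Rmult_le_pos; lra).
    assert (Hst : Rabs (s * t) <= small_shift v) by (rewrite Rabs_mult, Hs, Rabs_right; lra).
    destruct (Hgain t Hst) as [E1 E2].
    specialize (Hmax _ (shifted_is_dist v (s * t) Hv Hst)).
    rewrite (Rmin_left (MI NX NY Pstar W)) in Hmax by lra.
    apply (Rle_not_lt _ _ Hmax).
    replace ((k1 + k2) * t ^ 2) with (t * (t * (k1 + k2))) in * by ring.
    apply Rmin_glb_lt.
    - assert (t * (t * (k1 + k2)) < t * d) by (apply Rmult_lt_compat_l; lra). lra.
    - assert (t * (t * (k1 + k2)) <= 1 * (t * (k1 + k2))) by (apply Rmult_le_compat_r; lra).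
      assert (t * d' <= t * 1) by (apply Rmult_le_compat_l; lra).
      unfold gap in *. lra. }
  assert (Hk : forall t, k1 * t ^ 2 <= (k1 + k2) * t ^ 2 /\ k2 * t ^ 2 <= (k1 + k2) * t ^ 2).
  { intros t. pose proof (pow2_ge_0 t). split; apply Rmult_le_compat_r; lra. }
  destruct (Rtotal_order I1 I2) as [H|[H|H]]; [exfalso|exact H|exfalso]; revert H.
  - apply (Hraise 1 (1 - eta) eta W1 W2); try lra; [apply Rabs_R1|exact HPmax|].
    intros t Ht. destruct (Hexp _ Ht) as [_ [E1 E2]]. specialize (Hk t).
    replace (1 * t) with t in * by ring. lra.
  - apply (Hraise (-1) eta (1 - eta) W2 W1); try lra; [rewrite Rabs_left; lra| |].
    + intros P HP. rewrite (Rmin_comm _ (MI NX NY P W1)), (Rmin_comm I2 I1). auto.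
    + intros t Ht. destruct (Hexp _ Ht) as [_ [E1 E2]]. specialize (Hk t).
      replace ((-1 * t) ^ 2) with (t ^ 2) in * by ring. lra.
Qed.

Definition mixed_dens (x a b : nat) : R :=
  eta * ln (W1 x a / PW NX Pstar W1 a) + (1 - eta) * ln (W2 x b / PW NX Pstar W2 b).

(** Given the input, the two outputs are independent and both terms are centred, so the cross term
    vanishes; this is where the squared weights in [V] come from. *)
Lemma lsum_indep_square x (f g : nat -> R) : (x < NX)%nat ->
  lsum YY (fun a => W1 x a * f a) = 0 -> lsum YY (fun b => W2 x b * g b) = 0 ->
  lsum YY (fun a => lsum YY (fun b => W1 x a * W2 x b * (eta * f a + (1 - eta) * g b) ^ 2)) =
  eta ^ 2 * lsum YY (fun a => W1 x a * f a ^ 2) + (1 - eta) ^ 2 * lsum YY (fun b => W2 x b * g b ^ 2).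
Proof.
  intros Hx Hf Hg.
  rewrite (lsum_ext _ _ (fun a => eta ^ 2 * (W1 x a * f a ^ 2) +
    (1 - eta) ^ 2 * lsum YY (fun b => W2 x b * g b ^ 2) * W1 x a)).
  - rewrite lsum_plus, !lsum_scal, (channel_sum NX NY W1 x HW1 Hx). ring.
  - intros a _.
    rewrite (lsum_ext _ _ (fun b => eta ^ 2 * (W1 x a * f a ^ 2) * W2 x b +
      (2 * eta * (1 - eta) * (W1 x a * f a) * (W2 x b * g b) +
       (1 - eta) ^ 2 * W1 x a * (W2 x b * g b ^ 2)))) by (intros; ring).
    rewrite !lsum_plus, !lsum_scal, Hg, (channel_sum NX NY W2 x HW2 Hx). ring.
Qed.

Lemma centered_dens_mean W x : is_channel NX NY W -> (x < NX)%nat ->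
  lsum YY (fun y => W x y * (ln (W x y / PW NX Pstar W y) - KL NY W x (PW NX Pstar W))) = 0.
Proof.
  intros HW Hx.
  rewrite (lsum_ext _ _ (fun y => W x y * ln (W x y / PW NX Pstar W y) +
    (- KL NY W x (PW NX Pstar W)) * W x y)) by (intros; ring).
  rewrite lsum_plus, lsum_scal, <- (KL_lsum NX NY W HW x), (channel_sum NX NY W x HW Hx) by exact Hx.
  ring.
Qed.

Lemma mixed_dens_centered x a b : (x < NX)%nat -> mixed_dens x a b - I1 =
  eta * (ln (W1 x a / PW NX Pstar W1 a) - D1 x) + (1 - eta) * (ln (W2 x b / PW NX Pstar W2 b) - D2 x).
Proof.
  intros Hx. pose proof (weighted_KL x Hx) as H. rewrite <- MI_balanced in H.
  unfold mixed_dens. lra.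
Qed.

Lemma mixed_dens_mean x : (x < NX)%nat ->
  lsum YY (fun a => lsum YY (fun b => W1 x a * W2 x b * (mixed_dens x a b - I1))) = 0.
Proof.
  intros Hx.
  rewrite (lsum_ext _ _ (fun a => eta * (W1 x a * (ln (W1 x a / PW NX Pstar W1 a) - D1 x)))).
  - rewrite lsum_scal, centered_dens_mean by assumption. ring.
  - intros a _.
    rewrite (lsum_ext _ _ (fun b => eta * (W1 x a * (ln (W1 x a / PW NX Pstar W1 a) - D1 x)) * W2 x b +
      (1 - eta) * W1 x a * (W2 x b * (ln (W2 x b / PW NX Pstar W2 b) - D2 x)))).
    + rewrite lsum_plus, !lsum_scal, centered_dens_mean, (channel_sum NX NY W2 x HW2 Hx) by assumption.
      ring.
    + intros b _. rewrite mixed_dens_centered by exact Hx. ring.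
Qed.

Lemma mixed_dens_var x : (x < NX)%nat ->
  lsum YY (fun a => lsum YY (fun b => W1 x a * W2 x b * (mixed_dens x a b - I1) ^ 2)) =
  eta ^ 2 * var_dens NX NY Pstar W1 x + (1 - eta) ^ 2 * var_dens NX NY Pstar W2 x.
Proof.
  intros Hx. rewrite !var_dens_lsum by assumption.
  rewrite <- (lsum_indep_square x (fun a => ln (W1 x a / PW NX Pstar W1 a) - D1 x)
    (fun b => ln (W2 x b / PW NX Pstar W2 b) - D2 x)) by (auto using centered_dens_mean).
  apply lsum_ext; intros a _; apply lsum_ext; intros b _.
  rewrite mixed_dens_centered by exact Hx. reflexivity.
Qed.

Definition mixed_bound : R :=
  dens_bound NX NY W1 Pstar + dens_bound NX NY W2 Pstar + Rabs I1.

Lemma mixed_dens_bound x a b : (x < NX)%nat -> In a YY -> In b YY ->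
  Rabs (mixed_dens x a b - I1) <= mixed_bound.
Proof.
  intros Hx Ha Hb. assert (HxI : In x XX) by (apply in_seq; lia).
  pose proof (dens_le_bound NX NY W1 Pstar x a HxI Ha) as E1.
  pose proof (dens_le_bound NX NY W2 Pstar x b HxI Hb) as E2.
  unfold mixed_dens, mixed_bound. set (l1 := ln _) in *. set (l2 := ln (W2 x b / _)) in *.
  unfold Rminus. eapply Rle_trans; [apply Rabs_triang|]. rewrite Rabs_Ropp.
  apply Rplus_le_compat_r. eapply Rle_trans; [apply Rabs_triang|].
  rewrite !Rabs_mult, (Rabs_right eta), (Rabs_right (1 + - eta)) by lra.
  pose proof (Rabs_pos l1). pose proof (Rabs_pos l2). nra.
Qed.

Lemma mixed_bound_nonneg : 0 <= mixed_bound.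
Proof.
  unfold mixed_bound. pose proof (dens_bound_nonneg NX NY W1 Pstar).
  pose proof (dens_bound_nonneg NX NY W2 Pstar). pose proof (Rabs_pos I1). lra.
Qed.

End TwoChannels.

(** * The converse inequality *)

Definition dens1 (W : nat -> nat -> R) (q : nat -> R) (x a b : nat) : R := ln (W x a / q a).
Definition dens2 (W : nat -> nat -> R) (q : nat -> R) (x a b : nat) : R := ln (W x b / q b).

Lemma path_sum_swap z phi y1 y2 :
  path_sum z phi y1 y2 = path_sum (fun x a b => z x b a) (fun l1 l2 => phi l2 l1) y2 y1.
Proof.
  revert phi y2; induction y1 as [|a l1 IH]; intros phi [|b l2]; simpl; try reflexivity.
  rewrite IH; reflexivity.
Qed.

Lemma path_sum_affine z z1 z2 c1 c2 c phi y1 y2 n :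
  (forall x a b, z x a b = c1 * z1 x a b + c2 * z2 x a b + c) ->
  length y1 = n -> length y2 = n ->
  path_sum z phi y1 y2 = c1 * path_sum z1 phi y1 y2 + c2 * path_sum z2 phi y1 y2 + INR n * c.
Proof.
  intros Hz; revert phi y2 n; induction y1 as [|a l1 IH]; intros phi [|b l2] n L1 L2;
    simpl in L1, L2; subst n; try discriminate.
  - simpl; ring.
  - injection L2 as L2. cbn [path_sum]. rewrite (IH _ _ (length l1) eq_refl L2), Hz, S_INR. ring.
Qed.

Section ChangeOfMeasure.
Context (NX NY : nat) (W1 W2 : nat -> nat -> R) (q : nat -> R).
Local Notation YY := (seq 0 NY).
Hypothesis (HW1 : is_channel NX NY W1) (HW2 : is_channel NX NY W2)
  (Hq0 : forall y, In y YY -> 0 <= q y)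
  (Hqpos : forall x y, (x < NX)%nat -> In y YY -> 0 < W1 x y -> 0 < q y).

(** The factor [exp (- S_1)] turns the transition law of the first output into [q], step by step.
    The second output, although it steers the encoder, then sums out to one. Letters that the
    channel cannot produce are lost on the left, whence an inequality. *)
Lemma change_of_measure n phi (G : list nat -> R) : valid_strategy NX phi ->
  (forall y, 0 <= G y) ->
  Ex NY W1 W2 n phi (fun y1 y2 => G y1 * exp (- path_sum (dens1 W1 q) phi y1 y2))
  <= Ec YY q n G.
Proof.
  revert phi G; induction n as [|n IH]; intros phi G Hphi HG.
  - simpl. rewrite Ropp_0, exp_0; lra.
  - simpl. apply lsum_le; intros a Ha.
    set (x := phi nil nil). assert (Hx : (x < NX)%nat) by apply Hphi.
    rewrite (lsum_ext _ _ (fun b => W1 x a * exp (- ln (W1 x a / q a)) * (W2 x b *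
      Ex NY W1 W2 n (next_strategy phi a b) (fun l1 l2 => G (a :: l1) *
        exp (- path_sum (dens1 W1 q) (next_strategy phi a b) l1 l2))))).
    2:{ intros b _. rewrite Rmult_assoc, (Rmult_assoc (W1 x a)). f_equal.
        rewrite <- (Rmult_assoc (exp _)), (Rmult_comm (exp _)), Rmult_assoc. f_equal.
        rewrite <- Ex_scal. apply (Ex_ext NX); auto.
        - apply valid_next; assumption.
        - intros l1 l2 _ _ _. unfold dens1 at 1. rewrite Ropp_plus_distr, exp_plus. fold x. ring. }
    rewrite lsum_scal.
    assert (Hs : lsum YY (fun b => W2 x b *
      Ex NY W1 W2 n (next_strategy phi a b) (fun l1 l2 => G (a :: l1) *
        exp (- path_sum (dens1 W1 q) (next_strategy phi a b) l1 l2)))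
      <= Ec YY q n (fun c => G (a :: c))).
    { eapply Rle_trans.
      - apply lsum_le; intros b Hb. apply Rmult_le_compat_l.
        + apply (channel_nonneg NX NY W2); auto.
        + apply (IH (next_strategy phi a b) (fun l => G (a :: l))); [apply valid_next; auto|auto].
      - rewrite (lsum_ext _ _ (fun b => Ec YY q n (fun c => G (a :: c)) * W2 x b))
          by (intros; ring).
        rewrite lsum_scal, (channel_sum NX NY W2 x HW2 Hx). lra. }
    assert (HE0 : 0 <= Ec YY q n (fun c => G (a :: c))).
    { apply Ec_nonneg; auto. }
    destruct (channel_nonneg NX NY W1 x a HW1 Hx Ha) as [HWp|HWp].
    + pose proof (Hqpos x a Hx Ha HWp) as Hqa.
      replace (W1 x a * exp (- ln (W1 x a / q a))) with (q a).
      * apply Rmult_le_compat_l; [lra|exact Hs].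
      * rewrite exp_Ropp, exp_ln by (apply Rdiv_lt_0_compat; assumption). field; lra.
    + rewrite <- HWp, !Rmult_0_l. apply Rmult_le_pos; [apply Hq0; exact Ha|exact HE0].
Qed.

Definition miss (g : list nat -> nat) (j : nat) (y : list nat) : R :=
  if Nat.eqb (g y) j then 0 else 1.

(** A correct decision with [S_1 <= gam] costs at most [exp gam] times its probability under the
    message-independent product measure; decoding regions of different messages are disjoint, so
    these probabilities add up to at most 1. *)
Lemma decoding_bound n M (phis : nat -> strategy) (g : list nat -> nat) gam :
  lsum YY q = 1 -> (forall j, valid_strategy NX (phis j)) ->
  lsum (seq 0 M) (fun j => Ex NY W1 W2 n (phis j) (fun y1 y2 =>
    le_ind (path_sum (dens1 W1 q) (phis j) y1 y2) gam)) <=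
  lsum (seq 0 M) (fun j => Ex NY W1 W2 n (phis j) (fun y1 y2 => miss g j y1)) + exp gam.
Proof.
  intros Hq1 Hphi.
  apply Rle_trans with (lsum (seq 0 M) (fun j =>
    Ex NY W1 W2 n (phis j) (fun y1 y2 => miss g j y1) +
    exp gam * Ec YY q n (fun y => 1 - miss g j y))).
  - apply lsum_le; intros j _.
    apply Rle_trans with (Ex NY W1 W2 n (phis j) (fun y1 y2 => miss g j y1 + exp gam *
      ((1 - miss g j y1) * exp (- path_sum (dens1 W1 q) (phis j) y1 y2)))).
    + apply (Ex_le NX); auto. intros y1 y2 _ _ _. set (S := path_sum _ _ _ _).
      pose proof (exp_pos gam). pose proof (exp_pos (- S)).
      unfold le_ind, miss. destruct (Rle_dec S gam) as [HS|HS]; destruct Nat.eqb; try nra.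
      assert (1 <= exp gam * exp (- S)); [|lra].
      rewrite <- exp_plus, <- exp_0. apply exp_le_compat. lra.
    + rewrite Ex_plus, Ex_scal. apply Rplus_le_compat_l, Rmult_le_compat_l;
        [apply Rlt_le, exp_pos|].
      apply (change_of_measure n (phis j) (fun y => 1 - miss g j y)); auto.
      intros y; unfold miss; destruct Nat.eqb; lra.
  - rewrite lsum_plus, lsum_scal, <- (Ec_lsum _ _ Hq1).
    apply Rplus_le_compat_l. rewrite <- (Rmult_1_r (exp gam)) at 2.
    apply Rmult_le_compat_l; [apply Rlt_le, exp_pos|].
    apply Rle_trans with (Ec YY q n (fun _ => 1));
      [|rewrite (Ec_const _ _ Hq1); lra]. apply Ec_le; auto.
    intros y _ _. rewrite (lsum_ext _ _ (fun j => (if Nat.eqb j (g y) then 1 else 0) * 1)).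
    2:{ intros j _. unfold miss. destruct (Nat.eqb_spec (g y) j), (Nat.eqb_spec j (g y)); try congruence; ring. }
    destruct (in_dec Nat.eq_dec (g y) (seq 0 M)) as [HI|HI].
    + rewrite (lsum_point (seq 0 M) (g y) (fun _ => 1)); [lra|apply seq_NoDup|exact HI].
    + rewrite (lsum_ext _ _ (fun _ => 0)); [rewrite lsum_zero; lra|].
      intros j Hj. destruct (Nat.eqb_spec j (g y)); [subst; contradiction|ring].
Qed.

End ChangeOfMeasure.

Lemma err_det_Ex NY n M W1 W2 f k g :
  err_det NY n M W1 W2 f k g = / INR M * lsum (seq 0 M) (fun j =>
    Ex NY W1 W2 n (fun l1 l2 => f (length l1) j l1 l2)
      (fun y1 y2 => miss g j (if k then y1 else y2))).
Proof.
  unfold err_det. rewrite sumR_lsum, <- lsum_scal. apply lsum_ext; intros j _.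
  f_equal. apply (sum_joint_prob NY W1 W2 n f j).
Qed.

Section Converse.
Context (NX NY : nat) (W1 W2 : nat -> nat -> R) (q1 q2 : nat -> R) (eta : R).
Local Notation YY := (seq 0 NY).
Hypothesis (HW1 : is_channel NX NY W1) (HW2 : is_channel NX NY W2).
Hypothesis (Hq1 : forall y, In y YY -> 0 <= q1 y)
  (Hq2 : forall y, In y YY -> 0 <= q2 y)
  (Hq1pos : forall x y, (x < NX)%nat -> In y YY -> 0 < W1 x y -> 0 < q1 y)
  (Hq2pos : forall x y, (x < NX)%nat -> In y YY -> 0 < W2 x y -> 0 < q2 y)
  (Hq1s : lsum YY q1 = 1) (Hq2s : lsum YY q2 = 1).
Hypothesis (Heta01 : 0 < eta < 1).

(* If the mixed density is at most [gam], so is one of the two: both users cannot be served. *)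
Lemma converse_bound n M eps gam L :
  FLF_code_exists NX NY W1 W2 n M eps ->
  (forall phi, valid_strategy NX phi -> L <= Ex NY W1 W2 n phi (fun y1 y2 =>
     le_ind (eta * path_sum (dens1 W1 q1) phi y1 y2 + (1 - eta) * path_sum (dens2 W2 q2) phi y1 y2) gam)) ->
  L <= 2 * eps + 2 * exp gam / INR M.
Proof.
  intros [HM [Nu [pu [fs [g1 [g2 [Hpu [Hfs [He1 He2]]]]]]]]] HL.
  destruct (is_dist_lsum Nu pu Hpu) as [Hpu0 Hpu1].
  assert (HMpos : 0 < INR M) by (apply lt_0_INR; lia).
  assert (Hu : forall u, In u (seq 0 Nu) ->
    L <= err_det NY n M W1 W2 (fs u) true g1 + err_det NY n M W1 W2 (fs u) false g2
         + 2 * exp gam / INR M).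
  { intros u Hu. apply in_seq in Hu.
    set (phis := fun j => (fun l1 l2 => fs u (length l1) j l1 l2) : strategy).
    assert (Hphis : forall j, valid_strategy NX (phis j)) by (intros j l1 l2; apply Hfs; lia).
    (* The second application exchanges the users; the two equations that follow translate its terms
       back to the original order. *)
    pose proof (decoding_bound NX NY W1 W2 q1 HW1 HW2 Hq1 Hq1pos n M phis g1 gam Hq1s Hphis) as B1.
    pose proof (decoding_bound NX NY W2 W1 q2 HW2 HW1 Hq2 Hq2pos n M
      (fun j l1 l2 => phis j l2 l1) g2 gam Hq2s (fun j l1 l2 => Hphis j l2 l1)) as B2.
    assert (E1 : lsum (seq 0 M) (fun j => Ex NY W2 W1 n (fun l1 l2 => phis j l2 l1)
        (fun y1 y2 => le_ind (path_sum (dens1 W2 q2) (fun l1 l2 => phis j l2 l1) y1 y2) gam)) =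
      lsum (seq 0 M) (fun j => Ex NY W1 W2 n (phis j)
        (fun y1 y2 => le_ind (path_sum (dens2 W2 q2) (phis j) y1 y2) gam))).
    { apply lsum_ext; intros j _. rewrite (Ex_swap_users NY W1 W2).
      apply (Ex_ext NX); auto. intros l1 l2; apply Hphis.
      intros y1 y2 _ _ _. rewrite (path_sum_swap (dens2 W2 q2)). reflexivity. }
    assert (E2 : lsum (seq 0 M) (fun j => Ex NY W2 W1 n (fun l1 l2 => phis j l2 l1)
        (fun y1 y2 => miss g2 j y1)) =
      lsum (seq 0 M) (fun j => Ex NY W1 W2 n (phis j) (fun y1 y2 => miss g2 j y2))).
    { apply lsum_ext; intros j _. rewrite (Ex_swap_users NY W1 W2). reflexivity. }
    cbv beta in B2. rewrite E1, E2 in B2.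
    rewrite !err_det_Ex. fold phis.
    change (fun j => Ex NY W1 W2 n (fun l1 l2 => fs u (length l1) j l1 l2)
      (fun y1 y2 => miss g1 j y1)) with
      (fun j => Ex NY W1 W2 n (phis j) (fun y1 y2 => miss g1 j y1)).
    change (fun j => Ex NY W1 W2 n (fun l1 l2 => fs u (length l1) j l1 l2)
      (fun y1 y2 => miss g2 j y2)) with
      (fun j => Ex NY W1 W2 n (phis j) (fun y1 y2 => miss g2 j y2)).
    set (A1 := lsum (seq 0 M) (fun j => Ex NY W1 W2 n (phis j) (fun y1 y2 => miss g1 j y1))) in *.
    set (A2 := lsum (seq 0 M) (fun j => Ex NY W1 W2 n (phis j) (fun y1 y2 => miss g2 j y2))) in *.
    assert (HS : INR M * L <= A1 + A2 + 2 * exp gam).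
    { apply Rle_trans with (lsum (seq 0 M) (fun j => Ex NY W1 W2 n (phis j)
        (fun y1 y2 => le_ind (path_sum (dens1 W1 q1) (phis j) y1 y2) gam) +
        Ex NY W1 W2 n (phis j)
        (fun y1 y2 => le_ind (path_sum (dens2 W2 q2) (phis j) y1 y2) gam))).
      - assert (HML : INR M * L = lsum (seq 0 M) (fun _ => L * 1)).
        { rewrite lsum_scal. clear; rewrite Rmult_comm; f_equal.
          induction M as [|M IH]; [reflexivity|].
          rewrite seq_S, lsum_app, <- IH, S_INR; simpl; lra. }
        rewrite HML. apply lsum_le; intros j _. rewrite Rmult_1_r.
        eapply Rle_trans; [apply (HL (phis j)), Hphis|].
        rewrite <- Ex_plus. apply (Ex_le NX); auto. intros y1 y2 _ _ _.
        set (s1 := path_sum (dens1 W1 q1) _ _ _). set (s2 := path_sum (dens2 W2 q2) _ _ _).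
        unfold le_ind. destruct (Rle_dec s1 gam), (Rle_dec s2 gam), (Rle_dec _ gam); try lra.
        exfalso. nra.
      - rewrite lsum_plus. lra. }
    apply Rmult_le_reg_l with (INR M); [exact HMpos|].
    eapply Rle_trans; [exact HS|]. right. field. lra. }
  (* Randomised encoders come last: the bound holds for each deterministic one and is averaged over
     the randomisation. *)
  assert (Havg : lsum (seq 0 Nu) (fun u => L * pu u) <= lsum (seq 0 Nu) (fun u =>
    pu u * err_det NY n M W1 W2 (fs u) true g1 + (pu u * err_det NY n M W1 W2 (fs u) false g2
         + 2 * exp gam / INR M * pu u))).
  { apply lsum_le; intros u Hi. specialize (Hu u Hi). specialize (Hpu0 u Hi). nra. }
  rewrite !lsum_plus, !lsum_scal, Hpu1, <- !sumR_lsum in Havg. lra.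
Qed.

End Converse.

(** * Open-loop transmissions and Chernoff bounds *)

Fixpoint ysum (f : nat -> nat -> R) (y : list nat) : R :=
  match y with nil => 0 | b :: l => f 0%nat b + ysum (fun i => f (S i)) l end.

Fixpoint yprod (r : nat -> nat -> R) (y : list nat) : R :=
  match y with nil => 1 | b :: l => r 0%nat b * yprod (fun i => r (S i)) l end.

Fixpoint ypos (r : nat -> nat -> R) (y : list nat) : Prop :=
  match y with nil => True | b :: l => 0 < r 0%nat b /\ ypos (fun i => r (S i)) l end.

Definition open_loop (X : nat -> nat) : strategy := fun l1 _ => X (length l1).

Lemma yprod_exp r y : ypos r y -> yprod r y = exp (ysum (fun i b => ln (r i b)) y).
Proof.
  revert r; induction y as [|b l IH]; simpl; intros r Hp; [rewrite exp_0; reflexivity|].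
  destruct Hp as [H0 Hp]. rewrite exp_plus, exp_ln, (IH (fun i => r (S i))) by assumption.
  reflexivity.
Qed.

Lemma yprod_nonneg NY r y : (forall i b, In b (seq 0 NY) -> 0 <= r i b) ->
  Forall (fun b => In b (seq 0 NY)) y -> 0 <= yprod r y.
Proof.
  revert r; induction y as [|b l IH]; simpl; intros r Hr Hy; [lra|].
  inversion Hy; subst. apply Rmult_le_pos; [auto|apply IH; auto].
Qed.

Lemma sumR_succ_front n f : sumR (S n) f = f 0%nat + sumR n (fun i => f (S i)).
Proof.
  induction n as [|n IH]; [simpl; ring|].
  change (sumR (S (S n)) f) with (sumR (S n) f + f (S n)). rewrite IH; simpl; ring.
Qed.

Lemma ysum_affine k f mean y :
  ysum (fun i b => k * (f i b - mean i)) y = k * (ysum f y - sumR (length y) mean).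
Proof.
  revert f mean; induction y as [|b l IH]; intros f mean; [simpl; ring|].
  cbn [ysum length]. rewrite (IH (fun i => f (S i)) (fun i => mean (S i))), sumR_succ_front. ring.
Qed.

Lemma path_pos_letters NY W1 W2 phi y1 y2 : length y1 = length y2 -> path_pos NY W1 W2 phi y1 y2 ->
  Forall (fun b => In b (seq 0 NY)) y1 /\ Forall (fun b => In b (seq 0 NY)) y2.
Proof.
  revert phi y2; induction y1 as [|a l1 IH]; intros phi [|b l2]; simpl; intros L Hp;
    try discriminate; [auto|].
  destruct Hp as [[Ha _] [[Hb _] Hp]]. injection L as L. destruct (IH _ _ L Hp). auto.
Qed.

Lemma path_pos_open_loop NY W1 W2 X y1 y2 (q1 q2 : nat -> nat -> R) : length y1 = length y2 ->
  path_pos NY W1 W2 (open_loop X) y1 y2 ->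
  (forall i b, In b (seq 0 NY) -> 0 < W1 (X i) b -> 0 < q1 i b) ->
  (forall i b, In b (seq 0 NY) -> 0 < W2 (X i) b -> 0 < q2 i b) ->
  ypos (fun i b => W1 (X i) b / q1 i b) y1 /\ ypos (fun i b => W2 (X i) b / q2 i b) y2.
Proof.
  revert X y2 q1 q2; induction y1 as [|a l1 IH]; intros X [|b l2] q1 q2; simpl; intros L Hp H1 H2;
    try discriminate; [auto|].
  destruct Hp as [[Ha Pa] [[Hb Pb] Hp]]. injection L as L. unfold open_loop in Pa, Pb; simpl in Pa, Pb.
  destruct (IH (fun i => X (S i)) l2 (fun i => q1 (S i)) (fun i => q2 (S i)) L Hp
    (fun i => H1 (S i)) (fun i => H2 (S i))) as [E1 E2].
  split; (split; [apply Rdiv_lt_0_compat; auto|assumption]).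
Qed.

Lemma Ex_open_loop_swap NY W1 W2 n X F :
  Ex NY W1 W2 n (open_loop X) F = Ex NY W2 W1 n (open_loop X) (fun y1 y2 => F y2 y1).
Proof.
  rewrite Ex_swap_users. apply Ex_strategy_ext. intros l1 l2 L _. unfold open_loop. congruence.
Qed.

Lemma open_loop_valid NX X : (forall i, (X i < NX)%nat) -> valid_strategy NX (open_loop X).
Proof. intros H l1 l2; apply H. Qed.

Section RandomLetters.
Context {T : Type} (A : list T) (w : T -> R) (dft : T).
Hypothesis (Hw : forall t, In t A -> 0 <= w t) (Hw1 : lsum A w = 1).

(** For a fixed output sequence the letters of an independent codeword are averaged one position at
    a time. With [r] a likelihood ratio this is the false-alarm estimate of random coding. *)
Lemma Ec_yprod_le_1 NY n (r : nat -> T -> nat -> R) y :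
  (forall i t b, In t A -> In b (seq 0 NY) -> 0 <= r i t b) ->
  (forall i b, In b (seq 0 NY) -> lsum A (fun t => w t * r i t b) <= 1) ->
  length y = n -> Forall (fun b => In b (seq 0 NY)) y ->
  Ec A w n (fun c => yprod (fun i b => r i (nth i c dft) b) y) <= 1.
Proof.
  intros Hr0 Hr1 L Hy; revert r n Hr0 Hr1 L; induction Hy as [|b l Hb Hl IH];
    intros r n Hr0 Hr1 L; subst n; [simpl; lra|].
  simpl. rewrite (lsum_ext _ _ (fun t => Ec A w (length l)
    (fun c => yprod (fun i b => r (S i) (nth i c dft) b) l) * (w t * r 0%nat t b))).
  2:{ intros t _. rewrite Ec_scal. ring. }
  rewrite lsum_scal.
  assert (E1 := IH (fun i => r (S i)) (length l) (fun i => Hr0 (S i)) (fun i => Hr1 (S i)) eq_refl).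
  assert (E0 := Hr1 0%nat b Hb).
  assert (0 <= lsum A (fun t => w t * r 0%nat t b)).
  { apply lsum_nonneg; intros; apply Rmult_le_pos; auto. }
  cbv beta in E1. nra.
Qed.

Section Chernoff.
Context (NX NY : nat) (W1 W2 : nat -> nat -> R) (HW1 : is_channel NX NY W1) (HW2 : is_channel NX NY W2).

(** Without feedback, codeword letter and channel noise at one position form a unit independent of
    the others, so the joint moment generating function factorises. *)
Lemma chernoff_open_loop n (X : nat -> T -> nat) (zeta : nat -> T -> nat -> R) rho :
  (forall i t, In t A \/ t = dft -> (X i t < NX)%nat) -> 0 <= rho ->
  (forall i, lsum A (fun t => w t * lsum (seq 0 NY) (fun b => W1 (X i t) b * exp (zeta i t b))) <= rho) ->
  Ec A w n (fun c => Ex NY W1 W2 n (open_loop (fun i => X i (nth i c dft)))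
     (fun y1 y2 => exp (ysum (fun i b => zeta i (nth i c dft) b) y1))) <= rho ^ n.
Proof.
  intros HX Hrho; revert X zeta HX; induction n as [|n IH]; intros X zeta HX Hz.
  - simpl; rewrite exp_0; lra.
  - pose (R := fun c => Ex NY W1 W2 n (open_loop (fun i => X (S i) (nth i c dft)))
     (fun y1 y2 => exp (ysum (fun i b => zeta (S i) (nth i c dft) b) y1))).
    assert (HR : Ec A w n R <= rho ^ n).
    { apply (IH (fun i => X (S i)) (fun i => zeta (S i))); auto. }
    assert (HR0 : 0 <= Ec A w n R).
    { apply Rle_trans with (Ec A w n (fun _ => 0)); [rewrite Ec_zero; lra|].
      apply Ec_le; auto. intros c _ Hc. apply (Ex_nonneg NX); auto.
      - apply open_loop_valid. intros i. apply HX.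
        destruct (nth_in_or_default i c dft) as [Hi|Hi]; [left|right; exact Hi].
        rewrite Forall_forall in Hc; auto.
      - intros; apply Rlt_le, exp_pos. }
    apply Rle_trans with (lsum A (fun t => Ec A w n R *
      (w t * lsum (seq 0 NY) (fun b => W1 (X 0%nat t) b * exp (zeta 0%nat t b))))).
    + change (Ec A w (S n) ?F) with (lsum A (fun t => w t * Ec A w n (fun c => F (t :: c)))).
      apply lsum_le; intros t Ht. cbv beta.
      rewrite (Rmult_comm (Ec A w n R)), Rmult_assoc. apply Rmult_le_compat_l; [auto|].
      rewrite <- Ec_scal. apply Ec_le; auto. intros c _ Hc.
      assert (Hval : valid_strategy NX (open_loop (fun i => X (S i) (nth i c dft)))).
      { apply open_loop_valid. intros i. apply HX.
        destruct (nth_in_or_default i c dft) as [Hi|Hi]; [left|right; exact Hi].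
        rewrite Forall_forall in Hc; auto. }
      assert (Hx : (X 0%nat t < NX)%nat) by auto.
      cbn [Ex]. right. rewrite (Rmult_comm (lsum _ _)), <- lsum_scal.
      apply lsum_ext; intros a _.
      change (open_loop (fun i => X i (nth i (t :: c) dft)) [] []) with (X 0%nat t).
      rewrite (lsum_ext _ _ (fun b => R c * (W1 (X 0%nat t) a * exp (zeta 0%nat t a)) * W2 (X 0%nat t) b)).
      * rewrite lsum_scal, (channel_sum NX NY W2 _ HW2 Hx). ring.
      * intros b _.
        change (next_strategy (open_loop (fun i => X i (nth i (t :: c) dft))) a b) with
          (open_loop (fun i => X (S i) (nth i c dft))).
        rewrite (Ex_ext NX NY W1 W2 HW1 HW2 _ _ _ (fun y1 y2 => exp (zeta 0%nat t a) *
          exp (ysum (fun i b => zeta (S i) (nth i c dft) b) y1))); [|exact Hval|].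
        { rewrite Ex_scal. fold (R c). ring. }
        { intros y1 y2 _ _ _. cbn [ysum nth]. rewrite exp_plus. reflexivity. }
    + rewrite lsum_scal. rewrite <- tech_pow_Rmult. rewrite Rmult_comm.
      apply Rmult_le_compat; auto.
      apply lsum_nonneg; intros t Ht; apply Rmult_le_pos; auto.
      apply lsum_nonneg; intros b Hb; apply Rmult_le_pos; [|apply Rlt_le, exp_pos].
      apply (channel_nonneg NX NY W1); auto.
Qed.

Lemma lower_deviation n (X : nat -> T -> nat) (f : nat -> T -> nat -> R) mean lam rho s :
  (forall i t, In t A \/ t = dft -> (X i t < NX)%nat) -> 0 <= rho -> 0 <= lam ->
  (forall i, lsum A (fun t => w t * lsum (seq 0 NY) (fun b =>
     W1 (X i t) b * exp (- lam * (f i t b - mean i)))) <= rho) ->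
  Ec A w n (fun c => Ex NY W1 W2 n (open_loop (fun i => X i (nth i c dft)))
     (fun y1 y2 => le_ind (ysum (fun i b => f i (nth i c dft) b) y1) (sumR n mean - s)))
  <= exp (- lam * s) * rho ^ n.
Proof.
  intros HX Hrho Hlam Hz.
  eapply Rle_trans; [|apply Rmult_le_compat_l; [apply Rlt_le, exp_pos|
    apply (chernoff_open_loop n X (fun i t b => - lam * (f i t b - mean i)) rho HX Hrho Hz)]].
  rewrite <- Ec_scal. apply Ec_le; auto. intros c Hc Hf. rewrite <- Ex_scal.
  apply (Ex_le NX); auto.
  - apply open_loop_valid. intros i. apply HX.
    destruct (nth_in_or_default i c dft) as [Hi|Hi]; [left|right; exact Hi].
    rewrite Forall_forall in Hf; auto.
  - intros y1 y2 L1 _ _.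
    rewrite (ysum_affine (- lam) (fun i b => f i (nth i c dft) b) mean), L1, <- exp_plus.
    unfold le_ind. destruct Rle_dec as [H|H]; [|apply Rlt_le, exp_pos].
    rewrite <- exp_0. apply exp_le_compat. nra.
Qed.

End Chernoff.
End RandomLetters.

Lemma exp_quadratic z : Rabs z <= / 2 -> exp z <= 1 + z + 2 * z ^ 2.
Proof.
  intros H. assert (Hz : - / 2 <= z <= / 2).
  { pose proof (Rle_abs z). pose proof (Rle_abs (- z)) as HA. rewrite Rabs_Ropp in HA. lra. }
  pose proof (exp_ineq1_le (- z)) as E. rewrite exp_Ropp in E.
  pose proof (exp_pos z).
  assert (exp z * (1 - z) <= 1).
  { apply (Rmult_le_compat_l (exp z)) in E; [|lra]. rewrite Rinv_r in E by lra. lra. }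
  assert (1 <= (1 + z + 2 * z ^ 2) * (1 - z)) by nra.
  apply Rmult_le_reg_r with (1 - z); lra.
Qed.

(** The density has mean [MI] only after averaging over the letter as well. For [lam * B <= 1/2] the
    quadratic bound on the exponential applies, its linear term averages out, and the rest is at
    most [1 + 2 lam^2 B^2]. *)
Lemma mgf_step NX NY W P B lam : is_channel NX NY W -> is_dist NX P ->
  (forall x y, In x (seq 0 NX) -> In y (seq 0 NY) -> 0 < W x y ->
     Rabs (ln (W x y / PW NX P W y) - MI NX NY P W) <= B) ->
  0 <= lam -> lam * B <= / 2 ->
  lsum (seq 0 NX) (fun x => P x * lsum (seq 0 NY) (fun y =>
    W x y * exp (- lam * (ln (W x y / PW NX P W y) - MI NX NY P W)))) <= exp (2 * lam ^ 2 * B ^ 2).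
Proof.
  intros HW HP HB Hlam HlB. destruct (is_dist_lsum NX P HP) as [HP0 HP1].
  eapply Rle_trans; [|apply exp_ineq1_le].
  set (I := MI NX NY P W).
  assert (Hone : lsum (seq 0 NX) (fun x => lsum (seq 0 NY) (fun y => P x * W x y)) = 1).
  { rewrite <- HP1. apply lsum_ext; intros x Hx.
    rewrite lsum_scal, (channel_sum NX NY W x HW (in_XX NX x Hx)); ring. }
  apply Rle_trans with (lsum (seq 0 NX) (fun x => lsum (seq 0 NY) (fun y =>
    (1 + 2 * lam ^ 2 * B ^ 2 + lam * I) * (P x * W x y) +
    - lam * (P x * (W x y * ln (W x y / PW NX P W y)))))).
  - apply lsum_le; intros x Hx. rewrite <- lsum_scal. apply lsum_le; intros y Hy.
    destruct (channel_nonneg NX NY W x y HW (in_XX NX x Hx) Hy) as [Hp|Hp]; [|rewrite <- Hp; lra].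
    specialize (HB x y Hx Hy Hp). fold I in HB. set (l := ln _) in *.
    set (z := - lam * (l - I)).
    assert (Hz : Rabs z <= lam * B).
    { unfold z. rewrite Rabs_mult, Rabs_Ropp, (Rabs_right lam) by lra.
      apply Rmult_le_compat_l; lra. }
    pose proof (exp_quadratic z ltac:(lra)) as E.
    assert (Hz2 : z ^ 2 <= lam ^ 2 * B ^ 2).
    { rewrite <- Rpow_mult_distr, <- (pow2_abs z). apply pow_incr. split; [apply Rabs_pos|exact Hz]. }
    specialize (HP0 x Hx). assert (0 <= P x * W x y) by nra.
    replace (P x * (W x y * exp z)) with (P x * W x y * exp z) by ring.
    replace ((1 + 2 * lam ^ 2 * B ^ 2 + lam * I) * (P x * W x y) + - lam * (P x * (W x y * l)))
      with (P x * W x y * (1 + z + 2 * (lam ^ 2 * B ^ 2))) by (unfold z; ring).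
    apply Rmult_le_compat_l; lra.
  - rewrite (lsum_ext _ _ (fun x => (1 + 2 * lam ^ 2 * B ^ 2 + lam * I) *
      lsum (seq 0 NY) (fun y => P x * W x y) +
      - lam * lsum (seq 0 NY) (fun y => P x * (W x y * ln (W x y / PW NX P W y)))))
      by (intros; rewrite lsum_plus, !lsum_scal; reflexivity).
    rewrite lsum_plus, !lsum_scal, Hone, <- (MI_lsum NX NY W HW P). fold I. lra.
Qed.

(** * Two-phase codes *)

Lemma div_nonneg a b : 0 <= a -> 0 <= b -> 0 <= a / b.
Proof.
  intros Ha [Hb|Hb].
  - apply Rmult_le_pos; [exact Ha|apply Rlt_le, Rinv_0_lt_compat, Hb].
  - rewrite <- Hb; unfold Rdiv; rewrite Rinv_0; lra.
Qed.

Lemma avg_ratio_le_1 NX W P b : lsum (seq 0 NX) (fun x => P x * (W x b / PW NX P W b)) <= 1.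
Proof.
  rewrite (lsum_ext _ _ (fun x => / PW NX P W b * (P x * W x b))) by (intros; unfold Rdiv; ring).
  rewrite lsum_scal, <- PW_lsum. destruct (Req_dec (PW NX P W b) 0) as [E|E].
  - rewrite E; lra.
  - rewrite Rinv_l by exact E; lra.
Qed.

(* The last passing index wins, so message [j] can only be lost to a later one; this lets the
   codewords be chosen one after the other. *)
Fixpoint last_pass (pass : nat -> bool) (M : nat) : nat :=
  match M with O => O | S k => if pass k then k else last_pass pass k end.

Lemma last_pass_miss pass M j : (j < M)%nat -> last_pass pass M <> j ->
  pass j = false \/ exists i, (j < i < M)%nat /\ pass i = true.
Proof.
  induction M as [|M IH]; simpl; intros Hj Hm; [lia|].
  destruct (pass M) eqn:E.
  - right; exists M; split; [lia|exact E].
  - destruct (Nat.eq_dec j M) as [->|Hn]; [left; exact E|].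
    destruct (IH ltac:(lia) Hm) as [H|[i [Hi H]]]; [left; exact H|right; exists i; split; [lia|exact H]].
Qed.

(** Validity is kept at every index, so that the encoder is defined for all messages; goodness and
    the cost bound are secured only below [M]. *)
Lemma greedy_selection {C : Type} (valid good : C -> Prop) (cost : C -> C -> R) kappa c0 :
  valid c0 -> (forall c, good c -> valid c) ->
  (forall j (cs : nat -> C), (forall i, valid (cs i)) -> exists c, good c /\
     lsum (seq 0 j) (fun i => cost (cs i) c) <= kappa * (INR j + 1)) ->
  forall M, exists cs : nat -> C, (forall i, valid (cs i)) /\
    forall j, (j < M)%nat -> good (cs j) /\
      lsum (seq 0 j) (fun i => cost (cs i) (cs j)) <= kappa * (INR j + 1).
Proof.
  intros H0 Hgv Hstep M; induction M as [|M [cs [Hv Hcs]]].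
  - exists (fun _ => c0); split; [auto|intros; lia].
  - destruct (Hstep M cs Hv) as [c [Hg Hc]].
    exists (fun i => if Nat.eqb i M then c else cs i). split.
    + intros i; destruct Nat.eqb; auto.
    + intros j Hj.
      assert (Hpre : forall d, lsum (seq 0 j) (fun i => cost (if Nat.eqb i M then c else cs i) d)
        = lsum (seq 0 j) (fun i => cost (cs i) d)).
      { intros d; apply lsum_ext; intros i Hi; apply in_seq in Hi.
        destruct (Nat.eqb_spec i M); [lia|reflexivity]. }
      rewrite Hpre. destruct (Nat.eqb_spec j M) as [E|E].
      * subst j; auto.
      * apply Hcs; lia.
Qed.

Section TwoPhase.
Context (NX NY : nat) (W1 W2 : nat -> nat -> R) (P0 Pp Pm : nat -> R) (n1 m : nat).
Context (gam t2 lo thr eta : R) (mu1 mu2 : nat -> R).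
Hypothesis (HNX : (1 <= NX)%nat).
Hypothesis (HW1 : is_channel NX NY W1) (HW2 : is_channel NX NY W2)
  (HP0 : is_dist NX P0) (HPp : is_dist NX Pp) (HPm : is_dist NX Pm).

Local Notation XX := (seq 0 NX).
Local Notation YY := (seq 0 NY).
Local Notation EX := (Ex NY W1 W2).
Local Notation pair_letter := (fun t => In t (list_prod XX XX)).
Local Notation letter_in := (Forall (fun x => In x XX)).
Local Notation output_in := (Forall (fun b => In b YY)).

Definition chan (k : bool) := if k then W1 else W2.
Definition gain (k : bool) := if k then mu1 else mu2.

Definition supercode : Type := (list nat * list (nat * nat))%type.

Definition valid_code (c : supercode) : Prop :=
  letter_in (fst c) /\ Forall pair_letter (snd c).

(** The default letter 0 is a legitimate input since the alphabet is nonempty; so codes of any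
    length, even empty ones, give valid strategies. *)
Definition in1 (c1 : list nat) (i : nat) : nat := nth i c1 0%nat.
(** Mode [a] sends the first letter of each pair at the first [a] positions and the second letter
    afterwards. *)
Definition pick (a i : nat) (t : nat * nat) : nat := if (i <? a)%nat then fst t else snd t.
Definition in2 (c2 : list (nat * nat)) (a i : nat) : nat := pick a i (nth i c2 (0%nat, 0%nat)).
Definition law2 (a i : nat) : nat -> R := if (i <? a)%nat then Pp else Pm.

Definition ratio1 (k : bool) (c1 : list nat) (i b : nat) : R :=
  chan k (in1 c1 i) b / PW NX P0 (chan k) b.
Definition ratio2 (k : bool) (c2 : list (nat * nat)) (a i b : nat) : R :=
  chan k (in2 c2 a i) b / PW NX (law2 a i) (chan k) b.

(** The decoder cannot see the mode, so it sums the likelihood ratios of all [m + 1] possibilities;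
    the term of the true mode is a lower bound for the sum. *)
Definition score (k : bool) (c : supercode) (y : list nat) : R :=
  yprod (ratio1 k (fst c)) (firstn n1 y) *
  lsum (seq 0 (S m)) (fun a => yprod (ratio2 k (snd c) a) (skipn n1 y)).

Definition sum1 (k : bool) (c1 : list nat) (y : list nat) : R :=
  ysum (fun i b => ln (ratio1 k c1 i b)) y.
Definition sum2 (k : bool) (c2 : list (nat * nat)) (a : nat) (y : list nat) : R :=
  ysum (fun i b => ln (ratio2 k c2 a i b)) y.

(** [t2] is a reserve for the downward fluctuation of the second phase below its mean. *)
Definition serves (s1 s2 : R) (a : nat) : bool :=
  (if Rlt_dec gam (s1 + mu1 a - t2) then true else false) &&
  (if Rlt_dec gam (s2 + mu2 a - t2) then true else false).

(* When no mode serves both users, the coin [u] decides which of them is served. *)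
Definition mode (u : bool) (s1 s2 : R) : nat :=
  match find (serves s1 s2) (seq 0 (S m)) with
  | Some a => a
  | None => if u then m else 0%nat
  end.

Definition strat (u : bool) (c : supercode) : strategy := fun l1 l2 =>
  if (length l1 <? n1)%nat then in1 (fst c) (length l1)
  else in2 (snd c) (mode u (sum1 true (fst c) (firstn n1 l1)) (sum1 false (fst c) (firstn n1 l2)))
         (length l1 - n1).

Definition pass (k : bool) (c : supercode) (y : list nat) : bool :=
  if Rlt_dec (exp gam) (score k c y) then true else false.

Definition b2R (b : bool) : R := if b then 1 else 0.
Definition out (k : bool) (y1 y2 : list nat) : list nat := if k then y1 else y2.

Definition mix1 (c1 : list nat) (y1 y2 : list nat) : R :=
  eta * sum1 true c1 y1 + (1 - eta) * sum1 false c1 y2.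

Lemma chan_channel k : is_channel NX NY (chan k).
Proof. destruct k; assumption. Qed.

Lemma law2_dist a i : is_dist NX (law2 a i).
Proof. unfold law2; destruct Nat.ltb; assumption. Qed.

Lemma in1_lt c1 i : letter_in c1 -> (in1 c1 i < NX)%nat.
Proof.
  intros H. unfold in1. destruct (nth_in_or_default i c1 0%nat) as [Hi|Hi].
  - rewrite Forall_forall in H. apply (in_XX NX); auto.
  - rewrite Hi; lia.
Qed.

Lemma pick_lt a i t : In t (list_prod XX XX) \/ t = (0%nat, 0%nat) -> (pick a i t < NX)%nat.
Proof.
  intros [H|H].
  - destruct t as [x y]. apply in_prod_iff in H. destruct H as [Hx Hy].
    apply in_XX in Hx. apply in_XX in Hy. unfold pick; destruct Nat.ltb; assumption.
  - subst t; unfold pick; destruct Nat.ltb; simpl; lia.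
Qed.

Lemma in2_lt c2 a i : Forall pair_letter c2 -> (in2 c2 a i < NX)%nat.
Proof.
  intros H. apply pick_lt. destruct (nth_in_or_default i c2 (0%nat, 0%nat)) as [Hi|Hi]; [left|auto].
  rewrite Forall_forall in H; auto.
Qed.

Lemma strat_valid u c : valid_code c -> valid_strategy NX (strat u c).
Proof.
  intros [H1 H2] l1 l2. unfold strat. destruct Nat.ltb; [apply in1_lt|apply in2_lt]; assumption.
Qed.

Hypothesis (HP0pos : forall k x b, In x XX -> In b YY -> 0 < chan k x b -> 0 < PW NX P0 (chan k) b)
  (HPppos : forall k x b, In x XX -> In b YY -> 0 < chan k x b -> 0 < PW NX Pp (chan k) b)
  (HPmpos : forall k x b, In x XX -> In b YY -> 0 < chan k x b -> 0 < PW NX Pm (chan k) b).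

Lemma law2_pos k a i x b : (x < NX)%nat -> In b YY -> 0 < chan k x b ->
  0 < PW NX (law2 a i) (chan k) b.
Proof.
  intros Hx Hb H. assert (In x XX) by (apply in_seq; lia).
  unfold law2; destruct Nat.ltb; [apply (HPppos k x)|apply (HPmpos k x)]; auto.
Qed.

Lemma ratio1_nonneg k c1 i b : letter_in c1 -> In b YY -> 0 <= ratio1 k c1 i b.
Proof.
  intros H Hb. apply div_nonneg.
  - apply (channel_nonneg NX NY (chan k)); auto using chan_channel, in1_lt.
  - apply (PW_nonneg NX NY (chan k) (chan_channel k)); auto.
Qed.

Lemma ratio2_nonneg k c2 a i b : Forall pair_letter c2 -> In b YY ->
  0 <= ratio2 k c2 a i b.
Proof.
  intros H Hb. apply div_nonneg.
  - apply (channel_nonneg NX NY (chan k)); auto using chan_channel, in2_lt.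
  - apply (PW_nonneg NX NY (chan k) (chan_channel k)); auto using law2_dist.
Qed.

Lemma path_pos_ratio1 k c1 y1 y2 : letter_in c1 -> length y1 = length y2 ->
  path_pos NY W1 W2 (open_loop (in1 c1)) y1 y2 -> ypos (ratio1 k c1) (out k y1 y2).
Proof.
  intros Hc L Hp.
  destruct (path_pos_open_loop NY W1 W2 (in1 c1) y1 y2
    (fun _ b => PW NX P0 W1 b) (fun _ b => PW NX P0 W2 b) L Hp) as [E1 E2].
  - intros i b Hb H. apply (HP0pos true (in1 c1 i)); auto. apply in_seq. pose proof (in1_lt c1 i Hc). lia.
  - intros i b Hb H. apply (HP0pos false (in1 c1 i)); auto. apply in_seq. pose proof (in1_lt c1 i Hc). lia.
  - destruct k; assumption.
Qed.

Lemma path_pos_ratio2 k c2 a y1 y2 : Forall pair_letter c2 ->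
  length y1 = length y2 ->
  path_pos NY W1 W2 (open_loop (in2 c2 a)) y1 y2 -> ypos (ratio2 k c2 a) (out k y1 y2).
Proof.
  intros Hc L Hp.
  destruct (path_pos_open_loop NY W1 W2 (in2 c2 a) y1 y2
    (fun i b => PW NX (law2 a i) W1 b) (fun i b => PW NX (law2 a i) W2 b) L Hp) as [E1 E2].
  - intros i b Hb H. apply (law2_pos true a i (in2 c2 a i)); auto using in2_lt.
  - intros i b Hb H. apply (law2_pos false a i (in2 c2 a i)); auto using in2_lt.
  - destruct k; assumption.
Qed.

Hypothesis (Hserve : forall s1 s2, lo < s1 -> lo < s2 -> thr < eta * s1 + (1 - eta) * s2 ->
   exists a, (a <= m)%nat /\ gam < s1 + mu1 a - t2 /\ gam < s2 + mu2 a - t2)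
  (Hfav1 : forall s, lo < s -> gam < s + mu1 m - t2)
  (Hfav2 : forall s, lo < s -> gam < s + mu2 0%nat - t2).

Lemma mode_serves u s1 s2 k : lo < s1 -> lo < s2 ->
  u = k \/ thr < eta * s1 + (1 - eta) * s2 ->
  (mode u s1 s2 <= m)%nat /\ gam < (if k then s1 else s2) + gain k (mode u s1 s2) - t2.
Proof.
  intros H1 H2 H. unfold mode. destruct (find (serves s1 s2) (seq 0 (S m))) as [a|] eqn:E.
  - apply find_some in E. destruct E as [Ha Hs]. apply in_seq in Ha. split; [lia|].
    unfold serves in Hs. destruct (Rlt_dec gam (s1 + mu1 a - t2)), (Rlt_dec gam (s2 + mu2 a - t2));
      try discriminate. destruct k; assumption.
  - destruct H as [->|H].
    + destruct k; (split; [lia|]); auto.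
    + exfalso. destruct (Hserve s1 s2 H1 H2 H) as [a [Ha [G1 G2]]].
      pose proof (find_none _ _ E a ltac:(apply in_seq; lia)) as Hn.
      unfold serves in Hn. destruct (Rlt_dec gam (s1 + mu1 a - t2)), (Rlt_dec gam (s2 + mu2 a - t2));
      try discriminate; contradiction.
Qed.

Definition start_dev (c1 : list nat) (k : bool) : R :=
  EX n1 (open_loop (in1 c1)) (fun y1 y2 => le_ind (sum1 k c1 (out k y1 y2)) lo).
Definition end_dev (c2 : list (nat * nat)) (k : bool) : R :=
  lsum (seq 0 (S m)) (fun a => EX m (open_loop (in2 c2 a))
    (fun y1 y2 => le_ind (sum2 k c2 a (out k y1 y2)) (gain k a - t2))).
Definition outage (c1 : list nat) : R :=
  EX n1 (open_loop (in1 c1)) (fun y1 y2 => le_ind (mix1 c1 y1 y2) thr).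

Lemma le_ind_nonneg s t : 0 <= le_ind s t.
Proof. unfold le_ind; destruct Rle_dec; lra. Qed.

(** User [k] can miss its own codeword only if a sum of the first phase is abnormally small, or the
    second phase falls short of its mean by [t2], or the mixed sum is in outage while the coin
    favours the other user. *)
Lemma fail_bound k u c : valid_code c ->
  EX (n1 + m) (strat u c) (fun y1 y2 => 1 - b2R (pass k c (out k y1 y2))) <=
  start_dev (fst c) true + start_dev (fst c) false + end_dev (snd c) k +
  (if Bool.eqb u k then 0 else outage (fst c)).
Proof.
  intros Hc. pose proof Hc as [Hc1 Hc2]. destruct c as [c1 c2]; simpl fst in *; simpl snd in *.
  assert (V1 : valid_strategy NX (open_loop (in1 c1))).
  { apply open_loop_valid; intros; apply in1_lt; assumption. }
  assert (V2 : forall a, valid_strategy NX (open_loop (in2 c2 a))).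
  { intros a; apply open_loop_valid; intros; apply in2_lt; assumption. }
  rewrite Ex_app.
  rewrite (Ex_strategy_ext NY W1 W2 n1 _ (open_loop (in1 c1))).
  2:{ intros l1 l2 _ L. unfold strat, open_loop. simpl fst.
      destruct (Nat.ltb_spec (length l1) n1); [reflexivity|lia]. }
  assert (Hdev0 : forall a, 0 <= EX m (open_loop (in2 c2 a))
    (fun y1 y2 => le_ind (sum2 k c2 a (out k y1 y2)) (gain k a - t2))).
  { intros a; apply (Ex_nonneg NX); auto. intros; apply le_ind_nonneg. }
  assert (Hend0 : 0 <= end_dev c2 k) by (apply lsum_nonneg; auto).
  set (ind := fun y1 y2 => le_ind (sum1 true c1 y1) lo + le_ind (sum1 false c1 y2) lo +
    end_dev c2 k + (if Bool.eqb u k then 0 else le_ind (mix1 c1 y1 y2) thr)).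
  apply Rle_trans with (EX n1 (open_loop (in1 c1)) ind).
  - apply (Ex_le NX); auto. intros y1 y2 L1 L2 Hp. cbv beta.
    set (s1 := sum1 true c1 y1). set (s2 := sum1 false c1 y2). set (a := mode u s1 s2).
    (* Once the first-phase outputs are fixed the mode is fixed too, so the rest of the transmission
       is open-loop. *)
    rewrite (Ex_strategy_ext NY W1 W2 m _ (open_loop (in2 c2 a))).
    2:{ intros l1 l2 _ _. unfold strat, open_loop. rewrite length_app.
        destruct (Nat.ltb_spec (length y1 + length l1) n1); [lia|]. simpl fst; simpl snd.
        rewrite !firstn_app, L1, L2, Nat.sub_diag, !firstn_O, !app_nil_r.
        rewrite (firstn_all2 y1), (firstn_all2 y2) by lia. fold s1 s2 a. f_equal. lia. }
    assert (Hle1 : EX m (open_loop (in2 c2 a))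
      (fun l1 l2 => 1 - b2R (pass k (c1, c2) (out k (y1 ++ l1) (y2 ++ l2)))) <= 1).
    { eapply Rle_trans; [|right; apply (Ex_one NX NY W1 W2 HW1 HW2 m _ (V2 a))].
      apply (Ex_le NX); auto. intros; unfold b2R; destruct pass; lra. }
    assert (Hn1 := le_ind_nonneg s1 lo). assert (Hn2 := le_ind_nonneg s2 lo).
    assert (Hn3 := le_ind_nonneg (mix1 c1 y1 y2) thr).
    unfold ind. fold s1 s2.
    destruct (Rle_dec s1 lo) as [Q1|Q1].
    { unfold le_ind at 1. destruct (Rle_dec s1 lo); [|contradiction]. destruct Bool.eqb; lra. }
    destruct (Rle_dec s2 lo) as [Q2|Q2].
    { unfold le_ind at 2. destruct (Rle_dec s2 lo); [|contradiction]. destruct Bool.eqb; lra. }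
    assert (Hcase : (u = k \/ thr < mix1 c1 y1 y2) \/
      (if Bool.eqb u k then 0 else le_ind (mix1 c1 y1 y2) thr) = 1).
    { destruct (Bool.eqb u k) eqn:Eu; [left; left; apply Bool.eqb_prop; exact Eu|].
      unfold le_ind. destruct (Rle_dec (mix1 c1 y1 y2) thr) as [Q|Q]; [right; reflexivity|left; right; lra]. }
    destruct Hcase as [Hcase|Hcase]; [|rewrite Hcase; lra].
    apply Rnot_le_lt in Q1. apply Rnot_le_lt in Q2.
    destruct (mode_serves u s1 s2 k Q1 Q2 Hcase) as [Ham Hg]. fold a in Ham, Hg.
    assert (HT : EX m (open_loop (in2 c2 a))
      (fun l1 l2 => 1 - b2R (pass k (c1, c2) (out k (y1 ++ l1) (y2 ++ l2)))) <= end_dev c2 k).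
    (* Passing from the mode in use to the sum over all modes removes the dependence on the
       first-phase outputs. *)
    { eapply Rle_trans; [|unfold end_dev; apply (lsum_ge_term (seq 0 (S m)) (fun a =>
        EX m (open_loop (in2 c2 a))
        (fun y1 y2 => le_ind (sum2 k c2 a (out k y1 y2)) (gain k a - t2))) a);
        [intros; apply Hdev0|apply in_seq; lia]].
      apply (Ex_le NX); auto. intros l1 l2 M1 M2 Hp2.
      unfold pass. destruct Rlt_dec as [Hpass|Hfail]; simpl b2R; [pose proof (le_ind_nonneg
        (sum2 k c2 a (out k l1 l2)) (gain k a - t2)); lra|].
      assert (Hsc : exp ((if k then s1 else s2) + sum2 k c2 a (out k l1 l2)) <=
        score k (c1, c2) (out k (y1 ++ l1) (y2 ++ l2))).
      { assert (HE : exp (if k then s1 else s2) = yprod (ratio1 k c1) (out k y1 y2)).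
        { rewrite (yprod_exp _ _ (path_pos_ratio1 k c1 y1 y2 Hc1 ltac:(congruence) Hp)).
          destruct k; reflexivity. }
        unfold score. simpl fst; simpl snd.
        replace (firstn n1 (out k (y1 ++ l1) (y2 ++ l2))) with (out k y1 y2).
        2:{ destruct k; simpl; rewrite firstn_app, ?L1, ?L2, Nat.sub_diag, firstn_O, app_nil_r,
             firstn_all2; auto; lia. }
        replace (skipn n1 (out k (y1 ++ l1) (y2 ++ l2))) with (out k l1 l2).
        2:{ destruct k; simpl; rewrite skipn_app, ?L1, ?L2, Nat.sub_diag, skipn_O,
             skipn_all2; auto; lia. }
        rewrite exp_plus, HE. apply Rmult_le_compat_l; [rewrite <- HE; apply Rlt_le, exp_pos|].
        unfold sum2. rewrite <- (yprod_exp _ _ (path_pos_ratio2 k c2 a l1 l2 Hc2 ltac:(congruence) Hp2)).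
        apply (lsum_ge_term (seq 0 (S m)) (fun a => yprod (ratio2 k c2 a) (out k l1 l2)));
          [|apply in_seq; lia].
        intros a' _. apply (yprod_nonneg NY).
        - intros; apply ratio2_nonneg; assumption.
        - destruct (path_pos_letters NY W1 W2 _ l1 l2 ltac:(congruence) Hp2). destruct k; assumption. }
      apply Rnot_lt_le in Hfail.
      assert (Hexp : exp ((if k then s1 else s2) + sum2 k c2 a (out k l1 l2)) <= exp gam) by lra.
      assert (Hs : (if k then s1 else s2) + sum2 k c2 a (out k l1 l2) <= gam).
      { apply Rnot_lt_le; intros HH; apply exp_increasing in HH; lra. }
      unfold le_ind. destruct Rle_dec as [R|R]; lra. }
    destruct Bool.eqb; lra.
  - unfold ind. rewrite !Ex_plus, (Ex_const NX NY W1 W2 HW1 HW2 n1 _ (end_dev c2 k) V1).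
    unfold start_dev, outage; simpl out.
    destruct Bool.eqb; [rewrite (Ex_const NX NY W1 W2 HW1 HW2 n1 _ 0 V1)|]; lra.
Qed.

Definition pair_law (t : nat * nat) : R := Pp (fst t) * Pm (snd t).

Lemma pair_law_nonneg t : In t (list_prod XX XX) -> 0 <= pair_law t.
Proof.
  destruct t as [x y]; intros H; apply in_prod_iff in H.
  apply Rmult_le_pos; [apply (is_dist_lsum NX Pp HPp)|apply (is_dist_lsum NX Pm HPm)]; tauto.
Qed.

(** Within one mode only one letter of each pair is seen, so the codeword of that mode has
    independent letters with law [law2 a i]. *)
Lemma pair_law_pick a i f :
  lsum (list_prod XX XX) (fun t => pair_law t * f (pick a i t)) =
  lsum XX (fun x => law2 a i x * f x).
Proof.
  rewrite lsum_list_prod. unfold pair_law, pick, law2. simpl.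
  destruct (is_dist_lsum NX Pp HPp) as [_ H1]. destruct (is_dist_lsum NX Pm HPm) as [_ H2].
  destruct (i <? a)%nat.
  - apply lsum_ext; intros x _.
    rewrite (lsum_ext _ _ (fun y => Pp x * f x * Pm y)) by (intros; ring).
    rewrite lsum_scal, H2; ring.
  - rewrite lsum_swap. apply lsum_ext; intros y _.
    rewrite (lsum_ext _ _ (fun x => Pm y * f y * Pp x)) by (intros; ring).
    rewrite lsum_scal, H1; ring.
Qed.

Lemma pair_law_sum : lsum (list_prod XX XX) pair_law = 1.
Proof.
  rewrite (lsum_ext _ _ (fun t => pair_law t * (fun _ => 1) (pick 0 0 t))) by (intros; ring).
  rewrite (pair_law_pick 0 0 (fun _ => 1)).
  rewrite (lsum_ext _ _ (law2 0 0)) by (intros; ring).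
  apply (is_dist_lsum NX _ (law2_dist 0 0)).
Qed.

Definition Ecode (F : supercode -> R) : R :=
  Ec XX P0 n1 (fun c1 => Ec (list_prod XX XX) pair_law m (fun c2 => F (c1, c2))).

Lemma Ecode_plus F G : Ecode (fun c => F c + G c) = Ecode F + Ecode G.
Proof.
  unfold Ecode. rewrite <- Ec_plus. apply Ec_ext.
  - apply (is_dist_lsum NX P0 HP0).
  - intros c1 _ _. apply (Ec_plus _ _ m (fun c2 => F (c1, c2)) (fun c2 => G (c1, c2))).
Qed.

Lemma Ecode_scal k F : Ecode (fun c => k * F c) = k * Ecode F.
Proof.
  unfold Ecode. rewrite <- Ec_scal. apply Ec_ext.
  - apply (is_dist_lsum NX P0 HP0).
  - intros c1 _ _. apply (Ec_scal _ _ m k (fun c2 => F (c1, c2))).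
Qed.

Lemma Ecode_le F G : (forall c, length (fst c) = n1 -> length (snd c) = m -> valid_code c -> F c <= G c) ->
  Ecode F <= Ecode G.
Proof.
  intros H. apply Ec_le; [apply (is_dist_lsum NX P0 HP0)|]. intros c1 L1 H1.
  apply Ec_le; [apply pair_law_nonneg|]. intros c2 L2 H2. apply H; try split; auto.
Qed.

Lemma Ecode_lsum {U} (B : list U) (F : U -> supercode -> R) :
  Ecode (fun c => lsum B (fun u => F u c)) = lsum B (fun u => Ecode (F u)).
Proof.
  induction B as [|u B IH]; simpl.
  - unfold Ecode. rewrite (Ec_ext _ _ (proj1 (is_dist_lsum NX P0 HP0)) _ _ (fun _ => 0)).
    + apply Ec_zero.
    + intros; apply Ec_zero.
  - rewrite (Ecode_plus (F u)), IH. reflexivity.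
Qed.

Lemma Ecode_exists F k : Ecode F <= k -> exists c, valid_code c /\ F c <= k.
Proof.
  intros H. destruct (is_dist_lsum NX P0 HP0) as [H0 H1].
  destruct (Ec_exists _ _ H0 H1 n1 _ k H) as [c1 [L1 [V1 E1]]].
  destruct (Ec_exists _ _ pair_law_nonneg pair_law_sum m _ k E1) as [c2 [L2 [V2 E2]]].
  exists (c1, c2). split; [split; assumption|exact E2].
Qed.

Lemma Ecode_Ex n phi (F : supercode -> list nat -> list nat -> R) : valid_strategy NX phi ->
  Ecode (fun c => EX n phi (F c)) = EX n phi (fun y1 y2 => Ecode (fun c => F c y1 y2)).
Proof.
  intros Hphi. unfold Ecode. destruct (is_dist_lsum NX P0 HP0) as [H0 H1].
  rewrite (Ec_ext _ _ H0 _ _ (fun c1 => EX n phi (fun y1 y2 =>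
     Ec (list_prod XX XX) pair_law m (fun c2 => F (c1, c2) y1 y2)))).
  - apply (Ec_Ex _ _ H1).
  - intros c1 _ _. apply (Ec_Ex _ _ pair_law_sum).
Qed.

Lemma Ecode_score_le k y : length y = (n1 + m)%nat -> output_in y ->
  Ecode (fun c => score k c y) <= INR m + 1.
Proof.
  intros L Hy.
  assert (Hy1 : output_in (firstn n1 y) /\ output_in (skipn n1 y)).
  { apply Forall_app. rewrite firstn_skipn; exact Hy. }
  destruct Hy1 as [Hy1 Hy2].
  assert (L1 : length (firstn n1 y) = n1) by (rewrite length_firstn; lia).
  assert (L2 : length (skipn n1 y) = m) by (rewrite length_skipn; lia).
  destruct (is_dist_lsum NX P0 HP0) as [H0 H1].
  assert (HE2 : forall a, Ec (list_prod XX XX) pair_law m (fun c2 => yprod (ratio2 k c2 a) (skipn n1 y)) <= 1).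
  { intros a. apply (Ec_yprod_le_1 (list_prod XX XX) pair_law (0%nat, 0%nat) pair_law_nonneg NY m
      (fun i t b => chan k (pick a i t) b / PW NX (law2 a i) (chan k) b)); auto.
    - intros i t b Ht Hb. apply div_nonneg.
      + apply (channel_nonneg NX NY (chan k)); auto using chan_channel, pick_lt.
      + apply (PW_nonneg NX NY (chan k) (chan_channel k)); auto using law2_dist.
    - intros i b _.
      rewrite (pair_law_pick a i (fun x => chan k x b / PW NX (law2 a i) (chan k) b)).
      apply avg_ratio_le_1. }
  assert (HE1 : Ec XX P0 n1 (fun c1 => yprod (ratio1 k c1) (firstn n1 y)) <= 1).
  { apply (Ec_yprod_le_1 XX P0 0%nat H0 NY n1
      (fun i x b => chan k x b / PW NX P0 (chan k) b)); auto.
    - intros i x b Hx Hb. apply div_nonneg.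
      + apply (channel_nonneg NX NY (chan k)); auto using chan_channel. apply (in_XX NX x Hx).
      + apply (PW_nonneg NX NY (chan k) (chan_channel k)); auto.
    - intros i b _. apply avg_ratio_le_1. }
  unfold Ecode, score. cbn [fst snd].
  apply Rle_trans with (Ec XX P0 n1 (fun c1 => (INR m + 1) * yprod (ratio1 k c1) (firstn n1 y))).
  - apply Ec_le; [exact H0|]. intros c1 _ Hc1. rewrite Ec_scal, (Ec_lsum _ _ pair_law_sum).
    rewrite Rmult_comm. apply Rmult_le_compat_r.
    + apply (yprod_nonneg NY); [intros; apply ratio1_nonneg; assumption|exact Hy1].
    + eapply Rle_trans; [apply (lsum_const_le _ _ 1); intros; apply HE2|].
      rewrite length_seq, S_INR. lra.
  - rewrite Ec_scal. pose proof (pos_INR m). nra.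
Qed.

Definition clash (k u : bool) (c c' : supercode) : R :=
  EX (n1 + m) (strat u c) (fun y1 y2 => b2R (pass k c' (out k y1 y2))).

Lemma clash_nonneg k u c c' : valid_code c -> 0 <= clash k u c c'.
Proof.
  intros H. apply (Ex_nonneg NX); auto using strat_valid. intros; unfold b2R; destruct pass; lra.
Qed.

(** A fresh codeword is independent of the outputs caused by [c], so Markov's inequality applies to
    its score, whose mean is at most [m + 1]. *)
Lemma Ecode_clash_le k u c : valid_code c ->
  Ecode (fun c' => clash k u c c') <= (INR m + 1) * exp (- gam).
Proof.
  intros Hc. unfold clash.
  rewrite (Ecode_Ex (n1 + m) (strat u c) (fun c' y1 y2 => b2R (pass k c' (out k y1 y2))))
    by (apply strat_valid; exact Hc).
  rewrite <- (Ex_const NX NY W1 W2 HW1 HW2 (n1 + m) (strat u c) ((INR m + 1) * exp (- gam))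
    (strat_valid u c Hc)).
  apply (Ex_le NX); auto using strat_valid. intros y1 y2 L1 L2 Hp.
  destruct (path_pos_letters NY W1 W2 _ y1 y2 ltac:(congruence) Hp) as [F1 F2].
  assert (L : length (out k y1 y2) = (n1 + m)%nat) by (destruct k; assumption).
  assert (F : output_in (out k y1 y2)) by (destruct k; assumption).
  apply Rle_trans with (Ecode (fun c' => exp (- gam) * score k c' (out k y1 y2))).
  - apply Ecode_le. intros c' _ _ [Hv1 Hv2]. set (y := out k y1 y2) in *.
    assert (Hs0 : 0 <= score k c' y).
    { assert (Hy1 : output_in (firstn n1 y) /\ output_in (skipn n1 y)).
      { apply Forall_app. rewrite firstn_skipn; exact F. }
      apply Rmult_le_pos.
      - apply (yprod_nonneg NY); [intros; apply ratio1_nonneg; assumption|tauto].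
      - apply lsum_nonneg; intros. apply (yprod_nonneg NY); [intros; apply ratio2_nonneg; assumption|tauto]. }
    pose proof (exp_pos (- gam)). unfold pass. destruct Rlt_dec as [Q|Q]; simpl b2R.
    + assert (exp (- gam) * exp gam = 1) by (rewrite <- exp_plus, Rplus_opp_l, exp_0; reflexivity).
      nra.
    + apply Rmult_le_pos; lra.
  - rewrite Ecode_scal. rewrite Rmult_comm. apply Rmult_le_compat_r; [apply Rlt_le, exp_pos|].
    apply Ecode_score_le; assumption.
Qed.

(** Outage is left out: the Gaussian estimate holds for every single codeword, so it constrains no
    selection. *)
Definition atypical (c : supercode) : R :=
  start_dev (fst c) true + start_dev (fst c) false + end_dev (snd c) true + end_dev (snd c) false.

Lemma start_dev_nonneg c1 k : letter_in c1 -> 0 <= start_dev c1 k.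
Proof.
  intros H. apply (Ex_nonneg NX); auto; [|intros; apply le_ind_nonneg].
  apply open_loop_valid; intros; apply in1_lt; exact H.
Qed.

Lemma end_dev_nonneg c2 k : Forall pair_letter c2 -> 0 <= end_dev c2 k.
Proof.
  intros H. apply lsum_nonneg; intros. apply (Ex_nonneg NX); auto; [|intros; apply le_ind_nonneg].
  apply open_loop_valid; intros; apply in2_lt; exact H.
Qed.

Definition bool_pairs : list (bool * bool) := list_prod [true; false] [true; false].

Definition total_clash (c c' : supercode) : R :=
  lsum bool_pairs (fun ku => clash (fst ku) (snd ku) c c').

Lemma total_clash_nonneg c c' : valid_code c -> 0 <= total_clash c c'.
Proof. intros H; apply lsum_nonneg; intros; apply clash_nonneg, H. Qed.

Lemma clash_le_total k u c c' : valid_code c -> clash k u c c' <= total_clash c c'.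
Proof.
  intros H. apply (lsum_ge_term bool_pairs (fun ku => clash (fst ku) (snd ku) c c') (k, u)).
  - intros; apply clash_nonneg, H.
  - destruct k, u; simpl; auto.
Qed.

Lemma codebook_exists h M : 0 < h -> Ecode atypical <= h ->
  exists cs : nat -> supercode, (forall i, valid_code (cs i)) /\
    forall j, (j < M)%nat -> atypical (cs j) <= 2 * h /\
      lsum (seq 0 j) (fun i => total_clash (cs i) (cs j)) <=
        8 * (INR m + 1) * exp (- gam) * (INR j + 1).
Proof.
  intros Hh Hat.
  pose (kappa := 4 * (INR m + 1) * exp (- gam)).
  assert (Hk : 0 < kappa).
  { unfold kappa. pose proof (pos_INR m). pose proof (exp_pos (- gam)).
    apply Rmult_lt_0_compat; lra. }
  destruct (greedy_selection valid_code (fun c => valid_code c /\ atypical c <= 2 * h) total_clash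
    (2 * kappa) (nil, nil)) with (M := M) as [cs [Hv Hcs]].
  - split; constructor.
  - tauto.
  (* Each of the two normalised costs has mean at most 1, so some code keeps their sum, hence each
     of them, at most 2. The factor 4 in [kappa] counts the pairs of a user and a coin value. *)
  - intros j cs Hv. pose proof (pos_INR j) as Hj.
    destruct (Ecode_exists (fun c => / h * atypical c + / (kappa * (INR j + 1)) *
      lsum (seq 0 j) (fun i => total_clash (cs i) c)) 2) as [c [Hc HF]].
    + rewrite Ecode_plus, !Ecode_scal, Ecode_lsum.
      assert (E1 : / h * Ecode atypical <= 1).
      { apply Rmult_le_reg_l with h; [exact Hh|]. rewrite <- Rmult_assoc, Rinv_r by lra. lra. }
      assert (E2 : lsum (seq 0 j) (fun i => Ecode (total_clash (cs i))) <= INR j * kappa).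
      { rewrite <- (length_seq j 0) at 2. apply lsum_const_le; intros i _.
        change (Ecode (fun c' => lsum bool_pairs (fun ku => clash (fst ku) (snd ku) (cs i) c')) <= kappa).
        rewrite Ecode_lsum.
        eapply Rle_trans; [apply lsum_const_le; intros; apply Ecode_clash_le, Hv|].
        simpl; unfold kappa; lra. }
      assert (E3 : / (kappa * (INR j + 1)) * lsum (seq 0 j) (fun i => Ecode (total_clash (cs i))) <= 1).
      { apply Rmult_le_reg_l with (kappa * (INR j + 1)); [apply Rmult_lt_0_compat; lra|].
        rewrite <- Rmult_assoc, Rinv_r by (apply Rgt_not_eq, Rmult_lt_0_compat; lra). nra. }
      replace 2 with (1 + 1) by ring. apply Rplus_le_compat; [exact E1|exact E3].
    + exists c. pose proof Hc as [Hc1 Hc2].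
      assert (A0 : 0 <= atypical c).
      { unfold atypical. pose proof (start_dev_nonneg (fst c) true Hc1).
        pose proof (start_dev_nonneg (fst c) false Hc1). pose proof (end_dev_nonneg (snd c) true Hc2).
        pose proof (end_dev_nonneg (snd c) false Hc2). lra. }
      assert (B0 : 0 <= lsum (seq 0 j) (fun i => total_clash (cs i) c)).
      { apply lsum_nonneg; intros i _. apply total_clash_nonneg, Hv. }
      assert (Hkj : 0 < kappa * (INR j + 1)) by (apply Rmult_lt_0_compat; lra).
      assert (I1 : 0 < / h) by (apply Rinv_0_lt_compat; exact Hh).
      assert (I2 : 0 < / (kappa * (INR j + 1))) by (apply Rinv_0_lt_compat; exact Hkj).
      assert (J1 : 0 <= / h * atypical c) by (apply Rmult_le_pos; lra).
      assert (J2 : 0 <= / (kappa * (INR j + 1)) * lsum (seq 0 j) (fun i => total_clash (cs i) c))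
        by (apply Rmult_le_pos; lra).
      repeat split; auto.
      * apply Rmult_le_reg_l with (/ h); [exact I1|].
        replace (/ h * (2 * h)) with 2 by (field; lra). lra.
      * apply Rmult_le_reg_l with (/ (kappa * (INR j + 1))); [exact I2|].
        replace (/ (kappa * (INR j + 1)) * (2 * kappa * (INR j + 1))) with 2 by (field; split; lra). lra.
  - exists cs. split; [exact Hv|]. intros j Hj. destruct (Hcs j Hj) as [[_ Ha] Hl].
    split; [exact Ha|]. eapply Rle_trans; [exact Hl|]. unfold kappa. right; ring.
Qed.

Lemma two_phase_code h beta eps M : (1 <= M)%nat -> 0 < h -> Ecode atypical <= h ->
  (forall c, valid_code c -> outage (fst c) <= beta) ->
  beta / 2 + 2 * h + 8 * (INR m + 1) * exp (- gam) * INR M <= eps ->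
  FLF_code_exists NX NY W1 W2 (n1 + m) M eps.
Proof.
  intros HM Hh Hat Hout Heps.
  destruct (codebook_exists h M Hh Hat) as [cs [Hv Hcs]].
  split; [exact HM|].
  set (g := fun k y => last_pass (fun j => pass k (cs j) y) M).
  set (coin := fun u : nat => Nat.eqb u 0).
  set (fs := (fun u _ j l1 l2 => strat (coin u) (cs j) l1 l2) : nat -> encoder).
  (* The randomisation is one fair coin. For each user exactly one of its values incurs the outage,
     so averaging contributes [beta / 2]. *)
  exists 2%nat, (fun _ => / 2), fs, (g true), (g false).
  assert (HMpos : 0 < INR M) by (apply lt_0_INR; lia).
  set (q := 8 * (INR m + 1) * exp (- gam) * INR M) in *.
  assert (Herr : forall k u, err_det NY (n1 + m) M W1 W2 (fs u) k (g k) <=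
    2 * h + (if Bool.eqb (coin u) k then 0 else beta) + q).
  { intros k u. rewrite err_det_Ex.
    change (fun j => EX (n1 + m) (fun l1 l2 => fs u (length l1) j l1 l2)
      (fun y1 y2 => miss (g k) j (if k then y1 else y2))) with
      (fun j => EX (n1 + m) (strat (coin u) (cs j))
        (fun y1 y2 => miss (g k) j (out k y1 y2))).
    assert (Hj : forall j, In j (seq 0 M) -> EX (n1 + m) (strat (coin u) (cs j))
        (fun y1 y2 => miss (g k) j (out k y1 y2)) <=
      2 * h + (if Bool.eqb (coin u) k then 0 else beta) +
      lsum (seq 0 M) (fun i => b2R (j <? i)%nat * total_clash (cs j) (cs i))).
    { intros j Hj. apply in_seq in Hj.
      pose proof (strat_valid (coin u) (cs j) (Hv j)) as Hst.
      apply Rle_trans with (EX (n1 + m) (strat (coin u) (cs j)) (fun y1 y2 =>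
        (1 - b2R (pass k (cs j) (out k y1 y2))) +
        lsum (seq 0 M) (fun i => b2R (j <? i)%nat * b2R (pass k (cs i) (out k y1 y2))))).
      - apply (Ex_le NX); auto. intros y1 y2 _ _ _. set (y := out k y1 y2).
        assert (Hs0 : forall i, 0 <= b2R (j <? i)%nat * b2R (pass k (cs i) y)).
        { intros i; unfold b2R; destruct Nat.ltb, pass; lra. }
        assert (Hl0 : 0 <= lsum (seq 0 M) (fun i => b2R (j <? i)%nat * b2R (pass k (cs i) y))).
        { apply lsum_nonneg; auto. }
        assert (Hb0 : 0 <= 1 - b2R (pass k (cs j) y)) by (unfold b2R; destruct pass; lra).
        unfold miss. destruct (Nat.eqb_spec (g k y) j) as [E|E]; [lra|].
        destruct (last_pass_miss _ M j ltac:(lia) E) as [Hp|[i [Hi Hp]]].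
        { rewrite Hp in *. simpl b2R at 1. lra. }
        assert (1 <= lsum (seq 0 M) (fun i => b2R (j <? i)%nat * b2R (pass k (cs i) y))).
        { eapply Rle_trans; [|apply (lsum_ge_term (seq 0 M) (fun i => b2R (j <? i)%nat * b2R (pass k (cs i) y)) i);
            [auto|apply in_seq; lia]].
          rewrite Hp. destruct (Nat.ltb_spec j i); [simpl; lra|lia]. }
        lra.
      - rewrite Ex_plus, Ex_lsum. apply Rplus_le_compat.
        + eapply Rle_trans; [apply fail_bound, Hv|].
          destruct (Hcs j ltac:(lia)) as [Ha _]. unfold atypical in Ha.
          pose proof (end_dev_nonneg (snd (cs j)) true (proj2 (Hv j))).
          pose proof (end_dev_nonneg (snd (cs j)) false (proj2 (Hv j))).
          pose proof (Hout (cs j) (Hv j)).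
          destruct k, (Bool.eqb (coin u) _); lra.
        + apply lsum_le; intros i _. rewrite Ex_scal.
          apply Rmult_le_compat_l; [unfold b2R; destruct Nat.ltb; lra|].
          apply (clash_le_total k (coin u)), Hv. }
    apply Rle_trans with (/ INR M * lsum (seq 0 M) (fun j =>
      (2 * h + (if Bool.eqb (coin u) k then 0 else beta)) +
      lsum (seq 0 M) (fun i => b2R (j <? i)%nat * total_clash (cs j) (cs i)))).
    { apply Rmult_le_compat_l; [apply Rlt_le, Rinv_0_lt_compat, HMpos|]. apply lsum_le; exact Hj. }
    rewrite lsum_plus, lsum_swap.
    assert (Hcl : lsum (seq 0 M) (fun i => lsum (seq 0 M) (fun j =>
      b2R (j <? i)%nat * total_clash (cs j) (cs i))) <= INR M * q).
    { eapply Rle_trans; [apply (lsum_const_le _ _ q)|rewrite length_seq; lra]. intros i Hi; apply in_seq in Hi.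
      (* Only messages before [i] can be lost to [i], and for these the selection of codeword [i]
         bounded the total clash. *)
      replace (seq 0 M) with (seq 0 i ++ seq i (M - i)).
      2:{ symmetry; replace M with (i + (M - i))%nat at 1 by lia. apply seq_app. }
      rewrite lsum_app.
      rewrite (lsum_ext (seq 0 i) _ (fun j => total_clash (cs j) (cs i))).
      2:{ intros j Hj2; apply in_seq in Hj2. destruct (Nat.ltb_spec j i); [simpl; ring|lia]. }
      rewrite (lsum_ext (seq i (M - i)) _ (fun _ => 0)).
      2:{ intros j Hj2; apply in_seq in Hj2. destruct (Nat.ltb_spec j i); [lia|simpl; ring]. }
      rewrite lsum_zero, Rplus_0_r.
      destruct (Hcs i ltac:(lia)) as [_ Hc]. eapply Rle_trans; [exact Hc|]. unfold q.
      apply Rmult_le_compat_l.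
      - pose proof (pos_INR m). pose proof (exp_pos (- gam)). apply Rmult_le_pos; lra.
      - rewrite <- S_INR. apply le_INR. lia. }
    assert (Hcst : lsum (seq 0 M) (fun _ => 2 * h + (if Bool.eqb (coin u) k then 0 else beta)) <=
      INR M * (2 * h + (if Bool.eqb (coin u) k then 0 else beta))).
    { eapply Rle_trans; [apply lsum_const_le; intros; right; reflexivity|rewrite length_seq; lra]. }
    apply Rmult_le_reg_l with (INR M); [exact HMpos|].
    rewrite <- Rmult_assoc, Rinv_r, Rmult_1_l by lra. lra. }
  repeat split.
  - intros; lra.
  - simpl; lra.
  - intros u i j y1 y2 _. apply strat_valid, Hv.
  - simpl. pose proof (Herr true 0%nat) as E0. pose proof (Herr true 1%nat) as E1. simpl in E0, E1. lra.
  - simpl. pose proof (Herr false 0%nat) as E0. pose proof (Herr false 1%nat) as E1. simpl in E0, E1. lra.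
Qed.

End TwoPhase.

(** * Atypical codewords *)

Lemma sumR_const n c : sumR n (fun _ => c) = INR n * c.
Proof. induction n as [|n IH]; [simpl; ring|]. rewrite S_INR; simpl; rewrite IH; ring. Qed.

Lemma sumR_threshold m a (p q : R) : (a <= m)%nat ->
  sumR m (fun i => if (i <? a)%nat then p else q) = INR a * p + (INR m - INR a) * q.
Proof.
  induction m as [|m IH]; intros Ha.
  - replace a with 0%nat by lia; simpl; ring.
  - destruct (Nat.eq_dec a (S m)) as [E|E].
    + subst a. rewrite (sumR_ext _ _ (fun _ => p)).
      * rewrite sumR_const; ring.
      * intros i Hi. destruct (Nat.ltb_spec i (S m)); [reflexivity|lia].
    + change (sumR (S m) ?f) with (sumR m f + f m). cbv beta. rewrite IH by lia.
      destruct (Nat.ltb_spec m a); [lia|]. rewrite S_INR; ring.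
Qed.

Section DeviationAverages.
Context (NX NY : nat) (W1 W2 : nat -> nat -> R) (P0 Pp Pm : nat -> R) (n1 m : nat) (B : R).
Hypothesis (HNX : (1 <= NX)%nat).
Hypothesis (HW1 : is_channel NX NY W1) (HW2 : is_channel NX NY W2)
  (HP0 : is_dist NX P0) (HPp : is_dist NX Pp) (HPm : is_dist NX Pm).

Local Notation XX := (seq 0 NX).
Local Notation YY := (seq 0 NY).
Local Notation ch := (chan W1 W2).

Definition dens_close (P : nat -> R) : Prop := forall k x y, In x XX -> In y YY -> 0 < ch k x y ->
  Rabs (ln (ch k x y / PW NX P (ch k) y) - MI NX NY P (ch k)) <= B.

Hypothesis (HB0 : dens_close P0) (HBp : dens_close Pp) (HBm : dens_close Pm).

(** Makes user [k] the owner of the first output, so that one Chernoff bound covers both users. *)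
Lemma Ex_open_loop_out k n X (F : list nat -> R) :
  Ex NY W1 W2 n (open_loop X) (fun y1 y2 => F (out k y1 y2)) =
  Ex NY (ch k) (ch (negb k)) n (open_loop X) (fun y1 y2 => F y1).
Proof. destruct k; simpl; [reflexivity|]. rewrite Ex_open_loop_swap. reflexivity. Qed.

Lemma Ec_start_dev k lam s : 0 <= lam -> lam * B <= / 2 ->
  Ec XX P0 n1 (fun c1 => start_dev NX NY W1 W2 P0 n1 (INR n1 * MI NX NY P0 (ch k) - s) c1 k)
  <= exp (- lam * s) * exp (2 * lam ^ 2 * B ^ 2) ^ n1.
Proof.
  intros Hl HlB. destruct (is_dist_lsum NX P0 HP0) as [Hp0 Hp1].
  eapply Rle_trans; [|apply (lower_deviation XX P0 0%nat Hp0 NX NY (ch k) (ch (negb k))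
     (chan_channel NX NY W1 W2 HW1 HW2 k) (chan_channel NX NY W1 W2 HW1 HW2 (negb k)) n1
     (fun _ x => x) (fun _ x b => ln (ch k x b / PW NX P0 (ch k) b)) (fun _ => MI NX NY P0 (ch k)) lam
     (exp (2 * lam ^ 2 * B ^ 2)) s)].
  - rewrite sumR_const. apply Ec_le; [exact Hp0|]. intros c1 _ Hc1. unfold start_dev, sum1.
    rewrite (Ex_open_loop_out k n1 (in1 c1) (fun y => le_ind (ysum (fun i b => ln (ratio1 NX W1 W2 P0 k c1 i b)) y)
      (INR n1 * MI NX NY P0 (ch k) - s))). right; reflexivity.
  - intros _ t [Ht|Ht]; [apply (in_XX NX), Ht|subst; lia].
  - apply Rlt_le, exp_pos.
  - exact Hl.
  - intros _. apply mgf_step; auto using chan_channel.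
Qed.

Lemma law2_dens_close a i : dens_close (law2 Pp Pm a i).
Proof. unfold law2; destruct Nat.ltb; assumption. Qed.

Definition mode_gain (k : bool) (a : nat) : R := sumR m (fun i => MI NX NY (law2 Pp Pm a i) (ch k)).

Lemma Ec_end_dev k lam s : 0 <= lam -> lam * B <= / 2 ->
  Ec (list_prod XX XX) (pair_law Pp Pm) m (fun c2 =>
    end_dev NX NY W1 W2 Pp Pm m s (mode_gain true) (mode_gain false) c2 k)
  <= (INR m + 1) * (exp (- lam * s) * exp (2 * lam ^ 2 * B ^ 2) ^ m).
Proof.
  intros Hl HlB. pose proof (pair_law_nonneg NX Pp Pm HPp HPm) as Hp0.
  pose proof (pair_law_sum NX Pp Pm HPp HPm) as Hp1.
  unfold end_dev. rewrite (Ec_lsum _ _ Hp1).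
  eapply Rle_trans; [apply (lsum_const_le _ _ (exp (- lam * s) * exp (2 * lam ^ 2 * B ^ 2) ^ m))|
    rewrite length_seq, S_INR; lra].
  intros a _.
  eapply Rle_trans; [|apply (lower_deviation (list_prod XX XX) (pair_law Pp Pm) (0%nat, 0%nat) Hp0
     NX NY (ch k) (ch (negb k))
     (chan_channel NX NY W1 W2 HW1 HW2 k) (chan_channel NX NY W1 W2 HW1 HW2 (negb k)) m
     (fun i t => pick a i t)
     (fun i t b => ln (ch k (pick a i t) b / PW NX (law2 Pp Pm a i) (ch k) b))
     (fun i => MI NX NY (law2 Pp Pm a i) (ch k)) lam (exp (2 * lam ^ 2 * B ^ 2)) s)].
  - apply Ec_le; [exact Hp0|]. intros c2 _ Hc2. unfold sum2.
    rewrite (Ex_open_loop_out k m (in2 c2 a) (fun y => le_ind (ysum (fun i b =>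
      ln (ratio2 NX W1 W2 Pp Pm k c2 a i b)) y) (gain (mode_gain true) (mode_gain false) k a - s))).
    right. destruct k; reflexivity.
  - intros i t Ht; apply (pick_lt NX HNX); exact Ht.
  - apply Rlt_le, exp_pos.
  - exact Hl.
  - intros i. rewrite (pair_law_pick NX Pp Pm HPp HPm a i (fun x => lsum YY (fun b => ch k x b *
      exp (- lam * (ln (ch k x b / PW NX (law2 Pp Pm a i) (ch k) b) - MI NX NY (law2 Pp Pm a i) (ch k)))))).
    apply mgf_step; auto using chan_channel, law2_dist.
    intros x y; apply law2_dens_close.
Qed.

(** There are two users in each phase, and a union over the [m + 1] modes in the second. *)
Lemma Ecode_atypical_le lo lam1 s1 lam2 s2 :
  (forall k, lo = INR n1 * MI NX NY P0 (ch k) - s1) ->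
  0 <= lam1 -> lam1 * B <= / 2 -> 0 <= lam2 -> lam2 * B <= / 2 ->
  Ecode NX P0 Pp Pm n1 m (atypical NX NY W1 W2 P0 Pp Pm n1 m s2 lo (mode_gain true) (mode_gain false))
  <= 2 * (exp (- lam1 * s1) * exp (2 * lam1 ^ 2 * B ^ 2) ^ n1) +
     2 * ((INR m + 1) * (exp (- lam2 * s2) * exp (2 * lam2 ^ 2 * B ^ 2) ^ m)).
Proof.
  intros Hlo L1 L1B L2 L2B.
  set (sd := start_dev NX NY W1 W2 P0 n1 lo).
  set (ed := end_dev NX NY W1 W2 Pp Pm m s2 (mode_gain true) (mode_gain false)).
  change (Ecode NX P0 Pp Pm n1 m (fun c => sd (fst c) true + sd (fst c) false +
    ed (snd c) true + ed (snd c) false) <=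
     2 * (exp (- lam1 * s1) * exp (2 * lam1 ^ 2 * B ^ 2) ^ n1) +
     2 * ((INR m + 1) * (exp (- lam2 * s2) * exp (2 * lam2 ^ 2 * B ^ 2) ^ m))).
  rewrite (Ecode_plus NX P0 Pp Pm n1 m HP0
    (fun c => sd (fst c) true + sd (fst c) false + ed (snd c) true) (fun c => ed (snd c) false)).
  rewrite (Ecode_plus NX P0 Pp Pm n1 m HP0
    (fun c => sd (fst c) true + sd (fst c) false) (fun c => ed (snd c) true)).
  rewrite (Ecode_plus NX P0 Pp Pm n1 m HP0
    (fun c => sd (fst c) true) (fun c => sd (fst c) false)).
  destruct (is_dist_lsum NX P0 HP0) as [Hp0 Hp1].
  pose proof (pair_law_nonneg NX Pp Pm HPp HPm) as Hq0.
  pose proof (pair_law_sum NX Pp Pm HPp HPm) as Hq1.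
  assert (S : forall k, Ecode NX P0 Pp Pm n1 m (fun c => sd (fst c) k) <=
    exp (- lam1 * s1) * exp (2 * lam1 ^ 2 * B ^ 2) ^ n1).
  { intros k. eapply Rle_trans; [|apply (Ec_start_dev k lam1 s1 L1 L1B)].
    unfold Ecode. apply Ec_le; [exact Hp0|]. intros c1 _ _. simpl fst.
    rewrite (Ec_const _ _ Hq1). unfold sd. rewrite (Hlo k). lra. }
  assert (E : forall k, Ecode NX P0 Pp Pm n1 m (fun c => ed (snd c) k) <=
    (INR m + 1) * (exp (- lam2 * s2) * exp (2 * lam2 ^ 2 * B ^ 2) ^ m)).
  { intros k. unfold Ecode. simpl snd. rewrite (Ec_const _ _ Hp1).
    apply (Ec_end_dev k lam2 s2 L2 L2B). }
  pose proof (S true). pose proof (S false). pose proof (E true). pose proof (E false). lra.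
Qed.

End DeviationAverages.

Lemma nat_floor x : 0 <= x -> exists a : nat, INR a <= x < INR a + 1.
Proof. intros H. destruct (nfloor_ex x H) as [a Ha]. exists a; exact Ha. Qed.

(** * Asymptotic scales *)

Lemma Rpower_root_pow x k : 0 < x -> (0 < k)%nat -> Rpower x (/ INR k) ^ k = x.
Proof.
  intros Hx Hk. rewrite <- Rpower_pow by (apply exp_pos).
  rewrite Rpower_mult, Rinv_l by (apply not_0_INR; lia). apply Rpower_1; exact Hx.
Qed.

(* With [p = n^(1/12)] every power of [n] in the error analysis is a power of [p]. *)
Lemma eventually_scales D : 1 <= D -> exists n0 : nat, forall n : nat, (n >= n0)%nat ->
  exists p l, INR n = p ^ 12 /\ Rpower (INR n) (1 / 3) = p ^ 4 /\ ln (INR n) = l ^ 2 /\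
    D <= p /\ D <= l /\ D * l <= p ^ 2.
Proof.
  intros HD. set (P := 12 * D ^ 2 + D). assert (HP : 1 <= P) by (unfold P; nra).
  destruct (nat_floor (P ^ 12 + exp (D ^ 2))) as [n0 [_ Hn0]].
  { pose proof (exp_pos (D ^ 2)). pose proof (pow_lt P 12 ltac:(lra)). lra. }
  exists (S n0). intros n Hn.
  assert (HnR : P ^ 12 + exp (D ^ 2) <= INR n).
  { apply Rle_trans with (INR (S n0)); [rewrite S_INR; lra|apply le_INR; lia]. }
  pose proof (exp_pos (D ^ 2)) as HE. pose proof (pow_lt P 12 ltac:(lra)) as HP12.
  assert (Hpos : 0 < INR n) by lra.
  set (p := Rpower (INR n) (/ INR 12)). set (l := sqrt (ln (INR n))).
  assert (Hln : D ^ 2 <= ln (INR n)).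
  { rewrite <- (ln_exp (D ^ 2)). apply ln_le; [exact HE|lra]. }
  assert (Hp : INR n = p ^ 12) by (symmetry; apply Rpower_root_pow; [exact Hpos|lia]).
  assert (Hl : ln (INR n) = l ^ 2) by (symmetry; apply pow2_sqrt; nra).
  assert (Hl0 : 0 <= l) by apply sqrt_pos.
  assert (HpP : P <= p).
  { replace P with (Rpower (P ^ 12) (/ INR 12)).
    - apply Rle_Rpower_l; [apply Rlt_le, Rinv_0_lt_compat, lt_0_INR; lia|lra].
    - rewrite <- Rpower_pow, Rpower_mult, Rinv_r by (try apply not_0_INR; lia || lra).
      apply Rpower_1; lra. }
  assert (HDP : D <= P) by (unfold P; nra).
  exists p, l. repeat split; auto.
  - unfold p. rewrite <- Rpower_pow by apply exp_pos. rewrite Rpower_mult. f_equal.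
    simpl INR. field.
  - lra.
  - apply Rnot_lt_le; intros H. nra.
  - assert (Hl2 : l ^ 2 <= 12 * p).
    { rewrite <- Hl, Hp, ln_pow by lra. pose proof (ln_le_pred p ltac:(lra)). simpl INR. lra. }
    assert (HD12 : 12 * D ^ 2 <= p) by (unfold P in HpP; lra).
    apply Rnot_lt_le; intros H.
    assert (p ^ 2 * p ^ 2 < (D * l) * (D * l)) by (assert (0 <= p ^ 2) by nra; nra).
    assert ((D * l) * (D * l) <= D ^ 2 * (12 * p)).
    { replace ((D * l) * (D * l)) with (D ^ 2 * l ^ 2) by ring. apply Rmult_le_compat_l; nra. }
    assert (D ^ 2 * (12 * p) <= p * p) by nra.
    assert (Hp2 : 1 <= p ^ 2) by nra. replace (p * p) with (p ^ 2) in * by ring. nra.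
Qed.

Lemma gauss_pdf_lower c r : Rabs c <= r -> gauss_pdf r <= gauss_pdf c.
Proof.
  intros H. unfold gauss_pdf. apply Rmult_le_compat_l; [apply Rlt_le, inv_sqrt_2PI_le|].
  apply exp_le_compat. pose proof (Rabs_pos c). rewrite <- (pow2_abs c). nra.
Qed.

(** On an interval of length at most 1 next to [- q] the density is at least its value at
    [Rabs q + 1]; this converts probability errors into shifts of the threshold. *)
Lemma Phi_shift q y : 0 <= y <= 1 ->
  Phi (- q - y) <= Phi (- q) - gauss_pdf (Rabs q + 1) * y /\
  Phi (- q) + gauss_pdf (Rabs q + 1) * y <= Phi (- q + y).
Proof.
  intros Hy. pose proof (Rle_abs q). pose proof (Rle_abs (- q)) as HA. rewrite Rabs_Ropp in HA.
  split.
  - destruct (Phi_mvt (- q - y) (- q) ltac:(lra)) as [c [Hc E]].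
    assert (gauss_pdf (Rabs q + 1) <= gauss_pdf c) by (apply gauss_pdf_lower, Rabs_le; lra).
    nra.
  - destruct (Phi_mvt (- q) (- q + y) ltac:(lra)) as [c [Hc E]].
    assert (gauss_pdf (Rabs q + 1) <= gauss_pdf c) by (apply gauss_pdf_lower, Rabs_le; lra).
    nra.
Qed.

Lemma sqrt_near X a e : 0 < a -> 0 <= X -> Rabs (X - a ^ 2) <= e * a -> Rabs (sqrt X - a) <= e.
Proof.
  intros Ha HX He. pose proof (sqrt_pos X) as H0.
  assert (HE : X - a ^ 2 = (sqrt X - a) * (sqrt X + a)).
  { rewrite <- (sqrt_sqrt X HX) at 1. ring. }
  rewrite HE, Rabs_mult, (Rabs_right (sqrt X + a)) in He by lra.
  pose proof (Rabs_pos (sqrt X - a)).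
  apply Rmult_le_reg_r with a; [exact Ha|]. nra.
Qed.

(** * The two bounds *)

Section Coding.
Context (NX NY : nat) (W1 W2 : nat -> nat -> R) (Pstar : nat -> R) (eta : R) (v : nat -> R).
Context (C V B kappa Bz : R).

Local Notation XX := (seq 0 NX).
Local Notation YY := (seq 0 NY).
Local Notation ch := (chan W1 W2).
Local Notation Pt := (shifted Pstar v).
Local Notation zmix := (mixed_dens NX W1 W2 Pstar eta).
Local Notation close_to := (dens_close NX NY W1 W2 B).

Hypothesis (HNX : (1 <= NX)%nat) (HW1 : is_channel NX NY W1) (HW2 : is_channel NX NY W2)
  (HPd : is_dist NX Pstar) (Heta01 : 0 < eta < 1).
Hypothesis (HC : forall k, MI NX NY Pstar (ch k) = C).
Hypothesis (Hstar : close_to Pstar)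
  (Hstarpos : forall k x b, In x XX -> In b YY -> 0 < ch k x b ->
     0 < PW NX Pstar (ch k) b).

Definition good_shift (t : R) : Prop :=
  is_dist NX (Pt t) /\ close_to (Pt t) /\
  (forall k x b, In x XX -> In b YY -> 0 < ch k x b -> 0 < PW NX (Pt t) (ch k) b) /\
  C + t * (1 - eta) - kappa * t ^ 2 <= MI NX NY (Pt t) W1 /\
  C - t * eta - kappa * t ^ 2 <= MI NX NY (Pt t) W2.

Hypothesis (HBz : 0 <= Bz) (HV : 0 < V)
  (Hz : walk_law NX NY W1 W2 (fun x a b => zmix x a b - C) V Bz).

(** Switching after [a] positions leaves a net tilt [r]: opposite shifts cancel to first order,
    while the curvature loss is paid at all [m] positions. *)
Lemma mode_gain_ge m tau a : good_shift tau -> good_shift (- tau) -> (a <= m)%nat ->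
  let r := (2 * INR a - INR m) * tau in
  INR m * C + r * (1 - eta) - INR m * kappa * tau ^ 2 <=
    mode_gain NX NY W1 W2 (Pt tau) (Pt (- tau)) m true a /\
  INR m * C - r * eta - INR m * kappa * tau ^ 2 <=
    mode_gain NX NY W1 W2 (Pt tau) (Pt (- tau)) m false a.
Proof.
  intros [_ [_ [_ [P1 P2]]]] [_ [_ [_ [M1 M2]]]] Ha r.
  assert (E : forall k, mode_gain NX NY W1 W2 (Pt tau) (Pt (- tau)) m k a =
    INR a * MI NX NY (Pt tau) (ch k) + (INR m - INR a) * MI NX NY (Pt (- tau)) (ch k)).
  { intros k. rewrite <- sumR_threshold by exact Ha. apply sumR_ext; intros i _.
    unfold law2. destruct Nat.ltb; reflexivity. }
  rewrite !E. simpl ch. pose proof (pos_INR a) as H0. apply le_INR in Ha.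
  apply (Rmult_le_compat_l (INR a) _ _ H0) in P1. apply (Rmult_le_compat_l (INR a) _ _ H0) in P2.
  apply (Rmult_le_compat_l (INR m - INR a)) in M1; [|lra].
  apply (Rmult_le_compat_l (INR m - INR a)) in M2; [|lra].
  unfold r. replace ((- tau) ^ 2) with (tau ^ 2) in * by ring.
  split; [eapply Rle_trans; [|apply Rplus_le_compat; [exact P1|exact M1]]
         |eapply Rle_trans; [|apply Rplus_le_compat; [exact P2|exact M2]]]; right; ring.
Qed.

Lemma path_sum_mixed c1 y1 y2 n : length y1 = n -> length y2 = n ->
  path_sum (fun x a b => zmix x a b - C) (open_loop (in1 c1)) y1 y2 =
  mix1 NX W1 W2 Pstar eta c1 y1 y2 - INR n * C.
Proof.
  intros L1 L2.
  rewrite (path_sum_affine _ (dens1 W1 (PW NX Pstar W1)) (dens2 W2 (PW NX Pstar W2)) eta (1 - eta) (- C)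
    _ _ _ n) by (auto; intros; unfold mixed_dens, dens1, dens2; ring).
  assert (E : forall X l1 l2 (q1 q2 : nat -> R), length l1 = length l2 ->
    path_sum (dens1 W1 q1) (open_loop X) l1 l2 = ysum (fun i b => ln (W1 (X i) b / q1 b)) l1 /\
    path_sum (dens2 W2 q2) (open_loop X) l1 l2 = ysum (fun i b => ln (W2 (X i) b / q2 b)) l2).
  { intros X l1; revert X; induction l1 as [|a l1 IH]; intros X [|b l2] q1 q2 L; try discriminate;
      [split; reflexivity|].
    injection L as L. destruct (IH (fun i => X (S i)) l2 q1 q2 L) as [E1 E2].
    cbn [path_sum ysum]. change (next_strategy (open_loop X) a b) with (open_loop (fun i => X (S i))).
    rewrite E1, E2. split; reflexivity. }
  destruct (E (in1 c1) y1 y2 (PW NX Pstar W1) (PW NX Pstar W2) ltac:(congruence)) as [E1 E2].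
  rewrite E1, E2. unfold mix1, sum1, ratio1. simpl ch. ring.
Qed.

Lemma outage_le n1 thr del d c1 : Forall (fun x => In x XX) c1 -> 1 <= del -> 0 < d ->
  outage NX NY W1 W2 Pstar n1 thr eta c1 <=
  Phi ((thr - INR n1 * C + 2 * d) / sqrt (del ^ 2 + INR n1 * V)) + clt_const V Bz / del + 2 / (d / del) ^ 2.
Proof.
  intros Hc Hdel Hd.
  assert (Hv : valid_strategy NX (open_loop (in1 c1))).
  { apply open_loop_valid; intros; apply (in1_lt NX HNX); exact Hc. }
  eapply Rle_trans; [|apply (walk_cdf_upper NX NY W1 W2 _ V Bz n1 (open_loop (in1 c1)) del d
    (thr - INR n1 * C) HW1 HW2 Hz HV HBz Hdel Hd Hv)].
  apply (Ex_le NX); auto. intros y1 y2 L1 L2 _. rewrite (path_sum_mixed c1 y1 y2 n1 L1 L2).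
  unfold le_ind. destruct Rle_dec; destruct Rle_dec; lra.
Qed.

Lemma achievability_finite n1 m M gam lam1 s1 lam2 s2 tau del d h eps :
  (1 <= M)%nat -> 0 < tau -> good_shift tau -> good_shift (- tau) ->
  0 <= lam1 -> lam1 * B <= / 2 -> 0 <= lam2 -> lam2 * B <= / 2 ->
  0 < h -> 2 * (exp (- lam1 * s1) * exp (2 * lam1 ^ 2 * B ^ 2) ^ n1) +
     2 * ((INR m + 1) * (exp (- lam2 * s2) * exp (2 * lam2 ^ 2 * B ^ 2) ^ m)) <= h ->
  gam <= INR n1 * C - s1 + INR m * C + eta * (INR m * tau) - INR m * kappa * tau ^ 2 - s2 ->
  gam <= INR n1 * C - s1 + INR m * C + (1 - eta) * (INR m * tau) - INR m * kappa * tau ^ 2 - s2 ->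
  1 <= del -> 0 < d ->
  let loss := 2 * tau + INR m * kappa * tau ^ 2 + s2 + 2 * d in
  (Phi ((gam - (INR n1 + INR m) * C + loss) / sqrt (del ^ 2 + INR n1 * V)) +
     clt_const V Bz / del + 2 / (d / del) ^ 2) / 2
    + 2 * h + 8 * (INR m + 1) * exp (- gam) * INR M <= eps ->
  FLF_code_exists NX NY W1 W2 (n1 + m) M eps.
Proof.
  intros HM Htau HG1 HG2 L1 L1B L2 L2B Hh Hhle Hg1 Hg2 Hdel Hd loss Heps.
  set (thr := gam - INR m * C + 2 * tau + INR m * kappa * tau ^ 2 + s2).
  set (lo := INR n1 * C - s1).
  pose proof HG1 as [HD1 [HB1 [HQ1 _]]]. pose proof HG2 as [HD2 [HB2 [HQ2 _]]].
  set (mu1 := mode_gain NX NY W1 W2 (Pt tau) (Pt (- tau)) m true).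
  set (mu2 := mode_gain NX NY W1 W2 (Pt tau) (Pt (- tau)) m false).
  assert (Hm0 : 0 <= INR m) by apply pos_INR.
  assert (Hgm : mu1 m >= INR m * C + (1 - eta) * (INR m * tau) - INR m * kappa * tau ^ 2 /\
     mu2 m >= INR m * C - eta * (INR m * tau) - INR m * kappa * tau ^ 2).
  { destruct (mode_gain_ge m tau m HG1 HG2 (le_n m)) as [E1 E2]. unfold mu1, mu2.
    replace ((2 * INR m - INR m) * tau) with (INR m * tau) in * by ring. lra. }
  assert (Hg0 : mu1 0%nat >= INR m * C - (1 - eta) * (INR m * tau) - INR m * kappa * tau ^ 2 /\
     mu2 0%nat >= INR m * C + eta * (INR m * tau) - INR m * kappa * tau ^ 2).
  { destruct (mode_gain_ge m tau 0%nat HG1 HG2 ltac:(lia)) as [E1 E2]. unfold mu1, mu2.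
    simpl INR in *. replace ((2 * 0 - INR m) * tau) with (- (INR m * tau)) in * by ring. lra. }
  apply (two_phase_code NX NY W1 W2 Pstar (Pt tau) (Pt (- tau)) n1 m gam s2 lo thr eta mu1 mu2
    HNX HW1 HW2 HPd HD1 HD2 Hstarpos HQ1 HQ2) with (h := h)
    (beta := Phi ((gam - (INR n1 + INR m) * C + loss) / sqrt (del ^ 2 + INR n1 * V)) +
     clt_const V Bz / del + 2 / (d / del) ^ 2); auto.
  - intros a1 a2 A1 A2 A3. unfold lo in A1, A2.
    destruct (Rlt_dec (INR m * tau) (a1 - a2)) as [Q|Q].
    (* If the sums differ by more than the largest tilt, the extreme mode is used. The weaker user
       is then served because its sum exceeds [lo], the stronger one because it stays above the
       mixed sum, up to the curvature loss. *)
    { exists 0%nat. split; [lia|]. split; nra. }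
    destruct (Rlt_dec (a1 - a2) (- (INR m * tau))) as [Q'|Q'].
    { exists m. split; [lia|]. split; nra. }
    apply Rnot_lt_le in Q. apply Rnot_lt_le in Q'.
    assert (HDt : - INR m <= (a1 - a2) / tau <= INR m).
    { split; [apply Rle_div_r|apply Rle_div_l]; lra. }
    (* Chosen so that the tilt [r] cancels [a1 - a2] up to [2 * tau]; both users then end near the
       mixed sum, which exceeds [thr]. *)
    destruct (nat_floor ((INR m - (a1 - a2) / tau) / 2) ltac:(lra)) as [a [Ha1 Ha2]].
    assert (Ham : (a <= m)%nat) by (apply INR_le; lra).
    exists a. split; [exact Ham|].
    destruct (mode_gain_ge m tau a HG1 HG2 Ham) as [E1 E2]. fold mu1 in E1. fold mu2 in E2.
    set (r := (2 * INR a - INR m) * tau) in *.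
    assert (Htt : (a1 - a2) / tau * tau = a1 - a2) by (field; lra).
    assert (Hr : - (a1 - a2) - 2 * tau <= r <= - (a1 - a2)).
    { rewrite <- Htt. set (w := (a1 - a2) / tau) in *.
      assert (- w - 2 <= 2 * INR a - INR m <= - w) by lra. unfold r. split; nra. }
    unfold thr in A3. split; nra.
  - intros s Hs. unfold lo in Hs. lra.
  - intros s Hs. unfold lo in Hs. lra.
  - eapply Rle_trans; [|exact Hhle].
    apply (Ecode_atypical_le NX NY W1 W2 Pstar (Pt tau) (Pt (- tau)) n1 m B HNX HW1 HW2 HPd HD1 HD2
      Hstar HB1 HB2 lo lam1 s1 lam2 s2); auto.
    intros k. rewrite HC. reflexivity.
  - intros c [Hc1 _]. eapply Rle_trans; [apply (outage_le n1 thr del d (fst c) Hc1 Hdel Hd)|].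
    replace (thr - INR n1 * C + 2 * d) with (gam - (INR n1 + INR m) * C + loss)
      by (unfold thr, loss; ring). lra.
Qed.

Context (t0 eps q : R).
Hypothesis (Ht0 : 0 < t0) (Hshift : forall t, Rabs t <= t0 -> good_shift t)
  (HB : 0 <= B) (Hkappa : 0 <= kappa) (Hq : Phi (- q) = 2 * eps).

Let sv := sqrt V.
Let gmin := gauss_pdf (Rabs q + 1).
Let cc := clt_const V Bz.

Lemma sv_facts : 0 < sv /\ sv ^ 2 = V.
Proof. split; [apply sqrt_lt_R0; exact HV|apply pow2_sqrt; lra]. Qed.

Lemma cc_nonneg : 0 <= cc.
Proof. apply clt_const_nonneg; assumption. Qed.

Lemma inv_pow_le p a b : 1 <= p -> (a <= b)%nat -> / p ^ b <= / p ^ a.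
Proof.
  intros Hp H. apply Rinv_le_contravar; [apply pow_lt; lra|apply Rle_pow; assumption].
Qed.

Lemma converse_asymptotic : exists K D, 0 <= K /\ 1 <= D /\ forall n M p l,
  INR n = p ^ 12 -> ln (INR n) = l ^ 2 -> D <= p -> D <= l ->
  FLF_code_exists NX NY W1 W2 n M eps ->
  ln (INR M) <= INR n * C - p ^ 6 * sv * q + K * p ^ 4 * l ^ 2.
Proof.
  destruct sv_facts as [Hsv Hsv2]. pose proof cc_nonneg as Hcc.
  assert (Hg : 0 < gmin) by apply gauss_pdf_pos.
  (* The converse has an excess probability of at most [(cc + 4) / p ^ 2], where 4 collects the
     smoothing tail and the change of measure. With 5 here the corresponding shift of [- q] strictly
     exceeds it. *)
  set (K4 := (cc + 5) / gmin). assert (HK4 : 0 < K4) by (apply Rdiv_lt_0_compat; lra).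
  set (K := 2 + (Rabs q + K4) / sv + sv * K4).
  assert (Hs0 : 0 < / sv) by (apply Rinv_0_lt_compat; exact Hsv).
  assert (HK0 : 0 <= (Rabs q + K4) / sv).
  { apply Rmult_le_pos; [pose proof (Rabs_pos q); lra|lra]. }
  assert (HK1 : 0 <= sv * K4) by nra.
  exists K, (1 + K4). split; [unfold K; lra|]. split; [lra|].
  intros n M p l Hn Hl HDp HDl Hcode.
  assert (Hp : 1 <= p) by lra. assert (Hl1 : 1 <= l) by lra.
  assert (HM : (1 <= M)%nat) by apply Hcode.
  assert (HMR : 0 < INR M) by (apply lt_0_INR; lia).
  (* The reserve [l ^ 2 = ln n] makes [exp gam / M] equal to [1 / n]. *)
  set (gam := ln (INR M) - l ^ 2). set (sig := sqrt ((p ^ 3) ^ 2 + INR n * V)).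
  set (w := (gam - INR n * C - p ^ 4) / sig).
  assert (HL : Phi w - cc / p ^ 3 - 2 / (p ^ 4 / p ^ 3) ^ 2 <= 2 * eps + 2 * exp gam / INR M).
  { apply (converse_bound NX NY W1 W2 (PW NX Pstar W1) (PW NX Pstar W2) eta HW1 HW2) with (n := n) (gam := gam).
    - intros y Hy; apply (PW_nonneg NX NY W1 HW1); auto.
    - intros y Hy; apply (PW_nonneg NX NY W2 HW2); auto.
    - intros x y Hx Hy H; apply (Hstarpos true x y); auto; apply in_seq; lia.
    - intros x y Hx Hy H; apply (Hstarpos false x y); auto; apply in_seq; lia.
    - apply (PW_sum NX NY W1 HW1), (is_dist_lsum NX Pstar HPd).
    - apply (PW_sum NX NY W2 HW2), (is_dist_lsum NX Pstar HPd).
    - exact Heta01.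
    - exact Hcode.
    - intros phi Hphi.
      (* With [del = n^(1/4)] and [d = n^(1/3)] both error terms are [O (n^(-1/6))], and the shift
         by [d] stays within the allowed remainder. *)
      eapply Rle_trans; [apply (walk_cdf_lower NX NY W1 W2
        (fun x a b => zmix x a b - C) V Bz HW1 HW2 Hz HV HBz n phi
        (p ^ 3) (p ^ 4) (gam - INR n * C)); auto|].
      + apply (Rle_trans _ (1 ^ 3)); [lra|apply pow_incr; lra].
      + apply pow_lt; lra.
      + apply (Ex_le NX); auto. intros y1 y2 L1 L2 _.
        rewrite (path_sum_affine (fun x a b => zmix x a b - C)
          (dens1 W1 (PW NX Pstar W1)) (dens2 W2 (PW NX Pstar W2)) eta (1 - eta) (- C) phi y1 y2 n)
          by (auto; intros; unfold mixed_dens, dens1, dens2; ring).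
        unfold le_ind. destruct Rle_dec; destruct Rle_dec; lra. }
  assert (Hexp : exp gam / INR M = / p ^ 12).
  { unfold gam, Rminus. rewrite exp_plus, exp_ln, exp_Ropp, <- Hl, exp_ln, Hn by
      (try exact HMR; rewrite Hn; apply pow_lt; lra). field. split; lra. }
  assert (Hpp : 0 < p ^ 2) by nra.
  assert (Hw : Phi w <= 2 * eps + (cc + 4) / p ^ 2).
  { replace ((p ^ 4 / p ^ 3) ^ 2) with (p ^ 2) in HL by (field; lra).
    replace (2 * exp gam / INR M) with (2 * (exp gam / INR M)) in HL by (unfold Rdiv; ring).
    rewrite Hexp in HL. pose proof (inv_pow_le p 2 12 Hp ltac:(lia)).
    pose proof (inv_pow_le p 2 3 Hp ltac:(lia)). unfold Rdiv in *. nra. }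
  assert (Hy : 0 <= K4 / p ^ 2 <= 1).
  { split; [apply Rdiv_le_0_compat; lra|]. apply Rle_div_l; [exact Hpp|]. nra. }
  assert (Hw2 : w <= - q + K4 / p ^ 2).
  { apply Rnot_lt_le; intros H. destruct (Phi_shift q _ Hy) as [_ HS].
    assert (HP := Phi_le _ _ (Rlt_le _ _ H)). rewrite Hq in HS. fold gmin in HS.
    assert (E : gmin * (K4 / p ^ 2) = (cc + 5) / p ^ 2) by (unfold K4; field; split; lra).
    rewrite E in HS. assert (0 < / p ^ 2) by (apply Rinv_0_lt_compat; exact Hpp).
    unfold Rdiv in *. lra. }
  assert (Hp6 : 0 < p ^ 6) by (apply pow_lt; lra).
  assert (Hsig0 : 0 < sig).
  { apply sqrt_lt_R0. rewrite Hn. pose proof (pow_lt p 12 ltac:(lra)). nra. }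
  assert (Hsig : Rabs (sig - p ^ 6 * sv) <= / sv).
  { apply sqrt_near; [nra| |].
    - rewrite Hn. pose proof (pow_lt p 12 ltac:(lra)). nra.
    - rewrite Hn, <- Hsv2. replace ((p ^ 3) ^ 2 + p ^ 12 * sv ^ 2 - (p ^ 6 * sv) ^ 2) with (p ^ 6) by ring.
      rewrite Rabs_right by lra. right; field; lra. }
  assert (Hgam : gam <= INR n * C + p ^ 4 + sig * (- q + K4 / p ^ 2)).
  { assert (E : w * sig = gam - INR n * C - p ^ 4) by (unfold w; field; lra).
    apply (Rmult_le_compat_r sig) in Hw2; [|lra]. lra. }
  assert (H1 : sig * (- q + K4 / p ^ 2) <= - (p ^ 6 * sv * q) + (Rabs q + K4) / sv + sv * K4 * p ^ 4).
  { set (dlt := sig - p ^ 6 * sv) in *.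
    replace sig with (p ^ 6 * sv + dlt) by (unfold dlt; ring).
    replace ((p ^ 6 * sv + dlt) * (- q + K4 / p ^ 2)) with
      (- (p ^ 6 * sv * q) + sv * K4 * p ^ 4 + dlt * (- q + K4 / p ^ 2)) by (field; lra).
    assert (dlt * (- q + K4 / p ^ 2) <= (Rabs q + K4) / sv); [|lra].
    eapply Rle_trans; [apply Rle_abs|]. rewrite Rabs_mult, Rmult_comm. unfold Rdiv at 2.
    apply Rmult_le_compat; try apply Rabs_pos; [|exact Hsig].
    eapply Rle_trans; [apply Rabs_triang|]. rewrite Rabs_Ropp.
    rewrite (Rabs_right (K4 / p ^ 2)) by lra.
    assert (K4 / p ^ 2 <= K4); [|lra]. apply Rle_div_l; [exact Hpp|].
    assert (1 <= p ^ 2) by nra. nra. }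
  assert (Hp4 : 1 <= p ^ 4) by (apply (Rle_trans _ (1 ^ 4)); [lra|apply pow_incr; lra]).
  assert (Hl2 : 1 <= l ^ 2) by nra.
  assert (Hpl : p ^ 4 <= p ^ 4 * l ^ 2) by nra.
  assert (Hpl2 : l ^ 2 <= p ^ 4 * l ^ 2) by nra.
  assert (Hpl1 : 1 <= p ^ 4 * l ^ 2) by nra.
  unfold gam in Hgam. unfold K.
  replace ((2 + (Rabs q + K4) / sv + sv * K4) * p ^ 4 * l ^ 2) with
    (p ^ 4 * l ^ 2 + p ^ 4 * l ^ 2 + (Rabs q + K4) / sv * (p ^ 4 * l ^ 2) + sv * K4 * (p ^ 4 * l ^ 2)) by ring.
  assert ((Rabs q + K4) / sv <= (Rabs q + K4) / sv * (p ^ 4 * l ^ 2)) by nra.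
  assert (sv * K4 * p ^ 4 <= sv * K4 * (p ^ 4 * l ^ 2)) by nra.
  lra.
Qed.

Lemma achievability_asymptotic : exists K D, 0 <= K /\ 1 <= D /\ forall n M p l,
  INR n = p ^ 12 -> ln (INR n) = l ^ 2 -> D <= p -> D <= l -> D * l <= p ^ 2 -> (1 <= M)%nat ->
  ln (INR M) <= INR n * C - p ^ 6 * sv * q - K * p ^ 4 * l ^ 2 ->
  FLF_code_exists NX NY W1 W2 n M eps.
Proof.
  destruct sv_facts as [Hsv Hsv2]. pose proof cc_nonneg as Hcc.
  assert (Hg : 0 < gmin) by apply gauss_pdf_pos.
  assert (Hs0 : 0 < / sv) by (apply Rinv_0_lt_compat; exact Hsv).
  assert (Hq0 : 0 <= Rabs q) by apply Rabs_pos.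
  set (eta0 := Rmin eta (1 - eta)).
  assert (He0 : 0 < eta0) by (apply Rmin_glb_lt; lra).
  (* Chosen so that the exponents of the Chernoff bounds become [- l ^ 2] and [- 2 * l ^ 2], that is
     [1 / n] and [1 / n ^ 2]; the second must also beat the factor [m + 1]. *)
  set (b1 := 2 * B ^ 2 + 1). set (b2 := 4 * B ^ 2 + 2).
  assert (Hb1 : 1 <= b1) by (unfold b1; nra). assert (Hb2 : 2 <= b2) by (unfold b2; nra).
  (* The tilt must recover the first-phase deviation [b1 * p ^ 6 * l] and four further terms of size
     at most [p ^ 6 * l]: curvature, [s2], the offset by [q] and the reserve in [gam]. *)
  set (tau0 := (b1 + 4) / eta0).
  assert (Htau0 : 0 < tau0) by (apply Rdiv_lt_0_compat; lra).
  set (k1 := 2 * kappa * tau0 ^ 2). assert (Hk1 : 0 <= k1) by (unfold k1; nra).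
  set (K1 := 6 + k1 + b2).
  (* The variance loses at most [2 * p ^ 8 * V] to the second phase and gains [p ^ 6] from the
     smoothing; this is the resulting error of the standard deviation in units of [p ^ 2]. *)
  set (K2 := 2 * sv + / sv). assert (HK2 : 0 < K2) by (unfold K2; lra).
  (* In units of [1 / p ^ 2], beyond the [cc] term the outage probability must leave room for 2 from
     the smoothing tail and, after doubling, 32 from [2 * h] and 48 from false alarms; 100 covers
     all of it. *)
  set (K3 := (cc + 100) / gmin). assert (HK3 : 0 < K3) by (apply Rdiv_lt_0_compat; lra).
  set (K := K1 + Rabs q * K2 + (sv + K2) * K3).
  assert (HK : 0 <= K) by (unfold K, K1; assert (0 <= Rabs q * K2) by nra; assert (0 <= (sv + K2) * K3) by nra; lra).
  set (D := 2 + 2 * B + k1 + b2 + Rabs q * sv + K3 + tau0 * (1 + / t0)).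
  assert (Hit0 : 0 < / t0) by (apply Rinv_0_lt_compat; exact Ht0).
  assert (HD0 : 0 <= Rabs q * sv) by nra. assert (HD1 : 0 < tau0 * (1 + / t0)) by nra.
  exists K, D. split; [exact HK|]. split; [unfold D; lra|].
  intros n M p l Hn Hl HDp HDl HDlp HM HlnM.
  assert (Hp : 2 <= p) by (unfold D in HDp; lra). assert (Hl1 : 2 <= l) by (unfold D in HDl; lra).
  assert (HDx : forall x, x <= D -> x * l <= p ^ 2).
  { intros x Hx. apply Rle_trans with (D * l); [apply Rmult_le_compat_r; lra|exact HDlp]. }
  assert (Hpp : 4 <= p ^ 2) by nra.
  assert (Hp3 : 0 < p ^ 3) by (apply pow_lt; lra).
  assert (Hp4 : 1 <= p ^ 4) by (apply (Rle_trans _ (1 ^ 4)); [lra|apply pow_incr; lra]).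
  assert (Hp6 : 1 <= p ^ 6) by (apply (Rle_trans _ (1 ^ 6)); [lra|apply pow_incr; lra]).
  assert (Hp8 : 1 <= p ^ 8) by (apply (Rle_trans _ (1 ^ 8)); [lra|apply pow_incr; lra]).
  assert (Hp12 : 1 <= p ^ 12) by (apply (Rle_trans _ (1 ^ 12)); [lra|apply pow_incr; lra]).
  assert (HMR : 0 < INR M) by (apply lt_0_INR; lia).
  destruct (nat_floor (p ^ 8) ltac:(lra)) as [m0 [Hm1 Hm2]].
  set (m := S m0). assert (Hm : p ^ 8 <= INR m <= 2 * p ^ 8) by (unfold m; rewrite S_INR; lra).
  assert (Hmn : (m <= n)%nat).
  { apply INR_le. rewrite Hn. replace (p ^ 12) with (p ^ 8 * (p ^ 2 * p ^ 2)) by ring.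
    apply Rle_trans with (p ^ 8 * 2); [lra|apply Rmult_le_compat_l; nra]. }
  set (n1 := (n - m)%nat).
  assert (Hn1 : INR n1 + INR m = INR n) by (unfold n1; rewrite minus_INR by exact Hmn; ring).
  assert (Hn10 : 0 <= INR n1) by apply pos_INR.
  replace n with (n1 + m)%nat by (unfold n1; lia).
  set (tau := tau0 * l / p ^ 2).
  assert (Htau : 0 < tau) by (apply Rdiv_lt_0_compat; nra).
  assert (Htaule : tau <= t0 /\ tau <= 1).
  { assert (E1 : tau0 * (1 + / t0) * l <= p ^ 2).
    { apply HDx; unfold D; lra. }
    assert (0 < tau0 * l) by nra. assert (0 < tau0 * l * / t0) by nra.
    split; (apply Rle_div_l; [lra|]).
    - apply (Rmult_le_compat_l t0) in E1; [|lra].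
      replace (t0 * (tau0 * (1 + / t0) * l)) with (t0 * (tau0 * l) + tau0 * l) in E1 by (field; lra). nra.
    - lra. }
  destruct Htaule as [Htt0 Htau1].
  set (s1 := b1 * p ^ 6 * l). set (s2 := b2 * p ^ 4 * l).
  (* Raising the threshold by [2 * l ^ 2] suppresses false alarms by [1 / n ^ 2], enough to absorb
     the number of modes. *)
  set (gam := ln (INR M) + 2 * l ^ 2).
  set (h := 8 / p ^ 2).
  assert (Hmt : INR m * kappa * tau ^ 2 <= k1 * p ^ 4 * l ^ 2).
  { replace (INR m * kappa * tau ^ 2) with (INR m * (kappa * tau0 ^ 2 * l ^ 2 / p ^ 4)) by (unfold tau; field; lra).
    replace (k1 * p ^ 4 * l ^ 2) with (2 * p ^ 8 * (kappa * tau0 ^ 2 * l ^ 2 / p ^ 4)) by (unfold k1; field; lra).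
    apply Rmult_le_compat_r; [|lra]. apply Rdiv_le_0_compat; [|apply pow_lt; lra].
    apply Rmult_le_pos; [nra|nra]. }
  assert (HexpR : exp (- l ^ 2) = / p ^ 12).
  { rewrite exp_Ropp, <- Hl, exp_ln, Hn by (rewrite Hn; lra). reflexivity. }
  assert (Hexp_pow : forall x k, exp x ^ k = exp (INR k * x)).
  { intros x k; induction k as [|k IH]; [simpl; rewrite Rmult_0_l, exp_0; reflexivity|].
    rewrite S_INR. simpl pow. rewrite IH, <- exp_plus. f_equal; ring. }
  assert (Hmtau : tau0 * (p ^ 6 * l) <= INR m * tau).
  { replace (tau0 * (p ^ 6 * l)) with (p ^ 8 * tau) by (unfold tau; field; lra).
    apply Rmult_le_compat_r; lra. }
  assert (X3 : (INR m + 1) * (/ p ^ 12 * / p ^ 12) <= 3 * / p ^ 12).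
  { rewrite <- Rmult_assoc. apply Rmult_le_compat_r; [apply Rlt_le, Rinv_0_lt_compat; lra|].
    apply Rle_div_l; [lra|]. replace (p ^ 12) with (p ^ 8 * p ^ 4) by ring. nra. }
  assert (Hfav : forall e, eta0 <= e ->
    gam <= INR n1 * C - s1 + INR m * C + e * (INR m * tau) - INR m * kappa * tau ^ 2 - s2).
  { intros e He.
    assert (Hpl : 0 < p ^ 6 * l) by nra.
    assert (E1 : (b1 + 4) * (p ^ 6 * l) <= e * (INR m * tau)).
    { replace (b1 + 4) with (eta0 * tau0) by (unfold tau0; field; lra).
      rewrite Rmult_assoc. apply Rmult_le_compat; [lra|apply Rmult_le_pos; lra|exact He|exact Hmtau]. }
    assert (Hp4l : 0 < p ^ 4 * l) by nra.
    assert (E2 : k1 * p ^ 4 * l ^ 2 <= p ^ 6 * l).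
    { assert (k1 * l <= p ^ 2).
      { apply HDx; unfold D; lra. }
      replace (k1 * p ^ 4 * l ^ 2) with (k1 * l * (p ^ 4 * l)) by ring.
      replace (p ^ 6 * l) with (p ^ 2 * (p ^ 4 * l)) by ring. apply Rmult_le_compat_r; lra. }
    assert (E3 : s2 <= p ^ 6 * l).
    { unfold s2. replace (p ^ 6 * l) with (p ^ 2 * (p ^ 4 * l)) by ring. rewrite Rmult_assoc.
      apply Rmult_le_compat_r; [lra|]. assert (b2 <= p) by (unfold D in HDp; lra). nra. }
    assert (E4 : - (p ^ 6 * sv * q) <= p ^ 6 * l).
    { pose proof (Rle_abs (- q)) as HA. rewrite Rabs_Ropp in HA.
      assert (Rabs q * sv <= l) by (unfold D in HDl; lra).
      assert (sv * - q <= l) by nra.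
      replace (- (p ^ 6 * sv * q)) with (p ^ 6 * (sv * - q)) by ring. apply Rmult_le_compat_l; lra. }
    assert (E5 : 2 * l ^ 2 <= p ^ 6 * l).
    { assert (2 * l <= p ^ 2).
      { apply HDx; unfold D; lra. }
      replace (p ^ 6) with (p ^ 2 * p ^ 4) by ring. assert (p ^ 2 * 1 <= p ^ 2 * p ^ 4) by (apply Rmult_le_compat_l; lra). nra. }
    assert (E6 : 0 <= K * p ^ 4 * l ^ 2) by (apply Rmult_le_pos; [apply Rmult_le_pos; lra|nra]).
    assert (E7 : INR n1 * C + INR m * C = INR n * C) by (rewrite <- Hn1; ring).
    unfold gam, s1. rewrite <- E7 in HlnM. lra. }
  apply (achievability_finite n1 m M gam (l / p ^ 6) s1 (l / p ^ 4) s2 tau (p ^ 3) (p ^ 4) h eps); auto.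
  - apply Hshift. rewrite Rabs_right; lra.
  - apply Hshift. rewrite Rabs_Ropp, Rabs_right; lra.
  - apply Rdiv_le_0_compat; lra.
  - assert (Hll : 2 * B * l <= p ^ 2).
    { apply HDx; unfold D; lra. }
    replace (l / p ^ 6 * B) with ((2 * B * l) / (2 * p ^ 6)) by (field; lra).
    apply Rle_div_l; [lra|]. replace (p ^ 6) with (p ^ 2 * p ^ 4) by ring. nra.
  - apply Rdiv_le_0_compat; lra.
  - assert (Hll : 2 * B * l <= p ^ 2).
    { apply HDx; unfold D; lra. }
    replace (l / p ^ 4 * B) with ((2 * B * l) / (2 * p ^ 4)) by (field; lra).
    apply Rle_div_l; [lra|]. replace (p ^ 4) with (p ^ 2 * p ^ 2) by ring. nra.
  - apply Rdiv_lt_0_compat; lra.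
  - rewrite !Hexp_pow, <- !exp_plus.
    assert (X1 : exp (- (l / p ^ 6) * s1 + INR n1 * (2 * (l / p ^ 6) ^ 2 * B ^ 2)) <= / p ^ 12).
    { rewrite <- HexpR. apply exp_le_compat.
      replace (- (l / p ^ 6) * s1) with (- (b1 * l ^ 2)) by (unfold s1; field; lra).
      assert (INR n1 * (2 * (l / p ^ 6) ^ 2 * B ^ 2) <= 2 * B ^ 2 * l ^ 2).
      { replace (2 * B ^ 2 * l ^ 2) with (p ^ 12 * (2 * (l / p ^ 6) ^ 2 * B ^ 2)) by (field; lra).
        apply Rmult_le_compat_r; [|lra].
        pose proof (pow2_ge_0 (l / p ^ 6)). pose proof (pow2_ge_0 B). nra. }
      unfold b1. lra. }
    assert (X2 : exp (- (l / p ^ 4) * s2 + INR m * (2 * (l / p ^ 4) ^ 2 * B ^ 2)) <= / p ^ 12 * / p ^ 12).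
    { rewrite <- HexpR, <- exp_plus. apply exp_le_compat.
      replace (- (l / p ^ 4) * s2) with (- (b2 * l ^ 2)) by (unfold s2; field; lra).
      assert (INR m * (2 * (l / p ^ 4) ^ 2 * B ^ 2) <= 4 * B ^ 2 * l ^ 2).
      { replace (4 * B ^ 2 * l ^ 2) with (2 * p ^ 8 * (2 * (l / p ^ 4) ^ 2 * B ^ 2)) by (field; lra).
        apply Rmult_le_compat_r; [|lra].
        pose proof (pow2_ge_0 (l / p ^ 4)). pose proof (pow2_ge_0 B). nra. }
      unfold b2. lra. }
    assert (X4 : (INR m + 1) * exp (- (l / p ^ 4) * s2 + INR m * (2 * (l / p ^ 4) ^ 2 * B ^ 2)) <=
      (INR m + 1) * (/ p ^ 12 * / p ^ 12)) by (apply Rmult_le_compat_l; lra).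
    pose proof (inv_pow_le p 2 12 ltac:(lra) ltac:(lia)). unfold h, Rdiv in *. lra.
  - apply Hfav. apply Rmin_l.
  - apply Hfav. apply Rmin_r.
  - apply (Rle_trans _ (1 ^ 3)); [lra|apply pow_incr; lra].
  - lra.
  - set (sig := sqrt ((p ^ 3) ^ 2 + INR n1 * V)).
    set (loss := 2 * tau + INR m * kappa * tau ^ 2 + s2 + 2 * p ^ 4).
    assert (Hsig0 : 0 < sig) by (apply sqrt_lt_R0; nra).
    assert (Hsig : Rabs (sig - p ^ 6 * sv) <= K2 * p ^ 2).
    { apply sqrt_near; [nra|nra|]. rewrite <- Hsv2.
      replace (INR n1) with (p ^ 12 - INR m) by lra.
      replace ((p ^ 3) ^ 2 + (p ^ 12 - INR m) * sv ^ 2 - (p ^ 6 * sv) ^ 2) with (p ^ 6 - INR m * sv ^ 2) by ring.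
      replace (K2 * p ^ 2 * (p ^ 6 * sv)) with (2 * p ^ 8 * sv ^ 2 + p ^ 8) by (unfold K2; field; lra).
      assert (p ^ 6 <= p ^ 8) by (apply Rle_pow; [lra|lia]).
      assert (0 < sv ^ 2) by nra. apply Rabs_le; split; nra. }
    assert (Hy : 0 <= K3 / p ^ 2 <= 1).
    { split; [apply Rdiv_le_0_compat; lra|]. apply Rle_div_l; [lra|].
      assert (K3 <= p) by (unfold D in HDp; lra). nra. }
    assert (Hnum : gam - (INR n1 + INR m) * C + loss <= sig * (- q - K3 / p ^ 2)).
    { set (dlt := sig - p ^ 6 * sv) in *.
      replace sig with (p ^ 6 * sv + dlt) by (unfold dlt; ring).
      replace ((p ^ 6 * sv + dlt) * (- q - K3 / p ^ 2)) with
        (- (p ^ 6 * sv * q) - (dlt * q + (p ^ 6 * sv + dlt) * (K3 / p ^ 2))) by (field; lra).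
      assert (Hl2 : 1 <= l ^ 2) by nra.
      assert (U0 : p ^ 4 <= p ^ 4 * l ^ 2) by nra.
      assert (Up : p ^ 2 <= p ^ 4) by (apply Rle_pow; [lra|lia]).
      assert (U1 : dlt * q <= Rabs q * K2 * (p ^ 4 * l ^ 2)).
      { eapply Rle_trans; [apply Rle_abs|]. rewrite Rabs_mult, Rmult_comm, Rmult_assoc.
        apply Rmult_le_compat_l; [exact Hq0|]. nra. }
      assert (U2 : (p ^ 6 * sv + dlt) * (K3 / p ^ 2) <= (sv + K2) * K3 * (p ^ 4 * l ^ 2)).
      { apply Rle_trans with ((p ^ 6 * (sv + K2)) * (K3 / p ^ 2)).
        - apply Rmult_le_compat_r; [lra|]. pose proof (Rle_abs dlt).
          assert (p ^ 2 <= p ^ 6) by (apply Rle_pow; [lra|lia]).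
          assert (K2 * p ^ 2 <= K2 * p ^ 6) by (apply Rmult_le_compat_l; lra). lra.
        - replace (p ^ 6 * (sv + K2) * (K3 / p ^ 2)) with ((sv + K2) * K3 * p ^ 4) by (field; lra).
          apply Rmult_le_compat_l; [nra|exact U0]. }
      assert (U3 : 2 * l ^ 2 + loss <= K1 * (p ^ 4 * l ^ 2)).
      { unfold loss, K1.
        assert (l ^ 2 <= p ^ 4 * l ^ 2) by nra. assert (1 <= p ^ 4 * l ^ 2) by nra.
        assert (s2 <= b2 * (p ^ 4 * l ^ 2)).
        { unfold s2. rewrite Rmult_assoc. apply Rmult_le_compat_l; [lra|]. apply Rmult_le_compat_l; [lra|]. nra. }
        rewrite Rmult_assoc in Hmt. lra. }
      assert (HKe : K * p ^ 4 * l ^ 2 = K1 * (p ^ 4 * l ^ 2) + Rabs q * K2 * (p ^ 4 * l ^ 2) +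
        (sv + K2) * K3 * (p ^ 4 * l ^ 2)) by (unfold K; ring).
      unfold gam. rewrite Hn1. lra. }
    assert (Hphi : Phi ((gam - (INR n1 + INR m) * C + loss) / sig) <= 2 * eps - (cc + 100) / p ^ 2).
    { eapply Rle_trans; [apply (Phi_le _ (- q - K3 / p ^ 2))|].
      - apply Rle_div_l; [exact Hsig0|]. lra.
      - destruct (Phi_shift q _ Hy) as [HS _]. rewrite Hq in HS. fold gmin in HS.
        replace (gmin * (K3 / p ^ 2)) with ((cc + 100) / p ^ 2) in HS by (unfold K3; field; lra).
        exact HS. }
    replace ((p ^ 4 / p ^ 3) ^ 2) with (p ^ 2) by (field; lra).
    assert (Hfa : 8 * (INR m + 1) * exp (- gam) * INR M <= 24 * / p ^ 2).
    { assert (E : exp (- gam) * INR M = / p ^ 12 * / p ^ 12).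
      { rewrite <- HexpR, <- exp_plus. rewrite <- (exp_ln (INR M)) at 1 by exact HMR.
        rewrite <- exp_plus. f_equal. unfold gam. ring. }
      rewrite Rmult_assoc, E.
      pose proof (inv_pow_le p 2 12 ltac:(lra) ltac:(lia)). lra. }
    pose proof (inv_pow_le p 2 3 ltac:(lra) ltac:(lia)) as HI.
    assert (Hcp : cc / p ^ 3 <= cc / p ^ 2) by (apply Rmult_le_compat_l; assumption).
    assert (0 < / p ^ 2) by (apply Rinv_0_lt_compat; lra).
    fold cc. unfold h, Rdiv in *. nra.
Qed.

End Coding.

(** * Existence of the optimal code size and the final estimate *)

Lemma max_nat_exists (P : nat -> Prop) (b : nat) :
  P 1%nat -> (forall k, P k -> (k <= b)%nat) -> exists k, P k /\ forall j, P j -> (j <= k)%nat.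
Proof.
  intros H1 Hb.
  assert (H : forall d, (exists k, P k /\ (b - k <= d)%nat) ->
    exists k, P k /\ forall j, P j -> (j <= k)%nat).
  { induction d as [|d IH]; intros [k [Hk Hd]].
    - exists k; split; [exact Hk|]. intros j Hj; specialize (Hb j Hj); lia.
    - destruct (classic (exists j, P j /\ (k < j)%nat)) as [[j [Hj Hlt]]|HN].
      + apply IH. exists j; split; [exact Hj|]. specialize (Hb j Hj); lia.
      + exists k; split; [exact Hk|]. intros j Hj.
        destruct (le_lt_dec j k) as [|Hlt]; [assumption|]. exfalso; apply HN; exists j; auto. }
  apply (H b). exists 1%nat; split; [exact H1|lia].
Qed.

(** Supplies a nonempty set of code sizes; its boundedness comes from the converse. *)
Lemma one_message_code NX NY W1 W2 n eps : (1 <= NX)%nat -> 0 < eps ->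
  FLF_code_exists NX NY W1 W2 n 1 eps.
Proof.
  intros HNX Heps. split; [lia|].
  exists 1%nat, (fun _ => 1), (fun _ _ _ _ _ => 0%nat), (fun _ => 0%nat), (fun _ => 0%nat).
  assert (E : forall k, err_det NY n 1 W1 W2 (fun _ _ _ _ => 0%nat) k (fun _ => 0%nat) = 0).
  { intros k. rewrite err_det_Ex. simpl. unfold miss. simpl. rewrite Ex_zero. ring. }
  repeat split.
  - intros; lra.
  - simpl; lra.
  - intros; lia.
  - simpl. rewrite E. lra.
  - simpl. rewrite E. lra.
Qed.

Theorem theorem3
  (NX NY : nat) (W1 W2 : nat -> nat -> R) (Pstar : nat -> R) (eta : R)
  (HNX : (1 <= NX)%nat)
  (HW1 : is_channel NX NY W1) (HW2 : is_channel NX NY W2)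
  (* P* maximizes min_k I_k(P), uniquely, and has full support *)
  (HPd : is_dist NX Pstar)
  (HPmax : forall P, is_dist NX P ->
      Rmin (MI NX NY P W1) (MI NX NY P W2) <= Rmin (MI NX NY Pstar W1) (MI NX NY Pstar W2))
  (HPuniq : forall P, is_dist NX P ->
      Rmin (MI NX NY P W1) (MI NX NY P W2) = Rmin (MI NX NY Pstar W1) (MI NX NY Pstar W2) ->
      forall x, (x < NX)%nat -> P x = Pstar x)
  (HPpos : forall x, (x < NX)%nat -> 0 < Pstar x)
  (* V_k > 0 *)
  (HV1 : 0 < disp NX NY Pstar W1) (HV2 : 0 < disp NX NY Pstar W2)
  (* C_k > C, C = min_k I_k(Pstar) *)
  (HC1 : exists P, is_dist NX P /\
      MI NX NY P W1 > Rmin (MI NX NY Pstar W1) (MI NX NY Pstar W2))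
  (HC2 : exists P, is_dist NX P /\
      MI NX NY P W2 > Rmin (MI NX NY Pstar W1) (MI NX NY Pstar W2))
  (* eta is the unique constant in (0,1) with eta dI1 + (1-eta) dI2 = 0 *)
  (Heta01 : 0 < eta < 1)
  (Heta : forall v, sumR NX v = 0 ->
      eta * dI NX NY Pstar W1 v + (1 - eta) * dI NX NY Pstar W2 v = 0)
  (Hetauniq : forall eta', 0 < eta' < 1 ->
      (forall v, sumR NX v = 0 ->
        eta' * dI NX NY Pstar W1 v + (1 - eta') * dI NX NY Pstar W2 v = 0) ->
      eta' = eta)
  (* hypothesis of the theorem: conditional dispersion is constant = V *)
  (Hvar : forall x, (x < NX)%nat ->
      eta ^ 2 * var_dens NX NY Pstar W1 x + (1 - eta) ^ 2 * var_dens NX NY Pstar W2 x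
      = eta ^ 2 * disp NX NY Pstar W1 + (1 - eta) ^ 2 * disp NX NY Pstar W2)
  (eps : R) (Heps : 0 < eps < 1 / 2)
  (qinv : R) (Hq : gauss_tail qinv (2 * eps)) :
  let C := Rmin (MI NX NY Pstar W1) (MI NX NY Pstar W2) in
  let V := eta ^ 2 * disp NX NY Pstar W1 + (1 - eta) ^ 2 * disp NX NY Pstar W2 in
  exists K : R, exists n0 : nat, forall n : nat, (n >= n0)%nat ->
    (exists M, is_Mstar NX NY W1 W2 n eps M) /\
    forall M, is_Mstar NX NY W1 W2 n eps M ->
      Rabs (ln (INR M) - INR n * C + sqrt (INR n * V) * qinv)
        <= K * Rpower (INR n) (1 / 3) * ln (INR n).
Proof.
  intros C V.
  pose proof (MI_balanced NX NY W1 W2 Pstar eta HW1 HW2 HPd HPpos HPmax HC1 HC2 Heta01 Heta) as Hbal.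
  assert (HC : C = MI NX NY Pstar W1) by (unfold C; rewrite <- Hbal; apply Rmin_left; lra).
  destruct (exists_trade_direction NX NY W1 W2 Pstar eta HW1 HW2 HPd HPpos HC1 HC2 Heta01 Heta)
    as [v [Hv [Hd1 Hd2]]].
  assert (HVpos : 0 < V) 
    by (unfold V; apply Rplus_lt_0_compat; (apply Rmult_lt_0_compat; [apply pow_lt; lra|assumption])).
  set (B := 2 * (dens_bound NX NY W1 Pstar + 1) + 2 * (dens_bound NX NY W2 Pstar + 1)).
  pose proof (dens_bound_nonneg NX NY W1 Pstar) as Hb1.
  pose proof (dens_bound_nonneg NX NY W2 Pstar) as Hb2.
  pose proof (curvature_nonneg NX NY W1 Pstar HW1 HPd v) as Hk1.
  pose proof (curvature_nonneg NX NY W2 Pstar HW2 HPd v) as Hk2.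
  set (kappa := curvature NX NY W1 Pstar v + curvature NX NY W2 Pstar v).
  set (t0 := small_shift NX Pstar v).
  assert (Ht0 : 0 < t0) by (apply small_shift_pos; assumption).
  assert (HvL : lsum (seq 0 NX) v = 0) by (rewrite <- sumR_lsum; exact Hv).
  assert (Hshift : forall t, Rabs t <= t0 -> good_shift NX NY W1 W2 Pstar eta v C B kappa t).
  { intros t Ht. pose proof (shifted_is_dist NX Pstar HPd HPpos v t Hv Ht) as HD.
    pose proof (fun x => small_shift_spec NX Pstar HPpos v t x Ht) as Hs.
    pose proof (shifted_dens_bound NX NY W1 Pstar HW1 HPd HPpos v t HD Hs) as S1.
    pose proof (shifted_dens_bound NX NY W2 Pstar HW2 HPd HPpos v t HD Hs) as S2.
    pose proof (MI_shifted_ge NX NY W1 Pstar HW1 HPd HPpos v t HvL HD) as M1.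
    pose proof (MI_shifted_ge NX NY W2 Pstar HW2 HPd HPpos v t HvL HD) as M2.
    rewrite Hd1 in M1. rewrite Hd2 in M2. rewrite <- Hbal in M2. rewrite <- HC in M1, M2.
    pose proof (pow2_ge_0 t).
    repeat split; try exact (proj1 HD); try exact (proj2 HD).
    - intros [|] x y Hx Hy Hp; simpl in *.
      + destruct (S1 x y Hx Hy Hp) as [_ S]. unfold B; lra.
      + destruct (S2 x y Hx Hy Hp) as [_ S]. unfold B; lra.
    - intros [|] x y Hx Hy Hp; simpl in *; [apply (S1 x y Hx Hy Hp)|apply (S2 x y Hx Hy Hp)].
    - unfold kappa. nra.
    - unfold kappa. nra. }
  assert (HMIC : forall k, MI NX NY Pstar (chan W1 W2 k) = C).
  { intros [|]; simpl; [symmetry; exact HC|rewrite <- Hbal; symmetry; exact HC]. }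
  assert (Hstarpos : forall k x b, In x (seq 0 NX) -> In b (seq 0 NY) -> 0 < chan W1 W2 k x b ->
     0 < PW NX Pstar (chan W1 W2 k) b).
  { intros [|] x b Hx Hb Hp; simpl in *; [apply (q_pos NX NY W1 Pstar HW1 HPd HPpos x)|
      apply (q_pos NX NY W2 Pstar HW2 HPd HPpos x)]; auto. }
  assert (Hstar : dens_close NX NY W1 W2 B Pstar).
  { intros k x y Hx Hy Hp.
    assert (HL : Rabs (ln (chan W1 W2 k x y / PW NX Pstar (chan W1 W2 k) y)) <=
      dens_bound NX NY W1 Pstar + dens_bound NX NY W2 Pstar).
    { destruct k; simpl.
      - pose proof (dens_le_bound NX NY W1 Pstar x y Hx Hy); lra.
      - pose proof (dens_le_bound NX NY W2 Pstar x y Hx Hy); lra. }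
    assert (HI : Rabs (MI NX NY Pstar W1) <= dens_bound NX NY W1 Pstar).
    { apply (MI_abs_le NX NY W1 HW1); auto. intros; apply dens_le_bound; auto. }
    rewrite HMIC, HC. unfold Rminus. eapply Rle_trans; [apply Rabs_triang|].
    rewrite Rabs_Ropp. unfold B. lra. }
  assert (HB0 : 0 <= B) by (unfold B; lra).
  assert (Hkap0 : 0 <= kappa) by (unfold kappa; lra).
  set (Bz := mixed_bound NX NY W1 W2 Pstar).
  assert (HBz : 0 <= Bz) by apply mixed_bound_nonneg.
  assert (Hz : walk_law NX NY W1 W2 (fun x a b => mixed_dens NX W1 W2 Pstar eta x a b - C) V Bz).
  { intros x Hx. rewrite HC. repeat split.
    - apply mixed_dens_mean; assumption.
    - rewrite mixed_dens_var by assumption. apply Hvar; exact Hx.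
    - intros a b Ha Hb. apply mixed_dens_bound; assumption. }
  pose proof (gauss_tail_Phi _ _ Hq) as HqP.
  destruct (converse_asymptotic NX NY W1 W2 Pstar eta C V Bz HNX HW1 HW2 HPd Heta01 Hstarpos
    HBz HVpos Hz eps qinv HqP) as [Kc [Dc [HKc [HDc Hconv]]]].
  destruct (achievability_asymptotic NX NY W1 W2 Pstar eta v C V B kappa Bz HNX HW1 HW2
    HPd Heta01 HMIC Hstar Hstarpos HBz HVpos Hz t0 eps qinv Ht0 Hshift HB0 Hkap0 HqP)
    as [Ka [Da [HKa [HDa Hach]]]].
  destruct (eventually_scales (Dc + Da) ltac:(lra)) as [n0 Hn0].
  exists (Kc + Ka + 1), n0. intros n Hn.
  destruct (Hn0 n Hn) as [p [l [Hnp [Hp4 [Hl [HDp [HDl HDlp]]]]]]].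
  assert (Hup : forall M, FLF_code_exists NX NY W1 W2 n M eps ->
    ln (INR M) <= INR n * C - p ^ 6 * sqrt V * qinv + Kc * p ^ 4 * l ^ 2).
  { intros M HM. apply Hconv; auto; lra. }
  assert (Hp1 : 1 <= p ^ 4) by (apply (Rle_trans _ (1 ^ 4)); [lra|apply pow_incr; lra]).
  assert (Hl1 : 1 <= l ^ 2) by nra.
  assert (Hpl : 1 <= p ^ 4 * l ^ 2) by nra.
  split.
  - set (top := exp (INR n * C - p ^ 6 * sqrt V * qinv + Kc * p ^ 4 * l ^ 2)).
    destruct (nat_floor top (Rlt_le _ _ (exp_pos _))) as [b [_ Hb]].
    destruct (max_nat_exists (fun M => FLF_code_exists NX NY W1 W2 n M eps) (S b)) as [M [HM HMmax]].
    + apply one_message_code; lra || assumption.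
    + intros M HM. apply INR_le. rewrite S_INR.
      assert (HMpos : 0 < INR M) by (apply lt_0_INR; destruct HM; lia).
      apply Hup in HM. apply exp_le_compat in HM. rewrite exp_ln in HM by exact HMpos.
      fold top in HM. lra.
    + exists M; split; assumption.
  - intros M [HM HMmax]. specialize (Hup M HM).
    assert (Hsq : sqrt (INR n * V) = p ^ 6 * sqrt V).
    { rewrite sqrt_mult by (try apply pos_INR; lra). f_equal.
      rewrite Hnp. replace (p ^ 12) with ((p ^ 6) ^ 2) by ring. apply sqrt_pow2, pow_le; lra. }
    rewrite Hsq, Hp4, Hl.
    assert (HMpos : 1 <= INR M) by (apply (le_INR 1); apply HM).
    assert (HlnM0 : 0 <= ln (INR M)) by (rewrite <- ln_1; apply ln_le; lra).
    set (target := INR n * C - p ^ 6 * sqrt V * qinv - Ka * p ^ 4 * l ^ 2).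
    (* The loss of 1 pays for rounding [exp target] down to an integer. When [target <= 1] it is
       absorbed by [ln M >= 0]; otherwise rounding costs less than a factor [exp 1]. *)
    assert (Hlow : target - 1 <= ln (INR M)).
    { destruct (Rle_dec target 1) as [Q|Q]; [lra|]. apply Rnot_le_lt in Q.
      destruct (nat_floor (exp target) (Rlt_le _ _ (exp_pos _))) as [k [Hk1' Hk2']].
      assert (He : 1 + target <= exp target) by apply exp_ineq1_le.
      assert (Hk : 1 < INR k) by lra.
      assert (Hcode : FLF_code_exists NX NY W1 W2 n k eps).
      { apply (Hach n k p l); auto; try lra.
        - assert (0 <= l) by nra. nra.
        - apply INR_le. simpl; lra.
        - fold target. rewrite <- (ln_exp target). apply ln_le; lra. }
      assert (HkM : INR k <= INR M) by (apply le_INR, HMmax, Hcode).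
      assert (Hexp1 : exp (target - 1) <= INR k).
      { unfold Rminus. rewrite exp_plus. 
        assert (exp (- (1)) <= / 2).
        { rewrite exp_Ropp. apply Rinv_le_contravar; [lra|]. pose proof (exp_ineq1_le 1). lra. }
        pose proof (exp_pos target). nra. }
      rewrite <- (ln_exp (target - 1)). apply ln_le; [apply exp_pos|lra]. }
    unfold target in Hlow. apply Rabs_le.
    replace ((Kc + Ka + 1) * p ^ 4 * l ^ 2) with
      (Kc * (p ^ 4 * l ^ 2) + Ka * (p ^ 4 * l ^ 2) + p ^ 4 * l ^ 2) by ring.
    rewrite Rmult_assoc in Hup. rewrite (Rmult_assoc Ka) in Hlow.
    assert (0 <= Kc * (p ^ 4 * l ^ 2)) by nra. assert (0 <= Ka * (p ^ 4 * l ^ 2)) by nra.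
    lra.
Qed.
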